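(* Let $V_1 = \left(\frac{2}{3}\right)^6$ and $V_2 = \frac14$. For $V\in(0,\frac12]$, call $[0,V^{1/3}]^3$ the cube of volume $V$, $[0,V^{1/2}]^2\times[0,1]$ the tube of volume $V$, and $[0,V]\times[0,1]^2$ the slab of volume $V$. Consider the cubical subsets of $[0,1]^3$ of volume $V \in (0,\frac12]$ that are minimizers of relative perimeter (among all cubical subsets of $[0,1]^3$ of volume $V$). The following are true up to isometries of $[0,1]^3$ or sets of measure zero: (1) If $V < V_1$, then the only minimizer is the cube of volume $V$. (2) If $V = V_1$, then the only minimizers are the cube and the tube of volume $V_1$. (3) If $V_1 < V < V_2$, then the only minimizer is the tube of volume $V$. (4) If $V = V_2$, then the only minimizers are the tube and the slab of volume $V_2$. (5) If $V > V_2$, then the only minimizer is the slab of volume $V$.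
   Context: $[0,1]^n \subset \mathbb{R}^n$ carries the Euclidean metric, and $e_1,\dots,e_n$ is the standard basis of $\mathbb{R}^n$. A compact subset $X \subset [0,1]^n$ is called cubical if its boundary is contained in the union of finitely many hyperplanes, all of whose outer normal vectors lie in $\{\pm e_1,\dots,\pm e_n\}$. Volume is $n$-dimensional Lebesgue measure. For a measurable set $U \subset [0,1]^n$ of locally finite perimeter, the relative perimeter of $U$ is the $(n-1)$-dimensional Hausdorff measure of the part of the essential boundary of $U$ that does not lie on $\partial [0,1]^n$. *)

(* Defs.v *)
From mathcomp Require Import all_boot all_order all_algebra.
From mathcomp Require Import all_classical all_reals all_analysis.

Set Implicit Arguments.
Unset Strict Implicit.
Unset Printing Implicit Defensive.

Import Order.TTheory GRing.Theory Num.Theory.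
Import numFieldNormedType.Exports.

Local Open Scope classical_set_scope.
Local Open Scope ring_scope.

Section Euclidean.
Context {R : realType} {n : nat}.
Implicit Types (x y a : 'rV[R]_n) (A X : set 'rV[R]_n) (f : 'rV[R]_n -> 'rV[R]_n).

(* The library norm on 'rV[R]_n is the sup norm: it induces the right topology
   but not the Euclidean metric, which is needed for diameters, balls and
   isometries. *)
Definition eucl_dist x y : R := Num.sqrt (\sum_(i < n) (x 0 i - y 0 i) ^+ 2).

Definition eucl_ball x (r : R) : set 'rV[R]_n := [set y | eucl_dist x y < r].

(* 0 for the empty set, +oo for unbounded sets *)
Definition eucl_diam A : \bar R :=
  Order.max 0%E (ereal_sup [set (eucl_dist x y)%:E | x in A & y in A]).

Definition boundary A : set 'rV[R]_n := closure A `\` interior A.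

Definition box a : set 'rV[R]_n := [set x | forall i, 0 <= x 0 i <= a 0 i].

Definition unit_cube : set 'rV[R]_n := box (const_mx 1).

(* A hyperplane with normal vectors +e_i, -e_i is [set x | x 0 i = c]. *)
Definition cubical X : Prop :=
  [/\ X `<=` unit_cube, compact X &
      exists s : seq ('I_n * R),
        boundary X `<=` [set x | exists2 h, h \in s & x 0 h.1 = h.2]].

Definition cube_isometry f : Prop :=
  f @` unit_cube = unit_cube /\
  {in unit_cube &, forall x y, eucl_dist (f x) (f y) = eucl_dist x y}.

(* Two-dimensional Hausdorff measure; pi / 4 is the usual normalization
   (area of the unit disc divided by 2 ^ 2). *)
Definition hausdorff2_delta (delta : R) A : \bar R :=
  ereal_inf [set (\sum_(0 <= k <oo) ((pi / 4)%:E * eucl_diam (F k) ^+ 2))%E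
            | F in [set F : nat -> set 'rV[R]_n |
                     A `<=` \bigcup_k F k /\
                     forall k, (eucl_diam (F k) <= delta%:E)%E]].

Definition hausdorff2 A : \bar R :=
  ereal_sup [set hausdorff2_delta delta A | delta in [set d : R | 0 < d]].

End Euclidean.

Section Space.
Context {R : realType}.
Local Notation space := 'rV[R]_3.
Implicit Types (U X Y : set space) (V : R).

Definition row3 (a b c : R) : space := \row_(i < 3) [:: a; b; c]`_i.

(* Three-dimensional Lebesgue measure, as a product measure transported along
   the bijection row3 from R * R * R. *)
Definition volume U : \bar R :=
  ((@lebesgue_measure R \x @lebesgue_measure R) \x @lebesgue_measure R)%E
    [set p : R * R * R | U (row3 p.1.1 p.1.2 p.2)].

Definition has_density U (x : space) (t : R) : Prop :=
  fine (volume (U `&` eucl_ball x r)) / fine (volume (eucl_ball x r))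
    @[r --> 0^'+] --> t.

Definition essential_boundary U : set space :=
  [set x | ~ has_density U x 0 /\ ~ has_density U x 1].

Definition relative_perimeter U : \bar R :=
  hausdorff2 (essential_boundary U `\` boundary unit_cube).

Definition cubical_of_volume V : set (set space) :=
  [set X | cubical X /\ volume X = V%:E].

Definition minimizer V : set (set space) :=
  [set X | cubical_of_volume V X /\
           forall Y, cubical_of_volume V Y ->
             (relative_perimeter X <= relative_perimeter Y)%E].

(* Equality up to an isometry of the unit cube and a set of measure zero. *)
Definition equivalent X Y : Prop :=
  exists2 f : space -> space, cube_isometry f & volume (X `+` f @` Y) = 0%E.

Definition only_minimizers V (L : set (set space)) : Prop :=
  L `<=` minimizer V /\
  forall X, minimizer V X -> exists2 Y, L Y & equivalent X Y.

Definition cube V : set space :=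
  box (row3 (V `^ 3^-1) (V `^ 3^-1) (V `^ 3^-1)).

Definition tube V : set space := box (row3 (V `^ 2^-1) (V `^ 2^-1) 1).

Definition slab V : set space := box (row3 V 1 1).

End Space.

(* Main.v *)
(* The boundary of a cubical set lies in finitely many axis-parallel planes, so
   up to a null set it is a union of cells of a finite grid, and its essential
   boundary contains every face separating a cell inside from a cell outside.
   Only scaling, finite subadditivity and additivity on separated sets of the
   Hausdorff measure enter: areas of rectangles are compared with the measure c
   of a unit square, 0 < c < oo, whose exact value is irrelevant.

   For unions of grid cells of volume V, slice in one direction, and let v be
   the area of a slice.  In the square, counting rows and columns that are full
   or empty gives perimeter >= J v := min (2 sqrt v, 1, 2 sqrt (1 - v)).  The faces
   orthogonal to the slicing direction have area at least M - m, the oscillation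
   of v, so the area is at least mean (J v) + M - m.  J is concave, so the mean
   is smallest when v takes only the values m and M; keeping the proportions of
   the two values fixed, the bound is again concave in (m, M), and the minimum
   is attained when v is constant or at m = 0 or M = 1.  There it is
   min (3 V^(2/3), 2 V^(1/2), 1), and following the equality cases (J v / v is
   strictly decreasing) through the slices shows that the set is a product of
   intervals with an end in a face of the cube. *)
Require Import Defs.
From mathcomp Require Import all_boot all_order all_algebra all_fingroup.
From mathcomp Require Import all_classical all_reals all_analysis.
From mathcomp Require Import ring lra zify.

Set Implicit Arguments.
Unset Strict Implicit.
Unset Printing Implicit Defensive.

Import Order.TTheory GRing.Theory Num.Theory.
Import numFieldNormedType.Exports.

Local Open Scope classical_set_scope.
Local Open Scope ring_scope.

(** * Isoperimetric profiles of the square and the cube *)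

(** Uniqueness shapes the argument: every estimate has to be kept together with its equality case.
    Concavity of J alone gives no strictness, since J is constant on [1/4, 3/4]; strictness comes
    from J(0) = 0, which makes J(v)/v strictly decreasing. That the volume is at most 1/2 matters
    for two reasons: it removes the complement of a corner square from the optimal slices, and it
    disposes of the end M = 1 with m > 0, where the complement has volume at least 1/2 and the bound
    exceeds 1. On the analytic side, faces of neighbouring cells touch, whereas additivity of the
    Hausdorff measure is established here only for sets at positive distance. Faces and squares are
    therefore shrunk by a small margin before their areas are added, and the margin then tends to
    0. *)

Section Profile.
Context {R : rcfType}.
Implicit Types v m M V q t x : R.

(** The three terms are the relative perimeters of a corner square, a strip and the complement of a
    corner square of area [v], respectively [1 - v] for the removed square. *)
Definition profile2 v : R :=
  Num.min (2 * Num.sqrt v) (Num.min 1 (2 * Num.sqrt (1 - v))).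

(** [q] stands for the cube root of [V]; the terms are the areas of the cube, the tube and the slab.
    Keeping [q] as an argument leaves only polynomial relations and square roots. *)
Definition profile3 q V : R :=
  Num.min (3 * q ^+ 2) (Num.min (2 * Num.sqrt V) 1).

Lemma profile2_le v :
  [/\ profile2 v <= 2 * Num.sqrt v, profile2 v <= 1 & profile2 v <= 2 * Num.sqrt (1 - v)].
Proof. by rewrite /profile2 !ge_min !lexx !orbT. Qed.

Lemma profile2_ge v x : x <= 2 * Num.sqrt v -> x <= 1 -> x <= 2 * Num.sqrt (1 - v) ->
  x <= profile2 v.
Proof. by rewrite /profile2 !le_min => -> -> ->. Qed.

Lemma profile2_gt v x : x < 2 * Num.sqrt v -> x < 1 -> x < 2 * Num.sqrt (1 - v) ->
  x < profile2 v.
Proof. by rewrite /profile2 !lt_min => -> -> ->. Qed.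

Lemma profile3_le q V :
  [/\ profile3 q V <= 3 * q ^+ 2, profile3 q V <= 2 * Num.sqrt V & profile3 q V <= 1].
Proof. by rewrite /profile3 !ge_min !lexx !orbT. Qed.

Lemma profile2N v : profile2 (1 - v) = profile2 v.
Proof.
suff h x : profile2 (1 - x) <= profile2 x.
  by apply/eqP; rewrite eq_le h -[X in profile2 X <= _](subKr 1) h.
have [h1 h2 h3] := profile2_le (1 - x); rewrite subKr in h3.
exact: profile2_ge.
Qed.

Lemma profile2_ge0 v : 0 <= v <= 1 -> 0 <= profile2 v.
Proof. by move=> _; apply: profile2_ge; rewrite ?mulr_ge0 ?sqrtr_ge0. Qed.

Lemma profile20 : profile2 0 = 0.
Proof.
apply/eqP; rewrite eq_le; have [h _ _] := profile2_le 0.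
by rewrite (le_trans h) ?sqrtr0 ?mulr0//= profile2_ge0// lexx ler01.
Qed.

Lemma profile21 : profile2 1 = 0.
Proof. by rewrite -profile2N subrr profile20. Qed.

Lemma sqrt_concave (a b t : R) : 0 <= a -> 0 <= b -> 0 <= t <= 1 ->
  (1 - t) * Num.sqrt a + t * Num.sqrt b <= Num.sqrt ((1 - t) * a + t * b).
Proof.
move=> a0 b0 /andP[t0 t1]; set x := Num.sqrt a; set y := Num.sqrt b.
have ax : a = x ^+ 2 by rewrite sqr_sqrtr.
have bE : b = y ^+ 2 by rewrite sqr_sqrtr.
have x0 : 0 <= x by exact: sqrtr_ge0.
have y0 : 0 <= y by exact: sqrtr_ge0.
have c0 : 0 <= (1 - t) * a + t * b by rewrite addr_ge0 ?mulr_ge0 ?subr_ge0.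
rewrite -ler_sqr ?nnegrE ?sqrtr_ge0 ?addr_ge0 ?mulr_ge0 ?subr_ge0//.
rewrite sqr_sqrtr// ax bE -subr_ge0.
have -> : (1 - t) * x ^+ 2 + t * y ^+ 2 - ((1 - t) * x + t * y) ^+ 2 =
  (1 - t) * t * (x - y) ^+ 2 by ring.
by rewrite mulr_ge0 ?sqr_ge0// mulr_ge0// subr_ge0.
Qed.

Lemma profile2_concave m M t : 0 <= m <= 1 -> 0 <= M <= 1 -> 0 <= t <= 1 ->
  (1 - t) * profile2 m + t * profile2 M <= profile2 ((1 - t) * m + t * M).
Proof.
move=> /andP[m0 m1] /andP[M0 M1] t01; have [a1 a2 a3] := profile2_le m.
have [b1 b2 b3] := profile2_le M; have /andP[t0 t1] := t01.
have t1' : 0 <= 1 - t by rewrite subr_ge0.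
apply: profile2_ge.
- have := sqrt_concave m0 M0 t01.
  have := ler_wpM2l t1' a1; have := ler_wpM2l t0 b1; lra.
- have := ler_wpM2l t1' a2; have := ler_wpM2l t0 b2; lra.
- have m0' : 0 <= 1 - m by rewrite subr_ge0.
  have M0' : 0 <= 1 - M by rewrite subr_ge0.
  have := sqrt_concave m0' M0' t01.
  have -> : (1 - t) * (1 - m) + t * (1 - M) = 1 - ((1 - t) * m + t * M) by ring.
  have := ler_wpM2l t1' a3; have := ler_wpM2l t0 b3; lra.
Qed.

(** Each of the three terms of [profile2], divided by its argument, is strictly decreasing; the
    statement is cross-multiplied. This is the source of strictness in the equality analysis. *)
Lemma profile2_ratio v M : 0 < v -> v < M -> M <= 1 -> v * profile2 M < M * profile2 v.
Proof.
move=> v0 vM M1; have M0 : 0 < M by exact: lt_trans vM.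
have [h1 h2 h3] := profile2_le M.
have -> : v * profile2 M = M * (profile2 M * (v / M)).
  by field; rewrite gt_eqF.
rewrite ltr_pM2l//.
have hM : v / M < 1 by rewrite ltr_pdivrMr// mul1r.
have hM0 : 0 < v / M by rewrite divr_gt0.
have J0 : 0 <= profile2 M by apply: profile2_ge0; rewrite ltW.
apply: profile2_gt.
- have sv : Num.sqrt v < Num.sqrt M by rewrite ltr_sqrt.
  have sv0 : 0 < Num.sqrt v by rewrite sqrtr_gt0.
  have sv2 : Num.sqrt v ^+ 2 = v by rewrite sqr_sqrtr// ltW.
  have sM2 : Num.sqrt M ^+ 2 = M by rewrite sqr_sqrtr// ltW.
  apply: (@le_lt_trans _ _ (2 * Num.sqrt M * (v / M))); first by rewrite ler_wpM2r// ltW.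
  rewrite mulrA ltr_pdivrMr// -[X in _ * X < _]sv2 -[X in _ < _ * X]sM2.
  set x := Num.sqrt v in sv sv0 *; set y := Num.sqrt M in sv *.
  have -> : 2 * y * x ^+ 2 = 2 * x * (x * y) by ring.
  have y0 : 0 < y by exact: lt_trans sv.
  by rewrite ltr_pM2l ?mulr_gt0// expr2 ltr_pM2r.
- apply: le_lt_trans hM; rewrite -[leRHS]mul1r; apply: ler_wpM2r => //; exact: ltW.
- apply: (@le_lt_trans _ _ (profile2 M)).
    by rewrite -[leRHS]mulr1 ler_wpM2l// ltW.
  apply: le_lt_trans h3 _; rewrite ltr_pM2l// ltr_sqrt ?subr_gt0 ?ltrD2l ?ltrN2//.
  exact: lt_le_trans vM M1.
Qed.

Lemma sqr_ltW t x : 0 <= x -> t ^+ 2 < x ^+ 2 -> t < x.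
Proof.
move=> x0; apply: contraTT; rewrite -!leNgt => xt.
by rewrite ler_sqr ?nnegrE// (le_trans x0).
Qed.

Lemma sqr_leW t x : 0 <= x -> t ^+ 2 <= x ^+ 2 -> t <= x.
Proof.
move=> x0; apply: contraTT; rewrite -!ltNge => xt.
by rewrite ltr_sqr ?nnegrE// ltW// (le_lt_trans x0).
Qed.

Lemma sqrt_quarter_le M : 1 / 4 <= M -> 1 <= 2 * Num.sqrt M.
Proof.
move=> M4; have M0 : 0 <= M by lra.
rewrite -ler_sqr ?nnegrE ?mulr_ge0 ?sqrtr_ge0// exprMn sqr_sqrtr// expr1n -natrX; lra.
Qed.

Lemma sqrt_quarter_ge M : 0 <= M -> M <= 1 / 4 -> 2 * Num.sqrt M <= 1.
Proof.
move=> M0 M4.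
rewrite -ler_sqr ?nnegrE ?mulr_ge0 ?sqrtr_ge0// exprMn sqr_sqrtr// expr1n -natrX; lra.
Qed.

Lemma profile2_small M : 0 <= M <= 1 / 4 -> profile2 M = 2 * Num.sqrt M.
Proof.
move=> /andP[M0 M4]; have h := sqrt_quarter_ge M0 M4.
have [h1 h2 h3] := profile2_le M; apply/eqP; rewrite eq_le h1 /=.
by apply: profile2_ge => //; apply: le_trans h _; apply: sqrt_quarter_le; lra.
Qed.

Lemma profile2_mid M : 1 / 4 <= M <= 3 / 4 -> profile2 M = 1.
Proof.
move=> /andP[M0 M4]; have [h1 h2 h3] := profile2_le M.
by apply/eqP; rewrite eq_le h2; apply: profile2_ge => //; apply: sqrt_quarter_le; lra.
Qed.

(** The bound for sets whose slices all have area [V]. As [1 - V >= 1 / 4], the term of the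
    complement is at least 1, the area of the slab. *)
Lemma profile3_le_profile2 q V : V <= 1 / 2 -> profile3 q V <= profile2 V.
Proof.
move=> V2; have [h1 h2 h3] := profile3_le q V; apply: profile2_ge => //.
by apply: le_trans h3 _; apply: sqrt_quarter_le; lra.
Qed.

(** The bound when slices have area 0 or [M] only: a proportion [V / M] of them has perimeter at
    least [profile2 M], and the faces orthogonal to the slicing direction add [M]. Its candidates
    for a minimum are the square of the cube root of [V] (cube), the square root of [V] (tube) and 1
    (slab). *)
Definition slab_bound V M := V * profile2 M / M + M.

(** Meant for complements, whose volume is at least 1/2: slice areas [m] and 1 become 0 and [1 - m]
    there. *)
Lemma slab_bound_large V M : 1 / 2 <= V -> V <= M -> M < 1 -> 1 < slab_bound V M.
Proof.
move=> V2 VM M1; rewrite /slab_bound; have M0 : 0 < M by lra.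
have [M34|M34] := leP M (3 / 4).
  rewrite profile2_mid; last by apply/andP; split; lra.
  by rewrite mulr1 -ltrBlDr ltr_pdivlMr//; nra.
rewrite -(profile2N M) profile2_small; last by apply/andP; split; lra.
set s := Num.sqrt (1 - M).
have s0 : 0 < s by rewrite sqrtr_gt0; lra.
have Ms : M = 1 - s ^+ 2 by rewrite /s sqr_sqrtr; lra.
rewrite -ltrBlDr ltr_pdivlMr//.
have -> : 1 - M = s ^+ 2 by lra.
rewrite expr2 -mulrA.
have -> : V * (2 * s) = s * (2 * V) by ring.
rewrite ltr_pM2l//.
have s1 : s < 1 by apply: sqr_ltW; rewrite ?expr1n; lra.
by apply: (@lt_le_trans _ _ 1); [nra|lra].
Qed.

(** On each range where [profile2] has a single expression the excess is explicit. With y the root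
    of [M], it is (y - q)^2 (y + 2q) / y over the cube for [M < 1 / 4]; with r the root of [V], it
    is (M - r)^2 / M over the tube on [1/4, 3/4]. The range 3/4 < M < 1 is never optimal, and
    [M = 1] gives the slab. *)
Lemma slab_bound_ge q V M : 0 < V -> V <= 1 / 2 -> 0 < q -> q ^+ 3 = V ->
  V <= M -> M <= 1 ->
  profile3 q V <= slab_bound V M /\
  (slab_bound V M <= profile3 q V ->
    [\/ M = 1 /\ profile3 q V = 1,
        [/\ M = Num.sqrt V, profile3 q V = 2 * Num.sqrt V & 1 / 4 <= M] |
        [/\ M = q ^+ 2, profile3 q V = 3 * q ^+ 2 & M <= 1 / 4]]).
Proof.
move=> V0 V2 q0 qV VM M1; rewrite /slab_bound.
have M0 : 0 < M by exact: lt_le_trans VM.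
have [h1 h2 h3] := profile3_le q V; set T := profile3 q V in h1 h2 h3 *.
set r := Num.sqrt V in h2 *.
have r0 : 0 < r by rewrite sqrtr_gt0.
have Vr : V = r ^+ 2 by rewrite sqr_sqrtr// ltW.
have [M4|M4] := ltP M (1 / 4).
  rewrite profile2_small; last by apply/andP; split; lra.
  set y := Num.sqrt M.
  have y0 : 0 < y by rewrite sqrtr_gt0.
  have My : M = y ^+ 2 by rewrite sqr_sqrtr// ltW.
  have e : V * (2 * y) / M + M - 3 * q ^+ 2 = (y - q) ^+ 2 * (y + 2 * q) / y.
    by rewrite My -qV; field; rewrite gt_eqF.
  have e0 : 0 <= (y - q) ^+ 2 * (y + 2 * q) / y.
    rewrite divr_ge0 ?(ltW y0)// mulr_ge0 ?sqr_ge0//; lra.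
  split; first lra.
  move=> h4; apply: Or33.
  have : (y - q) ^+ 2 * (y + 2 * q) / y = 0 by lra.
  move=> /eqP; rewrite mulf_eq0 invr_eq0 (gt_eqF y0) orbF mulf_eq0 sqrf_eq0.
  have /gt_eqF-> : 0 < y + 2 * q by lra.
  rewrite orbF subr_eq0 => /eqP yq.
  by split; [rewrite My yq | lra | lra].
have [M34|M34] := leP M (3 / 4).
  rewrite profile2_mid; last by apply/andP; split.
  have e : V * 1 / M + M - 2 * r = (M - r) ^+ 2 / M.
    by rewrite Vr; field; rewrite gt_eqF.
  have e0 : 0 <= (M - r) ^+ 2 / M by rewrite divr_ge0 ?sqr_ge0// ltW.
  split; first lra.
  move=> h4; apply: Or32.
  have : (M - r) ^+ 2 / M = 0 by lra.
  move=> /eqP; rewrite mulf_eq0 invr_eq0 (gt_eqF M0) orbF sqrf_eq0 subr_eq0 => /eqP Mr.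
  by split => //; lra.
have [M1'|M1'] := ltP M 1; last first.
  have -> : M = 1 by lra.
  rewrite profile21 mulr0 mul0r add0r; split => //.
  by move=> h; apply: Or31; split => //; lra.
suff h : T < V * profile2 M / M + M by split; [exact: ltW|rewrite leNgt h].
rewrite -(profile2N M) profile2_small; last by apply/andP; split; lra.
set s := Num.sqrt (1 - M).
have s0 : 0 < s by rewrite sqrtr_gt0; lra.
have Ms : M = 1 - s ^+ 2 by rewrite /s sqr_sqrtr; lra.
have s1 : s < 1 / 2 by apply: sqr_ltW; rewrite ?expr_div_n ?expr1n -?natrX; lra.
(* Here M = 1 - s^2 with s < 1/2; the competitor is the tube if [V <= 1 / 4] and the slab
   otherwise. *)
have [V4|V4] := leP V (1 / 4).
  apply: le_lt_trans h2 _.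
  have r2 : r <= 1 / 2 by apply: sqr_leW; rewrite ?expr_div_n ?expr1n -?natrX; lra.
  have k1 : r * (1 - s) <= M - r by rewrite Ms; nra.
  have k2 : r ^+ 2 * (1 - s) ^+ 2 <= (M - r) ^+ 2.
    have k0 : 0 <= r * (1 - s) by rewrite mulr_ge0 ?(ltW r0)//; lra.
    by rewrite -exprMn ler_sqr ?nnegrE// (le_trans k0).
  rewrite -subr_gt0.
  have -> : V * (2 * s) / M + M - 2 * r = ((M - r) ^+ 2 - r ^+ 2 * (1 - s) ^+ 2 + r ^+ 2 * s ^+ 2) / M.
    by rewrite Vr; field; rewrite gt_eqF.
  rewrite divr_gt0// ltr_wpDl ?subr_ge0// mulr_gt0// exprn_gt0//.
apply: le_lt_trans h3 _.
rewrite -ltrBlDr ltr_pdivlMr//.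
have -> : 1 - M = s ^+ 2 by lra.
rewrite expr2 -mulrA.
have -> : V * (2 * s) = s * (2 * V) by ring.
rewrite ltr_pM2l//; nra.
Qed.

(* The pair [(m, M)] lies between [(V, V)] and [(0, V / t)], where the slab bound
   applies; concavity in between is strict because of [profile2_ratio]. *)
Lemma two_values_half T V m M t : 0 < V < 1 -> 0 < m -> m < V -> V < M -> M <= 1 ->
  T <= profile2 V -> (forall X, V <= X -> X <= 1 -> T <= slab_bound V X) ->
  0 < t < 1 -> (1 - t) * m + t * M = V -> (M - V) * V <= (V - m) * (1 - V) ->
  T < (1 - t) * profile2 m + t * profile2 M + (M - m).
Proof.
move=> /andP[V0 V1] m0 mV VM M1 TV TX /andP[t0 t1] tV le_lam.
(* [l] is the weight with m = (1 - l) V + l 0; the constraint on the mean then gives M = (1 - l) V +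
   l X. *)
set l := 1 - m / V; set X := V / t.
have l0 : 0 < l by rewrite /l subr_gt0 ltr_pdivrMr// mul1r.
have l1 : l < 1 by rewrite /l ltrBlDr ltrDl divr_gt0.
have lV : l * V = V - m by rewrite /l mulrBl mul1r divfK ?gt_eqF.
have tX : t * X = V by rewrite /X mulrCA divff ?mulr1// gt_eqF.
have tMm : t * (M - m) = V - m by lra.
have Mm : M - m = l * X.
  by apply: (@mulfI _ t); rewrite ?gt_eqF// tMm mulrCA tX.
have Xge : V <= X by rewrite /X ler_pdivlMr//; nra.
(* Since t (M - m) = V - m, the hypothesis [le_lam] says exactly that [V <= t]. *)
have Xle : X <= 1.
  rewrite /X ler_pdivrMr// mul1r -(@ler_pM2r _ (M - m)); last lra.
  by rewrite tMm; nra.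
have hX := TX X Xge Xle.
have X0 : 0 < X by exact: lt_le_trans Xge.
have hm : (1 - l) * profile2 V < profile2 m.
  have := profile2_ratio m0 mV (ltW V1).
  have -> : 1 - l = m / V by rewrite /l; ring.
  by rewrite mulrAC ltr_pdivrMr// [X in _ < X]mulrC.
have hM : (1 - l) * profile2 V + l * profile2 X <= profile2 M.
  have -> : M = (1 - l) * V + l * X by lra.
  by apply: profile2_concave; apply/andP; split=> //; exact: ltW.
have hX' : l * T <= l * (t * profile2 X) + (M - m).
  rewrite Mm -mulrDr ler_pM2l//.
  apply: le_trans hX _; rewrite /slab_bound lerD2r -[Z in Z * _ / _]tX.
  have -> // : t * X * profile2 X / X = t * profile2 X.
  by field; rewrite gt_eqF.
have hV : (1 - l) * T <= (1 - l) * profile2 V by rewrite ler_pM2l// subr_gt0.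
have k1 : (1 - t) * ((1 - l) * profile2 V) < (1 - t) * profile2 m.
  by rewrite ltr_pM2l// subr_gt0.
have k2 : t * ((1 - l) * profile2 V + l * profile2 X) <= t * profile2 M by rewrite ler_pM2l.
lra.
Qed.

(** The line from (V, V) through (m, M) leaves the unit square at m = 0 or at M = 1. The first case
    is [two_values_half]; the second becomes the first after v is replaced by 1 - v, where
    [slab_bound_large] supplies the bound. *)
Lemma two_values q V m M t : 0 < V -> V <= 1 / 2 -> 0 < q -> q ^+ 3 = V ->
  0 < m -> m < V -> V < M -> M <= 1 -> 0 < t < 1 -> (1 - t) * m + t * M = V ->
  profile3 q V < (1 - t) * profile2 m + t * profile2 M + (M - m).
Proof.
move=> V0 V2 q0 qV m0 mV VM M1 t01 tV; have V1 : V < 1 by lra.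
have hV := profile3_le_profile2 q V2; have [_ _ hT] := profile3_le q V.
have /andP[t0 t1] := t01.
have [hl|hl] := leP ((M - V) * V) ((V - m) * (1 - V)).
  apply: (@two_values_half _ V) => //; first by rewrite V0.
  by move=> X VX X1; have [] := slab_bound_ge V0 V2 q0 qV VX X1.
(* For M = 1 the complementary pair already has 0 as its smaller value, and its bound is
   [slab_bound (1 - V) (1 - m)] itself. *)
have [M1'|M1'] := ltP M 1; last first.
  have M1e : M = 1 by lra.
  apply: le_lt_trans hT _; rewrite M1e profile21 mulr0 addr0 -profile2N.
  have : 1 < slab_bound (1 - V) (1 - m) by apply: slab_bound_large; lra.
  rewrite /slab_bound.
  have -> : (1 - V) = (1 - t) * (1 - m) by rewrite -tV M1e; ring.
  suff -> : (1 - t) * (1 - m) * profile2 (1 - m) / (1 - m) = (1 - t) * profile2 (1 - m) by [].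
  by field; rewrite subr_eq0 gt_eqF//; lra.
have := @two_values_half (profile3 q V) (1 - V) (1 - M) (1 - m) (1 - t).
rewrite !profile2N => h; apply: lt_le_trans (h _ _ _ _ _ _ _ _ _ _) _; rewrite ?hV//; try lra.
move=> X VX X1; apply: le_trans hT _.
have [X1'|X1'] := ltP X 1; first by apply/ltW/slab_bound_large => //; lra.
have -> : X = 1 by lra.
by rewrite /slab_bound profile21 mulr0 mul0r add0r.
Qed.

End Profile.

(** * Face area of unions of grid cells *)

(** Only changes between neighbours count: the two ends of a line of cells lie on the boundary of
    the cube, where the relative perimeter sees nothing. *)
Definition jumps (N : nat) (b : nat -> bool) : nat :=
  (\sum_(i < N.-1) (b i != b i.+1))%N.

(* [b = true]: an initial segment of the indices; [b = false]: a final one. *)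
Definition flush (N : nat) (P : nat -> bool) :=
  exists n b, (n <= N)%N /\ forall i, (i < N)%N -> P i = b (+) (n <= i)%N.

Lemma jumpsS n b : jumps n.+2 b = (jumps n.+1 b + (b n != b n.+1))%N.
Proof. by rewrite /jumps /= big_ord_recr. Qed.

Lemma eq_jumps N (b b' : nat -> bool) :
  (forall i, (i < N)%N -> b i = b' i) -> jumps N b = jumps N b'.
Proof.
move=> h; apply: eq_bigr => i _; have := ltn_ord i; case: N h i => //= N h i iN.
by rewrite !h // ltnS ltnW.
Qed.

Lemma jumps_negb N b : jumps N (fun i => ~~ b i) = jumps N b.
Proof. by apply: eq_bigr => i _; case: (b i); case: (b i.+1). Qed.

Lemma jumps_eq0 N b : jumps N b = 0%N -> forall i, (i < N)%N -> b i = b 0%N.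
Proof.
elim: N => // -[|N] IH; first by move=> _ [|i].
rewrite jumpsS => /eqP; rewrite addn_eq0 => /andP[/eqP/IH{}IH].
rewrite eqb0 negbK => /eqP bN i; rewrite ltnS leq_eqVlt => /orP[/eqP->|/IH//].
by rewrite -bN IH.
Qed.

Lemma jumps_gt0 N b i j : (i < N)%N -> (j < N)%N -> b i != b j -> (0 < jumps N b)%N.
Proof.
move=> iN jN bij; rewrite lt0n; apply: contra bij => /eqP/jumps_eq0 h.
by rewrite !h.
Qed.

Lemma jumps_le1 N b : (jumps N b <= 1)%N -> flush N b.
Proof.
suff h : (jumps N b <= 1)%N ->
    exists2 n, (n <= N)%N & forall i, (i < N)%N -> b i = b 0%N (+) (n <= i)%N.
  by move=> /h[n nN nb]; exists n, (b 0%N).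
elim: N => [|[|N] IH]; first by exists 0%N.
  by move=> _; exists 1%N => // -[|i]//=; rewrite addbF.
rewrite jumpsS; case: (boolP (b N == b N.+1)) => [/eqP bN|bN].
  rewrite addn0 => /IH[n nN h].
  have [nN'|nN'] := leqP n N.
    exists n; rewrite ?(leq_trans nN)// => i; rewrite ltnS leq_eqVlt.
    by move=> /orP[/eqP->|/h//]; rewrite -bN h// nN' (leq_trans nN').
  exists N.+2 => // i; rewrite ltnS leq_eqVlt => iN.
  have -> : (N.+1 < i)%N = false by lia.
  case/orP: iN => [/eqP->|iN].
    by rewrite -bN h // leqNgt nN'.
  rewrite h //; have -> : (n <= i)%N = false by lia.
  by [].
rewrite addn1 ltnS leqn0 => /eqP/jumps_eq0 h.
exists N.+1 => // i; rewrite ltnS leq_eqVlt => /orP[/eqP->|iN].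
  by rewrite leqnn -(h N)//; move: bN; case: (b N); case: (b N.+1).
by rewrite h // leqNgt iN addbF.
Qed.

(** * Area and perimeter of unions of cells in the square *)

Section Weights.
Context {R : rcfType} (N : nat) (w : nat -> R).
Hypothesis w_gt0 : forall i, (i < N)%N -> 0 < w i.
Hypothesis w_sum : \sum_(i < N) w i = 1.
Implicit Types (P Q : nat -> bool) (E F : nat -> nat -> bool).

Let w_ge0 (i : 'I_N) : 0 <= w i. Proof. exact/ltW/w_gt0. Qed.

Definition weight P : R := \sum_(i < N) w i * (P i)%:R.

Lemma N_gt0 : (0 < N)%N.
Proof.
by case: (N) w_sum => //; rewrite big_ord0 => /esym/eqP; rewrite oner_eq0.
Qed.

Lemma weight_ge0 P : 0 <= weight P.
Proof. by apply: sumr_ge0 => i _; rewrite mulr_ge0. Qed.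

Lemma weight_le P Q :
  (forall i, (i < N)%N -> P i -> Q i) -> weight P <= weight Q.
Proof.
move=> h; apply: ler_sum => i _; rewrite ler_wpM2l// ler_nat.
by have := h i (ltn_ord i); case: (P i) => //= ->.
Qed.

Lemma weightN P : weight (fun i => ~~ P i) = 1 - weight P.
Proof.
rewrite -w_sum /weight -sumrB; apply: eq_bigr => i _.
by case: (P i); rewrite ?mulr0 ?mulr1 ?subrr ?subr0.
Qed.

Lemma weightT P : (forall i, (i < N)%N -> P i) -> weight P = 1.
Proof.
move=> h; rewrite -w_sum; apply: eq_bigr => i _.
by rewrite h // mulr1.
Qed.

Lemma eq_weight P Q : (forall i, (i < N)%N -> P i = Q i) -> weight P = weight Q.
Proof. by move=> h; apply: eq_bigr => i _; rewrite h. Qed.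


Lemma sum_weight_ge (a : nat -> nat) P :
  (forall i, (i < N)%N -> (P i <= a i)%N) ->
  weight P <= \sum_(i < N) w i * (a i)%:R.
Proof.
by move=> h; apply: ler_sum => i _; rewrite ler_wpM2l// ler_nat h.
Qed.

Lemma sum_weight_eq (a : nat -> nat) P :
  (forall i, (i < N)%N -> (P i <= a i)%N) ->
  \sum_(i < N) w i * (a i)%:R <= weight P ->
  forall i, (i < N)%N -> a i = P i.
Proof.
move=> h le_a i iN.
have : \sum_(i < N) (w i * (a i)%:R - w i * (P i)%:R) == 0.
  rewrite sumrB subr_eq0 eq_le le_a /=; exact: sum_weight_ge.
rewrite psumr_eq0; last first.
  by move=> j _; rewrite -mulrBr mulr_ge0// subr_ge0 ler_nat h.
move=> /allP/(_ (Ordinal iN) (mem_index_enum _)) /=.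
by rewrite -mulrBr mulf_eq0 gt_eqF ?w_gt0//= subr_eq0 eqr_nat => /eqP.
Qed.

Definition area E : R := \sum_(i < N) w i * weight (E i).

Definition row_jumps E : R := \sum_(i < N) w i * (jumps N (E i))%:R.

Definition transp E : nat -> nat -> bool := fun j i => E i j.

Definition per2 E : R := row_jumps E + row_jumps (transp E).

Lemma area_transp E : area (transp E) = area E.
Proof.
rewrite /area /weight.
under eq_bigr do rewrite big_distrr /=.
rewrite exchange_big /=; apply: eq_bigr => i _; rewrite big_distrr /=.
by apply: eq_bigr => j _; rewrite mulrCA.
Qed.

Lemma per2_transp E : per2 (transp E) = per2 E.
Proof. by rewrite /per2 addrC. Qed.

Lemma row_jumps_ge0 E : 0 <= row_jumps E.
Proof. by apply: sumr_ge0 => i _; rewrite mulr_ge0. Qed.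

Lemma areaN E : area (fun i j => ~~ E i j) = 1 - area E.
Proof.
rewrite -[X in X - _]w_sum /area -sumrB; apply: eq_bigr => i _.
by rewrite weightN mulrBr mulr1.
Qed.

Lemma per2N E : per2 (fun i j => ~~ E i j) = per2 E.
Proof.
congr (_ + _); apply: eq_bigr => i _; last by rewrite (jumps_negb _ (transp E i)).
by rewrite jumps_negb.
Qed.

Lemma area_ge0 E : 0 <= area E.
Proof. by apply: sumr_ge0 => i _; rewrite mulr_ge0 ?weight_ge0. Qed.

Lemma area_le1 E : area E <= 1.
Proof. by rewrite -subr_ge0 -areaN area_ge0. Qed.

Lemma area_prod P Q : area (fun i j => P i && Q j) = weight P * weight Q.
Proof.
rewrite /area /weight big_distrl /=; apply: eq_bigr => i _; rewrite -mulrA.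
congr (_ * _); case: (P i); rewrite ?mul1r ?mul0r //.
by rewrite big1 // => j _; rewrite mulr0.
Qed.

(** Cells have positive weight, so an inclusion that loses no area is an equality. *)
Lemma area_lt E F :
  (forall i j, (i < N)%N -> (j < N)%N -> E i j -> F i j) ->
  area F <= area E -> forall i j, (i < N)%N -> (j < N)%N -> E i j = F i j.
Proof.
move=> EF FE.
have EFi i : (i < N)%N -> weight (E i) <= weight (F i).
  by move=> iN; apply: weight_le => j; apply: EF.
have /eqP : area F - area E = 0.
  apply/eqP; rewrite subr_eq0 eq_le FE /=.
  by apply: ler_sum => i _; rewrite ler_wpM2l// EFi.
rewrite -sumrB psumr_eq0; last first.
  by move=> i _; rewrite -mulrBr mulr_ge0// subr_ge0 EFi.
move=> /allP h i j iN jN; have := h (Ordinal iN) (mem_index_enum _).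
rewrite /= -mulrBr mulf_eq0 gt_eqF ?w_gt0//= -sumrB psumr_eq0; last first.
  move=> k _; rewrite -mulrBr mulr_ge0// subr_ge0 ler_nat.
  by have := EF i k iN (ltn_ord k); case: (E i k) => //= ->.
move=> /allP /(_ (Ordinal jN) (mem_index_enum _)).
rewrite /= -mulrBr mulf_eq0 gt_eqF ?w_gt0//=.
by have := EF i j iN jN; case: (E i j); case: (F i j) => //=; [move=> /(_ isT)|rewrite subr0 oner_eq0].
Qed.

Lemma area_eq0 E : area E = 0 -> forall i j, (i < N)%N -> (j < N)%N -> E i j = false.
Proof.
move=> E0 i j iN jN; apply/esym.
by apply: (@area_lt (fun _ _ => false) E) => //; rewrite E0 area_ge0.
Qed.

Lemma row_jumps_ge_weight E P :
  (forall i, (i < N)%N -> P i -> (0 < jumps N (E i))%N) -> weight P <= row_jumps E.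
Proof.
move=> h; apply: (@sum_weight_ge (fun i => jumps N (E i))) => i iN.
by have := h i iN; case: (P i) => // ->.
Qed.

(** The rows already use up the whole perimeter, so columns are constant and all rows coincide;
    their common row has at most one jump. *)
Lemma strip E : 1 <= row_jumps E -> per2 E <= 1 ->
  exists2 Q, flush N Q & weight Q = area E /\
     forall i j, (i < N)%N -> (j < N)%N -> E i j = Q j.
Proof.
move=> E1 E2.
have cols0 : row_jumps (transp E) = 0.
  by apply/eqP; rewrite eq_le row_jumps_ge0 andbT; move: E2; rewrite /per2; lra.
have colc j : (j < N)%N -> jumps N (transp E j) = 0%N.
  move=> jN; apply: (@sum_weight_eq (fun j => jumps N (transp E j)) (fun _ => false)) => //.
  by rewrite -/(row_jumps _) cols0 weight_ge0.
have EQ i j : (i < N)%N -> (j < N)%N -> E i j = E 0%N j.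
  by move=> iN jN; exact: (jumps_eq0 (colc _ jN) iN).
have EQ' i : (i < N)%N -> jumps N (E i) = jumps N (E 0%N).
  by move=> iN; apply: eq_jumps => j jN; exact: EQ.
have rowE : row_jumps E = (jumps N (E 0%N))%:R.
  rewrite /row_jumps; under eq_bigr do rewrite EQ'//.
  by rewrite -big_distrl /= w_sum mul1r.
exists (E 0%N) => //.
  by apply: jumps_le1; rewrite -(ler_nat R) -rowE; move: E2; rewrite /per2 cols0; lra.
split=> //; rewrite /area.
rewrite [RHS](eq_bigr (fun i : 'I_N => w i * weight (E 0%N))); last first.
  by move=> i _; congr (_ * _); apply: eq_weight => j jN; rewrite EQ.
by rewrite -big_distrl /= w_sum mul1r.
Qed.

Let full_row E := [exists i : 'I_N, forall j : 'I_N, E i j].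
Let empty_row E := [exists i : 'I_N, forall j : 'I_N, ~~ E i j].

(** Every row contains cells of both kinds and hence a jump. *)
Lemma nofull_noempty E : ~~ full_row E -> ~~ empty_row E -> 1 <= row_jumps E.
Proof.
move=> nf ne; rewrite -(@weightT xpredT)//; apply: row_jumps_ge_weight => i iN _.
move: nf ne; rewrite !negb_exists => /forallP/(_ (Ordinal iN)) + /forallP/(_ (Ordinal iN)).
rewrite !negb_forall => /existsP[j nEj] /existsP[k]; rewrite negbK => Ek.
by apply: (@jumps_gt0 _ _ j k) => //; rewrite (negbTE nEj) Ek.
Qed.

(** Every column meets both the full and the empty row. *)
Lemma full_empty E : full_row E -> empty_row E -> 1 <= row_jumps (transp E).
Proof.
move=> /existsP[i /forallP Ei] /existsP[k /forallP Ek].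
rewrite -(@weightT xpredT)//; apply: row_jumps_ge_weight => j jN _.
apply: (@jumps_gt0 _ _ i k) => //=; rewrite /transp (Ei (Ordinal jN)).
by rewrite (negbTE (Ek (Ordinal jN))).
Qed.

Definition proj1 E : nat -> bool := fun i => [exists j : 'I_N, E i j].

Lemma proj1P E i j : (j < N)%N -> E i j -> proj1 E i.
Proof. by move=> jN Eij; apply/existsP; exists (Ordinal jN). Qed.

Lemma nofull E : ~~ full_row E ->
  forall i, (i < N)%N -> proj1 E i -> (0 < jumps N (E i))%N.
Proof.
rewrite negb_exists => /forallP nf i iN /existsP[j Eij].
have := nf (Ordinal iN); rewrite negb_forall => /existsP[k /= nEik].
by apply: (@jumps_gt0 _ _ j k) => //; rewrite Eij (negbTE nEik).
Qed.

Lemma area_le_proj E : area E <= weight (proj1 E) * weight (proj1 (transp E)).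
Proof.
rewrite -area_prod; apply: ler_sum => i _; rewrite ler_wpM2l //.
apply: weight_le => j jN Eij; rewrite (proj1P jN Eij)/=.
exact: (@proj1P (transp E) j i).
Qed.

Lemma sqrt_amgm (a p1 p2 : R) : 0 <= p1 -> 0 <= p2 -> 0 <= a -> a <= p1 * p2 ->
  2 * Num.sqrt a <= p1 + p2.
Proof.
move=> p10 p20 a0 ap; rewrite -ler_sqr ?nnegrE ?mulr_ge0 ?sqrtr_ge0 ?addr_ge0//.
have -> : (p1 + p2) ^+ 2 = 4 * (p1 * p2) + (p1 - p2) ^+ 2 by ring.
by rewrite exprMn sqr_sqrtr// -natrX; have := sqr_ge0 (p1 - p2); lra.
Qed.

(** The empty row also rules out full columns, so every row or column that meets [E] has a jump, and
    the perimeter is at least the sum of the two projections. Their product bounds the area, and the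
    inequality of arithmetic and geometric means concludes. In the equality case the projections
    have equal length, [E] fills their product, and each line has at most one jump. *)
Lemma empty_only E : ~~ full_row E -> empty_row E ->
  2 * Num.sqrt (area E) <= per2 E /\
  (0 < area E -> per2 E <= 2 * Num.sqrt (area E) ->
   exists P Q, [/\ flush N P, flush N Q,
     forall i j, (i < N)%N -> (j < N)%N -> E i j = P i && Q j,
     weight P = Num.sqrt (area E) & weight Q = Num.sqrt (area E)]).
Proof.
move=> nf ne.
have nfc : ~~ full_row (transp E).
  apply: contraL ne => /existsP[j /forallP Ej]; rewrite negb_exists.
  by apply/forallP => i; rewrite negb_forall; apply/existsP; exists j; rewrite negbK; exact: Ej.
set p1 := weight (proj1 E); set p2 := weight (proj1 (transp E)).
have h1 : p1 <= row_jumps E by apply: row_jumps_ge_weight; exact: nofull.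
have h2 : p2 <= row_jumps (transp E) by apply: row_jumps_ge_weight; exact: nofull.
have h3 := area_le_proj E; rewrite -/p1 -/p2 in h3.
have p10 : 0 <= p1 by exact: weight_ge0.
have p20 : 0 <= p2 by exact: weight_ge0.
have h4 := sqrt_amgm p10 p20 (area_ge0 E) h3.
split; first by rewrite /per2; lra.
move=> a0; rewrite /per2 => h5.
have s2 : Num.sqrt (area E) ^+ 2 = area E by rewrite sqr_sqrtr// area_ge0.
have s0 : 0 < Num.sqrt (area E) by rewrite sqrtr_gt0.
have h6 : p1 + p2 <= 2 * Num.sqrt (area E) by lra.
have h7 : (p1 + p2) ^+ 2 <= 4 * area E.
  rewrite -s2; set s := Num.sqrt (area E) in h6 s0 *.
  have : (p1 + p2) ^+ 2 <= (2 * s) ^+ 2 by rewrite ler_sqr// ?nnegrE; lra.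
  by rewrite exprMn -natrX.
have e12 : p1 = p2.
  apply/eqP; rewrite -subr_eq0 -sqrf_eq0 eq_le sqr_ge0 andbT.
  have -> : (p1 - p2) ^+ 2 = (p1 + p2) ^+ 2 - 4 * (p1 * p2) by ring.
  by lra.
have e1 : p1 = Num.sqrt (area E) by apply/eqP; rewrite eq_le; apply/andP; split; lra.
have e3 : area E = p1 * p2 by rewrite -s2 -e12 e1 expr2.
have r1 : forall i, (i < N)%N -> jumps N (E i) = proj1 E i.
  apply: (@sum_weight_eq (fun i => jumps N (E i))); last by rewrite -/(row_jumps E) -/p1; lra.
  by move=> i iN; have := nofull nf iN; case: (proj1 E i) => // ->.
have r2 : forall i, (i < N)%N -> jumps N (transp E i) = proj1 (transp E) i.
  apply: (@sum_weight_eq (fun i => jumps N (transp E i))); last by rewrite -/(row_jumps _) -/p2; lra.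
  by move=> i iN; have := nofull nfc iN; case: (proj1 (transp E) i) => // ->.
have EE : forall i j, (i < N)%N -> (j < N)%N -> E i j = proj1 E i && proj1 (transp E) j.
  apply: area_lt; last by rewrite area_prod e3.
  move=> i j iN jN Eij; rewrite (proj1P jN Eij)/=.
  exact: (@proj1P (transp E) j i).
have [i0 i0N Pi0] : exists2 i, (i < N)%N & proj1 E i.
  suff /existsP[i Pi] : [exists i : 'I_N, proj1 E i] by exists i.
  apply: contraT; rewrite negb_exists => /forallP h.
  have p10' : p1 = 0 by rewrite /p1 /weight big1// => i _; rewrite (negbTE (h i)) mulr0.
  by move: s0; rewrite -e1 p10' ltxx.
have [j0 j0N Pj0] : exists2 i, (i < N)%N & proj1 (transp E) i.
  suff /existsP[i Pi] : [exists i : 'I_N, proj1 (transp E) i] by exists i.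
  apply: contraT; rewrite negb_exists => /forallP h.
  have p20' : p2 = 0 by rewrite /p2 /weight big1// => i _; rewrite (negbTE (h i)) mulr0.
  by move: s0; rewrite -e1 e12 p20' ltxx.
exists (proj1 E), (proj1 (transp E)); split => //.
- apply: jumps_le1; rewrite -(@eq_jumps _ (transp E j0)) ?r2 ?leq_b1//.
  by move=> i iN; rewrite /transp EE // Pj0 andbT.
- by apply: jumps_le1; rewrite -(@eq_jumps _ (E i0)) ?r1 ?leq_b1// => i iN; rewrite EE // Pi0.
- by rewrite -/p2 -e12.
Qed.
Lemma full_rowN E : full_row (fun i j => ~~ E i j) = empty_row E.
Proof. by []. Qed.

Lemma empty_rowN E : empty_row (fun i j => ~~ E i j) = full_row E.
Proof.
by apply: eq_existsb => i; apply: eq_forallb => j; rewrite negbK.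
Qed.

(** The existence of full and of empty rows gives four cases; a full row without an empty one is
    treated through the complement. *)
Lemma per2_ge E : profile2 (area E) <= per2 E.
Proof.
have [h1 h2 h3] := profile2_le (area E).
have row0 := row_jumps_ge0 E; have col0 := row_jumps_ge0 (transp E).
case: (boolP (full_row E)) => fE; case: (boolP (empty_row E)) => eE.
- by have := full_empty fE eE; rewrite /per2; lra.
- rewrite -areaN -per2N in h3 *; apply: le_trans h3 _.
  by have [] := @empty_only (fun i j => ~~ E i j); rewrite ?full_rowN ?empty_rowN.
- by have [] := empty_only fE eE; lra.
- by have := nofull_noempty fE eE; rewrite /per2; lra.
Qed.

Lemma flushT : flush N xpredT.
Proof. by exists N, true; split => // i iN; rewrite leqNgt iN. Qed.

Definition square_or_strip (a p1 p2 : R) :=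
  [\/ [/\ a <= 1 / 4, p1 = Num.sqrt a & p2 = Num.sqrt a],
      [/\ 1 / 4 <= a, p1 = a & p2 = 1] |
      [/\ 1 / 4 <= a, p1 = 1 & p2 = a]].

Lemma profile2_ge1 (a : R) : 0 <= a -> 1 <= profile2 a -> 1 / 4 <= a.
Proof.
move=> a0 a1; have [h _ _] := profile2_le a; rewrite leNgt; apply/negP => a4.
have : 1 <= 2 * Num.sqrt a by exact: le_trans h.
rewrite -ler_sqr ?nnegrE ?mulr_ge0 ?sqrtr_ge0// exprMn sqr_sqrtr// expr1n -natrX; lra.
Qed.

Lemma per2_eq E : 0 < area E -> area E <= 1 / 2 -> per2 E <= profile2 (area E) ->
  exists P Q, [/\ flush N P, flush N Q,
    forall i j, (i < N)%N -> (j < N)%N -> E i j = P i && Q j &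
    square_or_strip (area E) (weight P) (weight Q)].
Proof.
move=> a0 a2 pE; have [h1 h2 h3] := profile2_le (area E).
have pE1 : per2 E <= 1 by exact: le_trans h2.
have row0 := row_jumps_ge0 E; have col0 := row_jumps_ge0 (transp E).
have wT : weight xpredT = 1 by exact: weightT.
have colcase : 1 <= row_jumps (transp E) ->
    exists P Q, [/\ flush N P, flush N Q,
    forall i j, (i < N)%N -> (j < N)%N -> E i j = P i && Q j &
    square_or_strip (area E) (weight P) (weight Q)].
  move=> h; have := strip h; rewrite per2_transp area_transp => /(_ pE1)[Q fQ [wQ EQ]].
  exists Q, xpredT; split => //; first exact: flushT.
    by move=> i j iN jN; rewrite andbT -(EQ j i).
  apply: Or32; split => //; apply: profile2_ge1 => //; first exact: ltW.
  by move: pE; rewrite /per2; lra.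
case: (boolP (full_row E)) => fE; case: (boolP (empty_row E)) => eE.
- exact/colcase/full_empty.
(* Impossible here: the complement has area above 1/4, so this shape would have perimeter above
   1. *)
- have [] := @empty_only (fun i j => ~~ E i j); rewrite ?full_rowN ?empty_rowN//.
  rewrite areaN per2N => h4 _.
  have : 1 / 4 < 1 - area E by lra.
  move=> h5; have : 1 < 2 * Num.sqrt (1 - area E); last by lra.
  by apply: sqr_ltW; rewrite ?mulr_ge0 ?sqrtr_ge0// exprMn sqr_sqrtr ?expr1n -?natrX; lra.
- have [h4 /(_ a0)] := empty_only fE eE; case; first exact: le_trans h1.
  move=> P [Q [fP fQ EPQ wP wQ]]; exists P, Q; split => //; apply: Or31; split => //.
  have : 2 * Num.sqrt (area E) <= 1 by lra.
  move=> h5; have s2 : Num.sqrt (area E) ^+ 2 = area E by rewrite sqr_sqrtr// ltW.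
  have := sqrtr_ge0 (area E); nra.
- have rE := nofull_noempty fE eE.
  have [Q fQ [wQ EQ]] := strip rE pE1.
  exists xpredT, Q; split => //; first exact: flushT.
  apply: Or33; split => //; apply: profile2_ge1 => //; first exact: ltW.
  by move: pE; rewrite /per2; lra.
Qed.

Lemma weighted_eq (a b : nat -> R) :
  (forall k, (k < N)%N -> a k <= b k) ->
  \sum_(k < N) w k * b k <= \sum_(k < N) w k * a k ->
  forall k, (k < N)%N -> b k = a k.
Proof.
move=> ab ba k kN.
have : \sum_(i < N) (w i * b i - w i * a i) == 0.
  rewrite sumrB subr_eq0 eq_le ba /=; apply: ler_sum => i _.
  by rewrite ler_wpM2l// ab.
rewrite psumr_eq0; last by move=> j _; rewrite -mulrBr mulr_ge0// subr_ge0 ab.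
move=> /allP/(_ (Ordinal kN) (mem_index_enum _)) /=.
by rewrite -mulrBr mulf_eq0 gt_eqF ?w_gt0//= subr_eq0 => /eqP.
Qed.

Lemma weighted_ge (a b : nat -> R) :
  (forall k, (k < N)%N -> a k <= b k) ->
  \sum_(k < N) w k * a k <= \sum_(k < N) w k * b k.
Proof. by move=> ab; apply: ler_sum => i _; rewrite ler_wpM2l// ab. Qed.

Lemma weighted_affine (v : nat -> R) (x y V : R) : \sum_(k < N) w k * v k = V ->
  \sum_(k < N) w k * (x + y * v k) = x + y * V.
Proof.
move=> <-; under eq_bigr do rewrite mulrDr mulrCA.
by rewrite big_split/= -big_distrl/= w_sum mul1r -big_distrr.
Qed.

Lemma weighted_between (v : nat -> R) V k0 k1 : \sum_(k < N) w k * v k = V ->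
  (k0 < N)%N -> (k1 < N)%N ->
  (forall k, (k < N)%N -> v k0 <= v k <= v k1) -> v k0 < v k1 -> v k0 < V < v k1.
Proof.
move=> vV k0N k1N hv lt01.
have cst (x : R) : \sum_(k < N) w k * x = x by rewrite -big_distrl /= w_sum mul1r.
apply/andP; split; rewrite ltNge; apply/negP => hV.
- have := @weighted_eq (fun=> v k0) v; rewrite cst vV => /(_ _ hV k1 k1N) h.
  by move: lt01; rewrite h ?ltxx// => k /hv/andP[].
- have := @weighted_eq v (fun=> v k1); rewrite cst vV => /(_ _ hV k0 k0N) h.
  by move: lt01; rewrite h ?ltxx// => k /hv/andP[].
Qed.

(** * Optimal distributions of slice areas *)

Definition slices_optimal (q V : R) (v : nat -> R) k0 k1 :=
  (forall k, (k < N)%N -> v k = V) \/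
  [/\ v k0 = 0, 0 < v k1, (forall k, (k < N)%N -> v k = 0 \/ v k = v k1) &
   [\/ v k1 = 1 /\ profile3 q V = 1,
       [/\ v k1 = Num.sqrt V, profile3 q V = 2 * Num.sqrt V & 1 / 4 <= v k1] |
       [/\ v k1 = q ^+ 2, profile3 q V = 3 * q ^+ 2 & v k1 <= 1 / 4]]].

(** [profile2] lies above its chord over the interval from [v k0] to [v k1], and the mean of an
    affine function of [v] depends on [V] only; this reduces everything to two values. If
    [v k0 = 0], the chord passes through the origin and is touched only at its ends, by
    [profile2_ratio]. If [0 < v k0 < v k1], [two_values] makes the bound strict. *)
Lemma slices q V (v : nat -> R) k0 k1 : 0 < V -> V <= 1 / 2 -> 0 < q -> q ^+ 3 = V ->
  \sum_(k < N) w k * v k = V -> (k0 < N)%N -> (k1 < N)%N ->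
  (forall k, (k < N)%N -> v k0 <= v k <= v k1) -> 0 <= v k0 -> v k1 <= 1 ->
  let S := \sum_(k < N) w k * profile2 (v k) + (v k1 - v k0) in
  profile3 q V <= S /\ (S <= profile3 q V -> slices_optimal q V v k0 k1).
Proof.
move=> V0 V2 q0 qV vV k0N k1N hv v0 v1 S.
have cst (x : R) : \sum_(k < N) w k * x = x by rewrite -big_distrl /= w_sum mul1r.
have [|lt01] := leP (v k1) (v k0).
  move=> le10; have vc k : (k < N)%N -> v k = V.
    have vk0 j : (j < N)%N -> v j = v k0.
      by move=> /hv/andP[h1 h2]; apply/eqP; rewrite eq_le h1 (le_trans h2).
    move=> kN; rewrite vk0// -vV -[LHS]cst; apply: eq_bigr => j _.
    by rewrite [in RHS]vk0.
  split; last by move=> _; left.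
  rewrite /S !vc// subrr addr0 (eq_bigr (fun k : 'I_N => w k * profile2 V)).
    by rewrite cst profile3_le_profile2.
  by move=> k _; rewrite vc.
have /andP[ltmV ltVM] := weighted_between vV k0N k1N hv lt01.
move: v0; rewrite le_eqVlt => /predU1P[/esym v0|v0].
- have M0 : 0 < v k1 by rewrite -v0.
  have ge_k k : (k < N)%N -> 0 + profile2 (v k1) / v k1 * v k <= profile2 (v k).
    move=> kN; rewrite add0r; have /andP[g1 g2] := hv k kN.
    move: g1; rewrite v0 le_eqVlt => /predU1P[<-|g1].
      by rewrite mulr0 profile20.
    move: g2; rewrite le_eqVlt => /predU1P[->|g2].
      by rewrite divfK// gt_eqF.
    by rewrite mulrAC ler_pdivrMr// mulrC [leRHS]mulrC ltW// profile2_ratio.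
  have hS : \sum_(k < N) w k * (0 + profile2 (v k1) / v k1 * v k) + v k1 =
      slab_bound V (v k1).
    by rewrite (weighted_affine _ _ vV) add0r /slab_bound; congr (_ + _); ring.
  have := weighted_ge ge_k.
  have [b1 b2] := slab_bound_ge V0 V2 q0 qV (ltW ltVM) v1.
  rewrite /S v0 subr0 => gS; split; first lra.
  move=> hT; right; split => //; last by apply: b2; lra.
  move=> k kN; have /andP[g1 g2] := hv k kN.
  have e : profile2 (v k) = 0 + profile2 (v k1) / v k1 * v k.
    by apply: (weighted_eq ge_k) => //; lra.
  move: g1; rewrite v0 le_eqVlt => /predU1P[<-|g1]; first by left.
  move: g2; rewrite le_eqVlt => /predU1P[->|g2]; first by right.
  have := profile2_ratio g1 g2 v1; rewrite e add0r mulrA mulrCA divff ?gt_eqF// mulr1.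
  by rewrite mulrC ltxx.
- have t0 : 0 < v k1 - v k0 by rewrite subr_gt0.
  (* The proportion of slices of area [v k1] in a distribution on the two extreme values with mean
     [V]. *)
  set t := (V - v k0) / (v k1 - v k0).
  have t01 : 0 < t < 1.
    by rewrite /t divr_gt0 ?subr_gt0//= ltr_pdivrMr// mul1r ltrD2r.
  have tE : (1 - t) * v k0 + t * v k1 = V by rewrite /t; field; rewrite gt_eqF.
  have := two_values V0 V2 q0 qV v0 ltmV ltVM v1 t01 tE.
  set B := (X in _ < X) => hB.
  suff hS : B <= S by split; [lra | rewrite leNgt (lt_le_trans hB)].
  (* [y] is the slope of the chord. *)
  set y := (profile2 (v k1) - profile2 (v k0)) / (v k1 - v k0).
  have -> : B = \sum_(k < N) w k * ((profile2 (v k0) - y * v k0) + y * v k) + (v k1 - v k0).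
    rewrite (weighted_affine _ _ vV) /B /y -tE; congr (_ + _); field; rewrite gt_eqF//.
  rewrite lerD2r.
  apply: (@weighted_ge (fun k => (profile2 (v k0) - y * v k0) + y * v k)
    (profile2 \o v)) => k kN /=; have /andP[g1 g2] := hv k kN.
  set s := (v k - v k0) / (v k1 - v k0).
  have s01 : 0 <= s <= 1.
    by rewrite /s divr_ge0 ?subr_ge0 ?(ltW lt01)//= ler_pdivrMr// mul1r lerD2r.
  have sE : v k = (1 - s) * v k0 + s * v k1 by rewrite /s; field; rewrite gt_eqF.
  have -> : profile2 (v k0) - y * v k0 + y * v k = (1 - s) * profile2 (v k0) + s * profile2 (v k1).
    by rewrite /y /s; field; rewrite gt_eqF.
  rewrite [in leRHS]sE; apply: profile2_concave => //; apply/andP; split; lra.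
Qed.

(** * Unions of cells in the cube *)

Definition line_sum (a : nat -> nat -> nat) : R :=
  \sum_(i < N) w i * \sum_(j < N) w j * (a i j)%:R.

Lemma line_sum_ge a b :
  (forall i j, (i < N)%N -> (j < N)%N -> (a i j <= b i j)%N) ->
  line_sum a <= line_sum b.
Proof.
move=> ab; apply: ler_sum => i _; rewrite ler_wpM2l//; apply: ler_sum => j _.
by rewrite ler_wpM2l// ler_nat ab.
Qed.

Lemma line_sum_eq a b :
  (forall i j, (i < N)%N -> (j < N)%N -> (a i j <= b i j)%N) ->
  line_sum b <= line_sum a ->
  forall i j, (i < N)%N -> (j < N)%N -> b i j = a i j.
Proof.
move=> ab ba i j iN jN.
have abi k : (k < N)%N ->
    \sum_(l < N) w l * (a k l)%:R <= \sum_(l < N) w l * (b k l)%:R.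
  by move=> kN; apply: ler_sum => l _; rewrite ler_wpM2l// ler_nat ab.
have e := weighted_eq abi ba iN.
apply/eqP; rewrite -(eqr_nat R); apply/eqP.
apply: (@weighted_eq (fun l => (a i l)%:R) (fun l => (b i l)%:R)) => //.
  by move=> l lN; rewrite ler_nat ab.
by rewrite e.
Qed.

Lemma line_sumD a b : line_sum (fun i j => (a i j + b i j)%N) = line_sum a + line_sum b.
Proof.
rewrite -big_split /=; apply: eq_bigr => i _; rewrite -mulrDr; congr (_ * _).
by rewrite -big_split /=; apply: eq_bigr => j _; rewrite natrD mulrDr.
Qed.

Implicit Types B : nat -> nat -> nat -> bool.

Definition slice B k : nat -> nat -> bool := fun i j => B i j k.

Definition vol3 B : R := \sum_(k < N) w k * area (slice B k).

Definition per3 B : R :=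
  \sum_(k < N) w k * per2 (slice B k) + line_sum (fun i j => jumps N (B i j)).

(** The slicing direction is fixed, so tube and slab occur in three orientations each; they are
    identified only in [cubical_structure]. *)
Definition extremal (q V a b c : R) :=
  [\/ [/\ profile3 q V = 3 * q ^+ 2, a = q, b = q & c = q],
      profile3 q V = 2 * Num.sqrt V /\
      [\/ [/\ a = Num.sqrt V, b = Num.sqrt V & c = 1],
          [/\ a = Num.sqrt V, b = 1 & c = Num.sqrt V] |
          [/\ a = 1, b = Num.sqrt V & c = Num.sqrt V]] |
      profile3 q V = 1 /\
      [\/ [/\ a = V, b = 1 & c = 1],
          [/\ a = 1, b = V & c = 1] |
          [/\ a = 1, b = 1 & c = V]]].

(** At slice area 1/4 a corner square and a strip have the same perimeter, so equality in the square
    does not determine the shape. This lemma and the next exclude the tie: at V = 1/16 the cube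
    beats the tube, and at V = 1/8 the tube beats the cube. *)
Lemma not_sqrt_quarter (q V : R) : 0 < V -> 0 < q -> q ^+ 3 = V ->
  profile3 q V = 2 * Num.sqrt V -> Num.sqrt V = 1 / 4 -> False.
Proof.
move=> V0 q0 qV pV s4; have [h1 _ _] := profile3_le q V.
have V16 : V = 1 / 16 by rewrite -[LHS](@sqr_sqrtr _ V) ?ltW// s4 expr_div_n expr1n -natrX; lra.
(* The contradiction: (q^2)^3 = V^2 = 1/256 is less than 1/216. *)
have q6 : 1 / 6 <= q ^+ 2 by lra.
have : (1 / 6) ^+ 3 <= (q ^+ 2) ^+ 3 by rewrite lerXn2r ?nnegrE ?sqr_ge0//; lra.
by rewrite -exprM mulnC exprM qV V16 !expr_div_n !expr1n -!natrX; lra.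
Qed.

Lemma not_cube_quarter (q V : R) : 0 < V -> 0 < q -> q ^+ 3 = V ->
  profile3 q V = 3 * q ^+ 2 -> q ^+ 2 = 1 / 4 -> False.
Proof.
move=> V0 q0 qV pV s4; have [_ h1 _] := profile3_le q V.
have q2 : q = 1 / 2.
  by apply/eqP; rewrite -(@eqrXn2 _ 2)//; [rewrite s4 expr_div_n expr1n -natrX; apply/eqP; lra|exact: ltW].
have V8 : Num.sqrt V ^+ 2 = 1 / 8.
  by rewrite sqr_sqrtr ?ltW// -qV q2 expr_div_n expr1n -natrX; lra.
have := sqrtr_ge0 V; nra.
Qed.

Lemma per3_extremal (q V : R) B : 0 < V -> V <= 1 / 2 -> 0 < q -> q ^+ 3 = V -> vol3 B = V ->
  profile3 q V <= per3 B /\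
  (per3 B <= profile3 q V -> exists P Q S, [/\ flush N P, flush N Q & flush N S] /\
    (forall i j k, (i < N)%N -> (j < N)%N -> (k < N)%N -> B i j k = [&& P i, Q j & S k]) /\
    extremal q V (weight P) (weight Q) (weight S)).
Proof.
move=> V0 V2 q0 qV vB.
pose v k := area (slice B k).
have [k0 k0min] : exists k0 : 'I_N, forall k : 'I_N, v k0 <= v k.
  case: (arg_minP (fun k : 'I_N => v k) (erefl (xpredT (Ordinal N_gt0)))) => k _ h.
  by exists k => j; exact: h.
have [k1 k1max] : exists k1 : 'I_N, forall k : 'I_N, v k <= v k1.
  case: (arg_maxP (fun k : 'I_N => v k) (erefl (xpredT (Ordinal N_gt0)))) => k _ h.
  by exists k => j; exact: h.
have hv k : (k < N)%N -> v k0 <= v k <= v k1.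
  by move=> kN; rewrite (k0min (Ordinal kN)) (k1max (Ordinal kN)).
have v0 : 0 <= v k0 by exact: area_ge0.
have v1 : v k1 <= 1 by exact: area_le1.
have [hS hS'] := slices V0 V2 q0 qV vB (ltn_ord k0) (ltn_ord k1) hv v0 v1.
set zp := line_sum (fun i j => jumps N (B i j)).
(* On a line in the slicing direction, a cell in the largest slice is matched by one in the smallest
   slice or forces a jump. Summed over all lines this bounds the third direction below by M - m. *)
have zle i j : (i < N)%N -> (j < N)%N ->
    (B i j k1 <= jumps N (B i j) + B i j k0)%N.
  move=> iN jN; case: (boolP (B i j k1)) => // b1; case: (boolP (B i j k0)) => b0.
    by rewrite addn1.
  by rewrite addn0; apply: (@jumps_gt0 _ _ k1 k0); rewrite ?ltn_ord// b1 (negbTE b0).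
have zpge : v k1 - v k0 <= zp.
  have := line_sum_ge zle; rewrite line_sumD => h.
  have {}h : v k1 <= zp + v k0 := h.
  lra.
have pge : \sum_(k < N) w k * profile2 (v k) <= \sum_(k < N) w k * per2 (slice B k).
  by apply: (@weighted_ge (fun k => profile2 (v k)) (fun k => per2 (slice B k))) => k kN; exact: per2_ge.
rewrite /per3 -/zp; split; first lra.
move=> pT; have {hS'}opt : slices_optimal q V v k0 k1 by apply: hS'; lra.
have pk k : (k < N)%N -> per2 (slice B k) <= profile2 (v k).
  move=> kN; rewrite (@weighted_eq (fun k => profile2 (v k)) (fun k => per2 (slice B k)))//.
    by move=> j jN; exact: per2_ge.
  lra.
have TV := profile3_le_profile2 q V2.
have wT : weight xpredT = 1 by exact: weightT.
have Vge0 : 0 <= V by exact: ltW.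
case: opt => [vV|[vk0 vk1 v01 vM]].
  (* Slices of equal area leave no room for faces in the third direction, so [B] is a cylinder over
     its slice 0. *)
  have zp0 : zp <= 0 by have := vV _ (ltn_ord k0); have := vV _ (ltn_ord k1); lra.
  have const i j k : (i < N)%N -> (j < N)%N -> (k < N)%N -> B i j k = B i j 0%N.
    move=> iN jN; apply: jumps_eq0.
    apply: (@line_sum_eq (fun _ _ => 0%N) (fun i j => jumps N (B i j))) => //.
    apply: le_trans zp0 _; apply: sumr_ge0 => l _; rewrite mulr_ge0//.
    by apply: sumr_ge0 => l' _; rewrite mulr_ge0.
  have a0 : area (slice B 0) = V by exact/vV/N_gt0.
  have := @per2_eq (slice B 0).
  rewrite a0 => /(_ V0 V2); case; first by rewrite -[in leRHS]a0; exact/pk/N_gt0.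
  move=> P [Q [fP fQ BPQ sh]]; exists P, Q, xpredT; split; first by split => //; exact: flushT.
  split; first by move=> i j k iN jN kN; rewrite const// andbT -BPQ.
  have TE : profile3 q V = profile2 V.
    have cst : \sum_(k < N) w k * profile2 (v k) = profile2 V.
      rewrite (eq_bigr (fun k : 'I_N => w k * profile2 V)); last by move=> k _; rewrite vV.
      by rewrite -big_distrl /= w_sum mul1r.
    by have := vV _ (ltn_ord k0); have := vV _ (ltn_ord k1); lra.
  have [hq1 hq2 hq3] := profile3_le q V.
  case: sh => [[V4 wP wQ]|[V4 wP wQ]|[V4 wP wQ]].
  - apply: Or32; split; last exact: Or31.
    by rewrite TE profile2_small//; apply/andP.
  - apply: Or33; split; last exact: Or31.
    by rewrite TE profile2_mid//; apply/andP; split => //; lra.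
  - apply: Or33; split; last exact: Or32.
    by rewrite TE profile2_mid//; apply/andP; split => //; lra.
have zpM : zp <= v k1 by rewrite vk0 in hS zpge *; lra.
have E0 i j : (i < N)%N -> (j < N)%N -> B i j k0 = false by exact: (@area_eq0 (slice B k0)).
have zle' i j : (i < N)%N -> (j < N)%N -> (B i j k1 <= jumps N (B i j))%N.
  by move=> iN jN; have := zle i j iN jN; rewrite E0// addn0.
(* Equality makes the number of jumps on a line exactly [B i j k1]. A cell in any slice forces a
   jump, because slice [k0] is empty, so it lies over slice [k1]; equal areas then make all nonempty
   slices equal. *)
have jE := line_sum_eq zle' zpM.
pose S k := v k != 0.
have BS i j k : (i < N)%N -> (j < N)%N -> (k < N)%N -> B i j k = B i j k1 && S k.
  move=> iN jN kN; rewrite /S; case: (eqVneq (v k) 0) => [vk|vk].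
    by rewrite andbF; exact: (@area_eq0 (slice B k)).
  rewrite andbT; case: (v01 k kN) => [/eqP|vkM]; first by rewrite (negbTE vk).
  apply: (@area_lt (slice B k) (slice B k1)) => //; last by rewrite -/(v k) vkM.
  move=> {iN jN} {}i {}j iN jN Bk; rewrite /slice.
  suff : (0 < jumps N (B i j))%N by rewrite jE// lt0b.
  by apply: (@jumps_gt0 _ _ k k0) => //; rewrite [B i j k]Bk E0.
have [i1 [j1 [i1N j1N B1]]] : exists i j, [/\ (i < N)%N, (j < N)%N & B i j k1].
  case: (boolP [exists i : 'I_N, [exists j : 'I_N, B i j k1]]).
    by move=> /existsP[i /existsP[j Bij]]; exists i, j; rewrite !ltn_ord.
  rewrite negb_exists => /forallP h; suff vk10 : v k1 = 0 by rewrite vk10 ltxx in vk1.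
  rewrite /v /area big1// => i _; rewrite /weight big1 ?mulr0// => j _.
  by have := h i; rewrite negb_exists => /forallP/(_ j)/negbTE; rewrite /slice => ->; rewrite mulr0.
have fS : flush N S.
  apply: jumps_le1; rewrite -(@eq_jumps _ (B i1 j1)) ?jE ?leq_b1// => k kN.
  by rewrite BS// B1.
have wS : v k1 * weight S = V.
  rewrite -vB /vol3 /weight big_distrr /=; apply: eq_bigr => k _; rewrite mulrCA.
  congr (_ * _); rewrite -/(v k) /S.
  by case: (v01 k (ltn_ord k)) => ->; rewrite ?eqxx ?mulr0// gt_eqF// mulr1.
have pk1 := pk k1 (ltn_ord k1).
have [hq1 hq2 hq3] := profile3_le q V.
have r0 : 0 < Num.sqrt V by rewrite sqrtr_gt0.
have r2 : Num.sqrt V * Num.sqrt V = V by rewrite -expr2 sqr_sqrtr.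
case: vM => [[vk1E TE]|[vk1E TE v4]|[vk1E TE v4]].
- exists xpredT, xpredT, S; split; first by split => //; exact: flushT.
  split.
    move=> i j k iN jN kN; rewrite BS//; congr (_ && _).
    have -> // : B i j k1 = true.
    apply: (@area_lt (slice B k1) (fun _ _ => true)) => //; rewrite -/(v k1) vk1E; exact: area_le1.
  apply: Or33; split => //; apply: Or33; split => //.
  by rewrite -wS vk1E mul1r.
- have := @per2_eq (slice B k1) vk1; rewrite -/(v k1) => /(_ _ pk1); case; first lra.
  move=> P [Q [fP fQ BPQ sh]]; exists P, Q, S; split => //; split.
    by move=> i j k iN jN kN; rewrite BS// [B _ _ _](BPQ i j)// andbA.
  have wSr : weight S = Num.sqrt V.
    by apply: (@mulfI _ (Num.sqrt V)); rewrite ?gt_eqF// r2 -[RHS]wS vk1E.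
  apply: Or32; split => //; case: sh => [[V4 wP wQ]|[V4 wP wQ]|[V4 wP wQ]].
  + by case: (@not_sqrt_quarter q V) => //; lra.
  + by apply: Or32; split => //; rewrite wP.
  + by apply: Or33; split => //; rewrite wQ.
- have := @per2_eq (slice B k1) vk1; rewrite -/(v k1) => /(_ _ pk1); case; first lra.
  move=> P [Q [fP fQ BPQ sh]]; exists P, Q, S; split => //; split.
    by move=> i j k iN jN kN; rewrite BS// [B _ _ _](BPQ i j)// andbA.
  have wSr : weight S = q.
    apply: (@mulfI _ (q ^+ 2)); first by rewrite expf_eq0 /= gt_eqF.
    by rewrite -exprSr qV -[RHS]wS vk1E.
  apply: Or31; case: sh => [[V4 wP wQ]|[V4 wP wQ]|[V4 wP wQ]].
  + by rewrite wP wQ wSr vk1E sqrtr_sqr gtr0_norm.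
  + by case: (@not_cube_quarter q V) => //; lra.
  + by case: (@not_cube_quarter q V) => //; lra.
Qed.

End Weights.

(** * Two-dimensional Hausdorff measure *)

Section EuclideanDistance.
Context {R : realType} {n : nat}.
Implicit Types (x y : 'rV[R]_n) (A B : set 'rV[R]_n).

Lemma eucl_dist_ge0 x y : 0 <= eucl_dist x y.
Proof. exact: sqrtr_ge0. Qed.

Lemma coord_le_eucl_dist x y i : `|x 0 i - y 0 i| <= eucl_dist x y.
Proof.
rewrite /eucl_dist -sqrtr_sqr ler_sqrt; last by rewrite sumr_ge0// => j _; rewrite sqr_ge0.
by rewrite (bigD1 i)//= lerDl sumr_ge0// => j _; rewrite sqr_ge0.
Qed.

Lemma eucl_dist_le_sq x y r : 0 <= r ->
  \sum_(i < n) (x 0 i - y 0 i) ^+ 2 <= r ^+ 2 -> eucl_dist x y <= r.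
Proof.
by move=> r0 h; rewrite /eucl_dist -(ger0_norm r0) -sqrtr_sqr ler_sqrt// sqr_ge0.
Qed.

Lemma eucl_dist_lt_sq x y r : 0 < r ->
  \sum_(i < n) (x 0 i - y 0 i) ^+ 2 < r ^+ 2 -> eucl_dist x y < r.
Proof.
by move=> r0 h; rewrite /eucl_dist -(gtr0_norm r0) -sqrtr_sqr ltr_sqrt// exprn_gt0.
Qed.

Lemma eucl_diam_ge0 A : (0 <= eucl_diam A)%E.
Proof. by rewrite /eucl_diam le_max lexx. Qed.

Lemma eucl_diam_ub A x y : A x -> A y -> ((eucl_dist x y)%:E <= eucl_diam A)%E.
Proof.
move=> Ax Ay; rewrite /eucl_diam le_max; apply/orP; right.
by apply: ereal_sup_ubound; exists x => //; exists y.
Qed.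

Lemma eucl_diam_le A (d : R) : 0 <= d ->
  (forall x y, A x -> A y -> eucl_dist x y <= d) -> (eucl_diam A <= d%:E)%E.
Proof.
move=> d0 h; rewrite /eucl_diam ge_max lee_fin d0 /=.
by apply: ge_ereal_sup => _ [x Ax [y Ay <-]]; rewrite lee_fin h.
Qed.

Lemma eucl_diam0 : eucl_diam (@set0 'rV[R]_n) = 0%E.
Proof.
by apply/eqP; rewrite eq_le eucl_diam_ge0 andbT; apply: eucl_diam_le => // x y [].
Qed.

Lemma eucl_diam_fin A (d : R) : (eucl_diam A <= d%:E)%E ->
  exists e : R, [/\ eucl_diam A = e%:E, 0 <= e & e <= d].
Proof.
move=> Ad; have A0 := eucl_diam_ge0 A.
have Af : eucl_diam A \is a fin_num by rewrite ge0_fin_numE// (le_lt_trans Ad) ?ltry.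
exists (fine (eucl_diam A)); rewrite fineK//; split => //; first exact: fine_ge0.
by rewrite -lee_fin fineK.
Qed.

End EuclideanDistance.

Section ErealInfSup.
Context {R : realType}.
Implicit Types (S T : set (\bar R)) (z : \bar R).
Local Open Scope ereal_scope.

Lemma le_add_ereal_inf S T z : 0 <= ereal_inf S -> 0 <= ereal_inf T ->
  (forall x y, S x -> T y -> z <= x + y) -> z <= ereal_inf S + ereal_inf T.
Proof.
move=> S0 T0 h.
have fin (x : \bar R) : 0 <= x -> x != +oo -> x \is a fin_num by move=> x0 xy; rewrite ge0_fin_numE// ltey.
have nNy (x : \bar R) : 0 <= x -> x != -oo by move=> x0; rewrite gt_eqF// (lt_le_trans _ x0)// ltNyr.
have h1 y : T y -> z <= ereal_inf S + y.
  move=> Ty; have y0 : 0 <= y by rewrite (le_trans T0)// ereal_inf_lbound.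
  have [->|yf] := eqVneq y +oo; first by rewrite addey ?leey// nNy.
  rewrite -leeBlDr; last exact: fin.
  by apply: le_ereal_inf_tmp => x Sx; rewrite leeBlDr ?fin// h.
have [->|yf] := eqVneq (ereal_inf S) +oo; first by rewrite addye ?leey// nNy.
rewrite -leeBlDl; last exact: fin.
by apply: le_ereal_inf_tmp => y Ty; rewrite leeBlDl ?fin// h1.
Qed.

Lemma ge_add_ereal_sup S T z : S !=set0 -> T !=set0 ->
  (forall x, S x -> 0 <= x) -> (forall x, T x -> 0 <= x) ->
  (forall x y, S x -> T y -> x + y <= z) -> ereal_sup S + ereal_sup T <= z.
Proof.
move=> [x0 Sx0] [y0 Ty0] S0 T0 h.
have [->|zy] := eqVneq z +oo; first by rewrite leey.
have fin (x : \bar R) : 0 <= x -> x <= z -> x \is a fin_num.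
  by move=> x_ge0 xz; rewrite ge0_fin_numE// (le_lt_trans xz)// ltey.
have h1 y : T y -> ereal_sup S + y <= z.
  move=> Ty; have yf : y \is a fin_num.
    by apply: fin; rewrite ?T0// (le_trans _ (h _ _ Sx0 Ty))// leeDr// S0.
  by rewrite -leeBrDr//; apply: ge_ereal_sup => x Sx; rewrite leeBrDr// h.
have Sf : ereal_sup S \is a fin_num.
  apply: fin; first by rewrite (le_trans (S0 _ Sx0))// ereal_sup_ubound.
  by rewrite (le_trans _ (h1 _ Ty0))// leeDl// T0.
by rewrite -leeBrDl//; apply: ge_ereal_sup => y Ty; rewrite leeBrDl// h1.
Qed.
End ErealInfSup.

Section Hausdorff.
Context {R : realType} {n : nat}.
Implicit Types (A B : set 'rV[R]_n) (F : nat -> set 'rV[R]_n) (d L : R).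

Definition diam_sq A : \bar R := ((pi / 4)%:E * eucl_diam A ^+ 2)%E.

Lemma diam_sq_ge0 A : (0 <= diam_sq A)%E.
Proof.
rewrite /diam_sq mule_ge0// ?lee_fin ?divr_ge0 ?pi_ge0//.
by rewrite expe_ge0// eucl_diam_ge0.
Qed.

Lemma diam_sq0 : diam_sq set0 = 0%E.
Proof. by rewrite /diam_sq eucl_diam0 expe2 mul0e mule0. Qed.

Lemma diam_sq_le A d : 0 <= d -> (eucl_diam A <= d%:E)%E ->
  (diam_sq A <= (pi / 4 * d ^+ 2)%:E)%E.
Proof.
move=> d0 /eucl_diam_fin[e [Ae e0 ed]]; rewrite /diam_sq Ae expe2 -!EFinM lee_fin -expr2.
by rewrite ler_wpM2l ?divr_ge0 ?pi_ge0// ler_sqr.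
Qed.

Definition cover_of d A F := A `<=` \bigcup_k F k /\ forall k, (eucl_diam (F k) <= d%:E)%E.

Lemma hausdorff2_delta_le d A F : cover_of d A F ->
  (hausdorff2_delta d A <= \sum_(0 <= k <oo) diam_sq (F k))%E.
Proof. by move=> h; apply: ereal_inf_lbound; exists F. Qed.

Lemma hausdorff2_delta_glb d A (x : \bar R) :
  (forall F, cover_of d A F -> (x <= \sum_(0 <= k <oo) diam_sq (F k))%E) ->
  (x <= hausdorff2_delta d A)%E.
Proof. by move=> h; apply: le_ereal_inf_tmp => _ [F hF <-]; exact: h. Qed.

Lemma hausdorff2_ub d A : 0 < d -> (hausdorff2_delta d A <= hausdorff2 A)%E.
Proof. by move=> d0; apply: ereal_sup_ubound; exists d. Qed.

Lemma hausdorff2_lub A (x : \bar R) :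
  (forall d, 0 < d -> (hausdorff2_delta d A <= x)%E) -> (hausdorff2 A <= x)%E.
Proof. by move=> h; apply: ge_ereal_sup => _ [d d0 <-]; exact: h. Qed.

Lemma hausdorff2_delta_ge0 d A : (0 <= hausdorff2_delta d A)%E.
Proof.
by apply: hausdorff2_delta_glb => F _; apply: nneseries_ge0 => k _ _; exact: diam_sq_ge0.
Qed.

Lemma hausdorff2_ge0 A : (0 <= hausdorff2 A)%E.
Proof. exact: le_trans (hausdorff2_delta_ge0 1 A) (hausdorff2_ub _ _). Qed.

Lemma hausdorff2_delta_mono d A B : A `<=` B ->
  (hausdorff2_delta d A <= hausdorff2_delta d B)%E.
Proof.
move=> AB; apply: hausdorff2_delta_glb => F [BF Fd]; apply: hausdorff2_delta_le.
by split => //; exact: subset_trans BF.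
Qed.

Lemma hausdorff2_mono A B : A `<=` B -> (hausdorff2 A <= hausdorff2 B)%E.
Proof.
move=> AB; apply: hausdorff2_lub => d d0.
exact: le_trans (hausdorff2_delta_mono d AB) (hausdorff2_ub _ d0).
Qed.

Lemma hausdorff2_delta_anti d d' A : d <= d' ->
  (hausdorff2_delta d' A <= hausdorff2_delta d A)%E.
Proof.
move=> dd'; apply: hausdorff2_delta_glb => F [AF Fd]; apply: hausdorff2_delta_le.
by split => // k; rewrite (le_trans (Fd k))// lee_fin.
Qed.

Lemma hausdorff2_delta_diam d A : (eucl_diam A <= d%:E)%E -> 0 <= d ->
  (hausdorff2_delta d A <= diam_sq A)%E.
Proof.
move=> Ad d0.
have -> : diam_sq A = (\sum_(0 <= k <oo) diam_sq (if k == 0%N then A else set0))%E.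
  rewrite (@nneseriesD1 _ _ 0%N)//; last by move=> k _; exact: diam_sq_ge0.
  rewrite eqxx eseries0 ?adde0// => k _ /=.
  by case: (k == 0%N) => //= _; exact: diam_sq0.
apply: hausdorff2_delta_le; split; first by move=> x Ax; exists 0%N.
by move=> k; case: ifP => // _; rewrite eucl_diam0 lee_fin.
Qed.

Lemma hausdorff2_delta0 d : 0 <= d -> hausdorff2_delta d (@set0 'rV[R]_n) = 0%E.
Proof.
move=> d0; apply/eqP; rewrite eq_le hausdorff2_delta_ge0 andbT.
by rewrite (le_trans (hausdorff2_delta_diam _ d0)) ?eucl_diam0 ?diam_sq0 ?lee_fin.
Qed.

Lemma hausdorff2_0 : hausdorff2 (@set0 'rV[R]_n) = 0%E.
Proof.
apply/eqP; rewrite eq_le hausdorff2_ge0 andbT; apply: hausdorff2_lub => d d0.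
by rewrite hausdorff2_delta0// ltW.
Qed.

(** Merges two covers into one sequence, even indices for the first and odd ones for the second. *)
Lemma nneseries_interleave (f g : nat -> \bar R) :
  (forall k, (0 <= f k)%E) -> (forall k, (0 <= g k)%E) ->
  (\sum_(0 <= k <oo) (if odd k then g k./2 else f k./2) <=
   \sum_(0 <= k <oo) f k + \sum_(0 <= k <oo) g k)%E.
Proof.
move=> f0 g0; pose h k := if odd k then g k./2 else f k./2.
rewrite -[X in (X <= _)%E]/(\sum_(0 <= k <oo) h k)%E.
have h0 k : (0 <= h k)%E by rewrite /h; case: ifP.
apply: lime_le; first exact: is_cvg_nneseries.
near=> m.
have le2 : (\sum_(0 <= k < m) h k <= \sum_(0 <= k < m.*2) h k)%E.
  have mm : (m <= m.*2)%N by rewrite -addnn leq_addr.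
  by rewrite [leRHS](big_cat_nat (leq0n m) mm)/= leeDl// sume_ge0.
apply: (le_trans le2).
have -> : (\sum_(0 <= k < m.*2) h k = \sum_(0 <= k < m) f k + \sum_(0 <= k < m) g k)%E.
  elim: (m) => [|k IH]; first by rewrite !big_nil adde0.
  rewrite doubleS !big_nat_recr//= IH /h /= odd_double /= uphalf_double doubleK.
  by rewrite -!addeA; congr (_ + _)%E; rewrite [RHS]addeCA.
by apply: leeD; exact: nneseries_lim_ge.
Unshelve. all: by end_near. Qed.

Lemma hausdorff2_deltaU d A B :
  (hausdorff2_delta d (A `|` B) <= hausdorff2_delta d A + hausdorff2_delta d B)%E.
Proof.
have key F G : cover_of d A F -> cover_of d B G ->
  (hausdorff2_delta d (A `|` B) <=
   \sum_(0 <= k <oo) diam_sq (F k) + \sum_(0 <= k <oo) diam_sq (G k))%E.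
  move=> [AF Fd] [BG Gd].
  apply: le_trans (nneseries_interleave (fun k => diam_sq_ge0 (F k)) (fun k => diam_sq_ge0 (G k))).
  rewrite [leRHS](_ : _ = \sum_(0 <= k <oo) diam_sq (if odd k then G k./2 else F k./2))%E; last first.
    by apply: eq_eseriesr => k _; case: ifP.
  apply: hausdorff2_delta_le; split; last by move=> k; case: ifP.
  move=> x [/AF|/BG] [k _ xk].
    by exists k.*2 => //; rewrite odd_double doubleK.
  by exists k.*2.+1 => //=; rewrite odd_double /= uphalf_double.
apply: le_add_ereal_inf; first exact: hausdorff2_delta_ge0.
- exact: hausdorff2_delta_ge0.
- by move=> _ _ [F AF <-] [G BG <-]; exact: key.
Qed.

Lemma hausdorff2U A B : (hausdorff2 (A `|` B) <= hausdorff2 A + hausdorff2 B)%E.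
Proof.
apply: hausdorff2_lub => d d0; apply: le_trans (hausdorff2_deltaU d A B) _.
by apply: leeD; exact: hausdorff2_ub.
Qed.

Lemma hausdorff2_delta_big (I : Type) (s : seq I) (A_ : I -> set 'rV[R]_n) d : 0 <= d ->
  (hausdorff2_delta d (\big[setU/set0]_(i <- s) A_ i) <= \sum_(i <- s) hausdorff2_delta d (A_ i))%E.
Proof.
move=> d0; elim: s => [|i s IH]; first by rewrite !big_nil hausdorff2_delta0.
by rewrite !big_cons (le_trans (hausdorff2_deltaU _ _ _))// leeD.
Qed.

Lemma hausdorff2_big (I : Type) (s : seq I) (A_ : I -> set 'rV[R]_n) :
  (hausdorff2 (\big[setU/set0]_(i <- s) A_ i) <= \sum_(i <- s) hausdorff2 (A_ i))%E.
Proof.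
elim: s => [|i s IH]; first by rewrite !big_nil hausdorff2_0.
by rewrite !big_cons (le_trans (hausdorff2U _ _))// leeD.
Qed.

Lemma hausdorff2_delta_lipschitz (f : 'rV[R]_n -> 'rV[R]_n) L d A : 0 < L ->
  (forall x y, eucl_dist (f x) (f y) <= L * eucl_dist x y) ->
  (hausdorff2_delta (L * d) (f @` A) <= (L ^+ 2)%:E * hausdorff2_delta d A)%E.
Proof.
move=> L0 fL; have L20 : 0 < L ^+ 2 by exact: exprn_gt0.
rewrite -lee_pdivrMl//; apply: hausdorff2_delta_glb => F [AF Fd].
have diamf k : (eucl_diam (f @` F k) <= (L%:E * eucl_diam (F k)))%E.
  have [e [Fe e0 _]] := eucl_diam_fin (Fd k); rewrite Fe -EFinM.
  apply: eucl_diam_le; first by rewrite mulr_ge0// ltW.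
  move=> _ _ [x Fx <-] [y Fy <-]; rewrite (le_trans (fL _ _))// ler_pM2l//.
  by rewrite -lee_fin -Fe eucl_diam_ub.
rewrite lee_pdivrMl// -nneseriesZl; last by move=> k _; exact: diam_sq_ge0.
apply: (@le_trans _ _ (\sum_(0 <= k <oo) diam_sq (f @` F k))%E).
  apply: hausdorff2_delta_le; split.
    by move=> _ [x /AF[k _ Fx] <-]; exists k => //; exists x.
  by move=> k; rewrite (le_trans (diamf k))// EFinM lee_pmul2l.
apply: lee_nneseries => [k _ _|k _]; first exact: diam_sq_ge0.
have [e [Fe e0 _]] := eucl_diam_fin (Fd k).
have := diamf k; rewrite Fe -EFinM => /(diam_sq_le (mulr_ge0 (ltW L0) e0)) h.
apply: le_trans h _; rewrite /diam_sq Fe expe2 -!EFinM lee_fin.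
by rewrite le_eqVlt; apply/orP; left; apply/eqP; ring.
Qed.

(** A set of diameter at most [d < r] cannot meet both [A] and [B], so every cover of the union
    splits into a cover of [A] and one of [B]. *)
Lemma hausdorff2_delta_separated A B d r : d < r ->
  (forall x y, A x -> B y -> r <= eucl_dist x y) ->
  (hausdorff2_delta d A + hausdorff2_delta d B <= hausdorff2_delta d (A `|` B))%E.
Proof.
move=> dr sep; apply: hausdorff2_delta_glb => F [ABF Fd].
pose FA k := if pselect (F k `&` A !=set0) then F k else set0.
pose FB k := if pselect (F k `&` A !=set0) then set0 else F k.
have -> : (\sum_(0 <= k <oo) diam_sq (F k) =
    \sum_(0 <= k <oo) diam_sq (FA k) + \sum_(0 <= k <oo) diam_sq (FB k))%E.
  rewrite -nneseriesD; try by move=> k _ _; exact: diam_sq_ge0.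
  apply: eq_eseriesr => k _; rewrite /FA /FB.
  by case: pselect => h; rewrite diam_sq0 ?adde0 ?add0e.
have d0 : (0 <= d%:E)%E by apply: le_trans (Fd 0%N); exact: eucl_diam_ge0.
apply: leeD; apply: hausdorff2_delta_le; split.
- move=> x Ax; have [k _ Fx] := ABF x (or_introl Ax); exists k => //.
  by rewrite /FA; case: pselect => // h; exfalso; apply: h; exists x.
- by move=> k; rewrite /FA; case: pselect => h; rewrite ?eucl_diam0 //; exact: Fd.
- move=> x Bx; have [k _ Fx] := ABF x (or_intror Bx); exists k => //.
  rewrite /FB; case: pselect => [h|//] /=; case: h => y [Fy Ay].
  have := le_trans (eucl_diam_ub Fy Fx) (Fd k); rewrite lee_fin => h.
  by have := lt_le_trans dr (le_trans (sep _ _ Ay Bx) h); rewrite ltxx.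
- by move=> k; rewrite /FB; case: pselect => h; rewrite ?eucl_diam0 //; exact: Fd.
Qed.

Lemma hausdorff2_separated A B r : 0 < r ->
  (forall x y, A x -> B y -> r <= eucl_dist x y) ->
  (hausdorff2 A + hausdorff2 B <= hausdorff2 (A `|` B))%E.
Proof.
move=> r0 sep; apply: ge_add_ereal_sup.
- by exists (hausdorff2_delta 1 A), 1; rewrite /= ?ltr01.
- by exists (hausdorff2_delta 1 B), 1; rewrite /= ?ltr01.
- by move=> _ [d _ <-]; exact: hausdorff2_delta_ge0.
- by move=> _ [d _ <-]; exact: hausdorff2_delta_ge0.
move=> _ _ [d1 d10 <-] [d2 d20 <-].
(* Passing to a smaller scale only increases the two terms, and below [r] they add up. *)
pose d := Num.min (Num.min d1 d2) (r / 2).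
have d0 : 0 < d by rewrite !lt_min d10 d20 divr_gt0.
apply: le_trans (hausdorff2_ub _ d0).
apply: le_trans (@hausdorff2_delta_separated _ _ _ r _ sep).
  apply: leeD; apply: hausdorff2_delta_anti; rewrite /d !ge_min lexx ?orbT//.
by rewrite /d gt_min; apply/orP; right; lra.
Qed.

Lemma hausdorff2_lipschitz (f : 'rV[R]_n -> 'rV[R]_n) L A : 0 < L ->
  (forall x y, eucl_dist (f x) (f y) <= L * eucl_dist x y) ->
  (hausdorff2 (f @` A) <= (L ^+ 2)%:E * hausdorff2 A)%E.
Proof.
move=> L0 fL; apply: hausdorff2_lub => d d0.
have -> : d = L * (d / L) by rewrite mulrCA divff ?mulr1// gt_eqF.
apply: le_trans (hausdorff2_delta_lipschitz _ _ L0 fL) _.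
by rewrite lee_wpmul2l ?lee_fin ?sqr_ge0// hausdorff2_ub// divr_gt0.
Qed.

End Hausdorff.

Section Separation.
Context {R : realType} {n : nat}.
Implicit Types (A B : set 'rV[R]_n) (lo hi x y p : 'rV[R]_n) (s : R) (tau : {perm 'I_n}).

Definition dist_separated A B := exists2 r, 0 < r & forall x y, A x -> B y -> r <= eucl_dist x y.

Lemma separated_big (I : eqType) (S : seq I) (A : set 'rV[R]_n) (B_ : I -> set 'rV[R]_n) :
  (forall i, i \in S -> dist_separated A (B_ i)) -> dist_separated A (\big[setU/set0]_(i <- S) B_ i).
Proof.
elim: S => [|i S IH] h; first by rewrite big_nil; exists 1 => // x y _ [].
have [r r0 hr] := h i (mem_head _ _).
have [r' r'0 hr'] : dist_separated A (\big[setU/set0]_(i <- S) B_ i).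
  by apply: IH => j js; apply: h; rewrite inE js orbT.
exists (Num.min r r'); first by rewrite lt_min r0.
rewrite big_cons => x y Ax [Bx|Bx]; rewrite ge_min; apply/orP; [left|right].
  exact: hr.
exact: hr'.
Qed.

Lemma hausdorff2_big_separated (I : eqType) (S : seq I) (A_ : I -> set 'rV[R]_n) :
  uniq S -> (forall i j, i \in S -> j \in S -> i != j -> dist_separated (A_ i) (A_ j)) ->
  (\sum_(i <- S) hausdorff2 (A_ i) <= hausdorff2 (\big[setU/set0]_(i <- S) A_ i))%E.
Proof.
elim: S => [|i S IH] /=; first by rewrite !big_nil hausdorff2_ge0.
move=> /andP[nis us] h; rewrite !big_cons.
have [|r r0 hr] := @separated_big I S (A_ i) A_.
  move=> j js; apply: h; rewrite ?mem_head ?inE ?js ?orbT//.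
  by apply: contraNneq nis => ->.
apply: le_trans (hausdorff2_separated r0 hr); apply: leeD => //; apply: IH => // j k js ks.
by apply: h; rewrite inE ?js ?ks orbT.
Qed.

Definition cbox (lo hi : 'rV[R]_n) : set 'rV[R]_n :=
  [set x | forall i, lo 0 i <= x 0 i <= hi 0 i].

Lemma separated_cbox lo hi lo' hi' i : hi 0 i < lo' 0 i ->
  dist_separated (cbox lo hi) (cbox lo' hi') /\ dist_separated (cbox lo' hi') (cbox lo hi).
Proof.
move=> lt; split; exists (lo' 0 i - hi 0 i); rewrite ?subr_gt0// => x y /(_ i)/andP[x1 x2] /(_ i)/andP[y1 y2];
  apply: le_trans (coord_le_eucl_dist _ _ i).
  by rewrite distrC ger0_norm; lra.
by rewrite ger0_norm; lra.
Qed.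

(** Scalings, translations and coordinate permutations suffice to carry a reference square to every
    axis-parallel square. *)
Definition similarity (p : 'rV[R]_n) (s : R) (tau : {perm 'I_n}) (x : 'rV[R]_n) : 'rV[R]_n :=
  \row_k (p 0 k + s * x 0 (tau k)).

Lemma similarity_dist p s tau x y : 0 <= s ->
  eucl_dist (similarity p s tau x) (similarity p s tau y) = s * eucl_dist x y.
Proof.
move=> s0; rewrite /eucl_dist -[in RHS](ger0_norm s0) -sqrtr_sqr -sqrtrM ?sqr_ge0//.
congr Num.sqrt; rewrite big_distrr /= [RHS](reindex_inj (@perm_inj _ tau)) /=.
by apply: eq_bigr => k _; rewrite !mxE; ring.
Qed.

Lemma similarityK p s tau : s != 0 ->
  cancel (similarity p s tau)
    (similarity (\row_k (- (p 0 ((tau^-1)%g k) / s))) s^-1 (tau^-1)%g).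
Proof.
move=> s0 x; apply/rowP => k; rewrite !mxE permKV; field; exact: s0.
Qed.

(** Both inequalities come from the Lipschitz estimate, applied to the map and to its inverse. *)
Lemma hausdorff2_similarity p s tau A : 0 < s ->
  hausdorff2 (similarity p s tau @` A) = ((s ^+ 2)%:E * hausdorff2 A)%E.
Proof.
move=> s0; apply/eqP; rewrite eq_le; apply/andP; split.
  by apply: hausdorff2_lipschitz => // x y; rewrite similarity_dist// ltW.
rewrite -lee_pdivlMl ?exprn_gt0//.
have := @hausdorff2_lipschitz R n
  (similarity (\row_k (- (p 0 ((tau^-1)%g k) / s))) s^-1 (tau^-1)%g) s^-1
  (similarity p s tau @` A).
rewrite image_comp (_ : _ @` A = A) ?exprVn; last first.
  rewrite -[RHS]image_id; apply: eq_imagel => x Ax /=.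
  by rewrite similarityK// gt_eqF.
apply; first by rewrite invr_gt0.
by move=> x y; rewrite similarity_dist// invr_ge0 ltW.
Qed.

Lemma similarity_cbox p s tau lo hi : 0 < s ->
  similarity p s tau @` cbox lo hi = cbox (similarity p s tau lo) (similarity p s tau hi).
Proof.
move=> s0; apply/seteqP; split => [_ [x hx <-] k|y hy].
  by rewrite !mxE !lerD2l !ler_pM2l.
exists (similarity (\row_k (- (p 0 ((tau^-1)%g k) / s))) s^-1 (tau^-1)%g y).
  move=> k; have := hy ((tau^-1)%g k); rewrite !mxE permKV.
  set z := y _ _; set q := p _ _ => /andP[h1 h2].
  have -> : - (q / s) + s^-1 * z = (z - q) / s by ring.
  by rewrite ler_pdivlMr// ler_pdivrMr//; apply/andP; split; lra.
by apply/rowP => k; rewrite !mxE permK; field; rewrite gt_eqF.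
Qed.

End Separation.

(** * Rectangles compared with the unit square *)

Section Rectangles.
Context {R : realType}.
Local Notation space := 'rV[R]_3.
Implicit Types (t a b u v s : R).

Lemma ord3P (P : 'I_3 -> Prop) : P ord0 -> P (inord 1) -> P (inord 2) -> forall i, P i.
Proof.
move=> h0 h1 h2 [[|[|[|//]]] hi].
- by have -> : Ordinal hi = ord0 by apply/val_inj.
- by have -> : Ordinal hi = inord 1 by apply/val_inj; rewrite /= inordK.
- by have -> : Ordinal hi = inord 2 by apply/val_inj; rewrite /= inordK.
Qed.

Lemma row3_0 a b u : (row3 a b u : space) 0 ord0 = a.
Proof. by rewrite mxE. Qed.

Lemma row3_1 a b u : (row3 a b u : space) 0 (inord 1) = b.
Proof. by rewrite mxE inordK. Qed.

Lemma row3_2 a b u : (row3 a b u : space) 0 (inord 2) = u.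
Proof. by rewrite mxE inordK. Qed.

Definition row3E := (row3_0, row3_1, row3_2).

Lemma sum3 (F : 'I_3 -> R) : \sum_i F i = F ord0 + F (inord 1) + F (inord 2).
Proof.
rewrite !big_ord_recl big_ord0 addr0 addrA; congr (_ + F _ + F _); apply/val_inj;
  by rewrite /= inordK.
Qed.

Definition rect0 a b u v : set space := cbox (row3 0 a b) (row3 0 (a + u) (b + v)).

Lemma rect0P a b u v (x : space) : rect0 a b u v x <->
  [/\ x 0 ord0 = 0, a <= x 0 (inord 1) <= a + u & b <= x 0 (inord 2) <= b + v].
Proof.
split=> [h|[h0 h1 h2]].
  have := h ord0; have := h (inord 1); have := h (inord 2); rewrite !row3E => -> -> /andP[h1 h2].
  by split => //; apply/eqP; rewrite eq_le h1 h2.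
by apply: ord3P; rewrite !row3E// h0 lexx.
Qed.

Definition unit_area : \bar R := hausdorff2 (rect0 0 0 1 1).

Lemma hausdorff2_rect0_square a b s : 0 < s ->
  hausdorff2 (rect0 a b s s) = ((s ^+ 2)%:E * unit_area)%E.
Proof.
move=> s0; rewrite -(hausdorff2_similarity (row3 0 a b) 1 _ s0) similarity_cbox//.
congr (hausdorff2 (cbox _ _)); apply/rowP; apply: ord3P;
  by rewrite [RHS]mxE perm1 !row3E; ring.
Qed.

Lemma truncP (x : R) : 0 <= x -> exists m : nat, m%:R <= x < m.+1%:R.
Proof. by move=> /truncn_itv h; exists (Num.truncn x). Qed.

Lemma rect0_cover u v s : 0 <= u -> 0 <= v -> 0 < s -> exists K L : nat,
  [/\ K%:R * s <= u + s, L%:R * s <= v + s &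
  rect0 0 0 u v `<=` \big[setU/set0]_(p : 'I_K * 'I_L) rect0 (p.1%:R * s) (p.2%:R * s) s s].
Proof.
move=> u0 v0 s0.
have [K /andP[K1 K2]] : exists m : nat, m%:R <= u / s < m.+1%:R by apply: truncP; rewrite divr_ge0// ltW.
have [L /andP[L1 L2]] : exists m : nat, m%:R <= v / s < m.+1%:R by apply: truncP; rewrite divr_ge0// ltW.
exists K.+1, L.+1; split.
- by move: K1; rewrite ler_pdivlMr// -natr1 mulrDl mul1r lerD2r.
- by move: L1; rewrite ler_pdivlMr// -natr1 mulrDl mul1r lerD2r.
move=> x /rect0P[x0 /andP[x1 x1'] /andP[x2 x2']]; rewrite -bigcup_seq.
rewrite add0r in x1'; rewrite add0r in x2'.
have idx (y w : R) (M : nat) : 0 <= y -> y <= w -> w / s < M.+1%:R ->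
    exists m : 'I_M.+1, m%:R * s <= y <= m%:R * s + s.
  move=> y0 yw wM; have [m /andP[m1 m2]] : exists m : nat, m%:R <= y / s < m.+1%:R.
    by apply: truncP; rewrite divr_ge0// ltW.
  have mM : (m < M.+1)%N.
    rewrite -(ltr_nat R) (le_lt_trans m1)// (le_lt_trans _ wM)// ler_pM2r// invr_gt0//.
  exists (Ordinal mM) => /=; move: m1 m2; rewrite ler_pdivlMr// ltr_pdivrMr// => -> /ltW.
  by rewrite -natr1 mulrDl mul1r.
have [k hk] := idx _ _ _ x1 x1' K2; have [l hl] := idx _ _ _ x2 x2' L2.
exists (k, l) => /=; first by rewrite mem_index_enum.
by apply/rect0P.
Qed.

Lemma sume_const_pair (K L : nat) (x : R) :
  (\sum_(p : 'I_K * 'I_L) x%:E = ((K%:R * L%:R) * x)%:E)%E.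
Proof.
by rewrite sumEFin big_const card_prod !card_ord iter_addr_0 -[x *+ _]mulr_natl natrM.
Qed.

Lemma rect0_diam a b s : 0 <= s -> (eucl_diam (rect0 a b s s) <= (2 * s)%:E)%E.
Proof.
move=> s0; apply: eucl_diam_le; first by rewrite mulr_ge0.
move=> x y /rect0P[x0 x1 x2] /rect0P[y0 y1 y2]; apply: eucl_dist_le_sq.
  by rewrite mulr_ge0.
rewrite sum3 x0 y0 subrr expr0n /= add0r.
have sq (z w c : R) : c <= z <= c + s -> c <= w <= c + s -> (z - w) ^+ 2 <= s ^+ 2.
  move=> /andP[z1 z2] /andP[w1 w2]; rewrite -real_normK ?num_real//.
  by rewrite ler_sqr ?nnegrE// ler_norml; apply/andP; split; lra.
have := sq _ _ _ x1 y1; have := sq _ _ _ x2 y2; have := sqr_ge0 s.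
rewrite exprMn -natrX; lra.
Qed.

Lemma unit_area_lty : (unit_area < +oo)%E.
Proof.
apply: (@le_lt_trans _ _ (4 * pi)%:E); last by rewrite ltry.
(* At most (1 + s)/s squares are needed in each direction. Each has diameter at most 2s, hence
   contributes at most pi s^2, and s <= 1 gives the total 4 pi. *)
apply: hausdorff2_lub => d d0; pose s := Num.min 1 (d / 2).
have s0 : 0 < s by rewrite lt_min ltr01 divr_gt0.
have s1 : s <= 1 by rewrite ge_min lexx.
have sd : 2 * s <= d.
  have : s <= d / 2 by rewrite ge_min lexx orbT.
  lra.
have [K [L [hK hL hc]]] := rect0_cover ler01 ler01 s0.
apply: le_trans (hausdorff2_delta_mono d hc) _.
apply: le_trans (hausdorff2_delta_big _ _ (ltW d0)) _.
apply: (@le_trans _ _ (\sum_(p : 'I_K * 'I_L) (pi * s ^+ 2)%:E)%E).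
  apply: lee_sum => p _.
  have h := rect0_diam (p.1%:R * s) (p.2%:R * s) (ltW s0).
  have h' : (eucl_diam (rect0 (p.1%:R * s) (p.2%:R * s) s s) <= d%:E)%E.
    by rewrite (le_trans h)// lee_fin.
  apply: le_trans (hausdorff2_delta_diam h' (ltW d0)) _.
  apply: le_trans (diam_sq_le _ h) _; first by rewrite mulr_ge0// ltW.
  by rewrite lee_fin exprMn -natrX; lra.
rewrite sume_const_pair lee_fin.
have -> : K%:R * L%:R * (pi * s ^+ 2) = (K%:R * s) * (L%:R * s) * pi by ring.
rewrite ler_wpM2r ?pi_ge0//.
apply: (@le_trans _ _ (2 * 2)); last by rewrite -natrM.
by apply: ler_pM; rewrite ?mulr_ge0 ?(ltW s0)//; lra.
Qed.

Lemma hausdorff2_rect0_le u v : 0 <= u -> 0 <= v ->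
  (hausdorff2 (rect0 0 0 u v) <= (u * v)%:E * unit_area)%E.
Proof.
move=> u0 v0; have c_lty := unit_area_lty; have c0 : (0 <= unit_area)%E by exact: hausdorff2_ge0.
set C := fine unit_area; have CE : unit_area = C%:E by rewrite fineK// ge0_fin_numE.
have C0 : 0 <= C by exact: fine_ge0.
apply/lee_addgt0Pr => e e0.
(* The covering squares exceed the rectangle by area at most s (u + v + 1). The final 1 keeps the
   denominator positive. *)
pose s := Num.min 1 (e / ((u + v + 1) * C + 1)).
have k0 : 0 < (u + v + 1) * C + 1.
  by rewrite ltr_wpDl// mulr_ge0// !addr_ge0.
have s0 : 0 < s by rewrite lt_min ltr01 divr_gt0.
have s1 : s <= 1 by rewrite ge_min lexx.
have se : s * ((u + v + 1) * C + 1) <= e.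
  by rewrite -ler_pdivlMr// ge_min lexx orbT.
have [K [L [hK hL hc]]] := rect0_cover u0 v0 s0.
apply: le_trans (hausdorff2_mono hc) _.
apply: le_trans (hausdorff2_big _ _) _.
under eq_bigr do rewrite hausdorff2_rect0_square// CE -EFinM.
rewrite sume_const_pair CE -EFinM -EFinD lee_fin.
have -> : K%:R * L%:R * (s ^+ 2 * C) = (K%:R * s) * (L%:R * s) * C by ring.
have h : (K%:R * s) * (L%:R * s) <= (u + s) * (v + s).
  by apply: ler_pM; rewrite ?mulr_ge0// ltW.
have h2 : s * s <= s by rewrite -[leRHS]mulr1 ler_pM2l.
apply: (@le_trans _ _ ((u + s) * (v + s) * C)); first by rewrite ler_wpM2r.
have h3 : (u + s) * (v + s) <= u * v + s * (u + v + 1).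
  have -> : (u + s) * (v + s) = u * v + s * (u + v) + s * s by ring.
  lra.
apply: (@le_trans _ _ ((u * v + s * (u + v + 1)) * C)); first by rewrite ler_wpM2r.
have -> : (u * v + s * (u + v + 1)) * C = u * v * C + s * ((u + v + 1) * C) by ring.
rewrite lerD2l; apply: le_trans se; rewrite ler_pM2l//; lra.
Qed.

(** In a grid of step [s] the squares are shrunk to side s (1 - s): this leaves gaps of s^2, which
    makes them separated, and the loss vanishes with [s]. *)
Lemma rect0_pack u v s : 0 < s -> s < 1 -> s <= u -> s <= v -> exists K L : nat,
  [/\ u - s <= K%:R * s, v - s <= L%:R * s &
  \big[setU/set0]_(p : 'I_K * 'I_L) rect0 (p.1%:R * s) (p.2%:R * s) (s * (1 - s)) (s * (1 - s))
    `<=` rect0 0 0 u v].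
Proof.
move=> s0 s1 su sv.
have [K /andP[K1 K2]] : exists m : nat, m%:R <= u / s < m.+1%:R by apply: truncP; rewrite divr_ge0//; lra.
have [L /andP[L1 L2]] : exists m : nat, m%:R <= v / s < m.+1%:R by apply: truncP; rewrite divr_ge0//; lra.
rewrite ler_pdivlMr// in K1; rewrite ler_pdivlMr// in L1.
rewrite ltr_pdivrMr// -natr1 mulrDl mul1r in K2; rewrite ltr_pdivrMr// -natr1 mulrDl mul1r in L2.
exists K, L; split; [lra|lra|].
move=> x; rewrite -bigcup_seq => -[[k l] _ /= /rect0P[x0 x1 x2]]; apply/rect0P.
have idx (M : nat) (m : 'I_M) (y w : R) : M%:R * s <= w ->
    m%:R * s <= y <= m%:R * s + s * (1 - s) -> 0 <= y <= 0 + w.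
  move=> Mw /andP[y1 y2]; have m0 : 0 <= m%:R * s by rewrite mulr_ge0// ltW.
  have : (m%:R + 1) * s <= M%:R * s by rewrite natr1 ler_pM2r// ler_nat ltn_ord.
  have : 0 < s * s by rewrite mulr_gt0.
  by move=> h h'; apply/andP; split; lra.
by split => //; [exact: idx K1 x1|exact: idx L1 x2].
Qed.

Lemma hausdorff2_rect0_ge u v : 0 < u -> 0 < v ->
  ((u * v)%:E * unit_area <= hausdorff2 (rect0 0 0 u v))%E.
Proof.
move=> u0 v0; have c_lty := unit_area_lty; have c0 : (0 <= unit_area)%E by exact: hausdorff2_ge0.
set C := fine unit_area; have CE : unit_area = C%:E by rewrite fineK// ge0_fin_numE.
have C0 : 0 <= C by exact: fine_ge0.
apply/lee_addgt0Pr => e e0.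
(* The constant comes from (u - s)(v - s)(1 - s)^2 >= u v - s (u + v + 2 u v). *)
pose k := (u + v + 2 * (u * v)) * C + 1.
have k0 : 0 < k.
  by rewrite /k ltr_wpDl// mulr_ge0// !addr_ge0 ?mulr_ge0// ltW.
pose s := Num.min (Num.min (1 / 2) (e / k)) (Num.min u v).
have s0 : 0 < s by rewrite !lt_min u0 v0 !divr_gt0.
have s1 : s <= 1 / 2 by rewrite !ge_min lexx.
have su : s <= u by rewrite !ge_min lexx !orbT.
have sv : s <= v by rewrite !ge_min lexx !orbT.
have se : s * k <= e by rewrite -ler_pdivlMr// !ge_min lexx !orbT.
have s1' : s < 1 by lra.
have [K [L [hK hL hc]]] := rect0_pack s0 s1' su sv.
have s10 : 0 < s * (1 - s) by rewrite mulr_gt0//; lra.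
apply: (@le_trans _ _ (\sum_(p : 'I_K * 'I_L) ((s * (1 - s)) ^+ 2 * C)%:E + e%:E)%E).
  rewrite sume_const_pair CE -EFinM -EFinD lee_fin.
  have -> : K%:R * L%:R * ((s * (1 - s)) ^+ 2 * C) = (K%:R * s) * (L%:R * s) * ((1 - s) ^+ 2 * C) by ring.
  have h : (u - s) * (v - s) <= (K%:R * s) * (L%:R * s).
    by apply: ler_pM => //; lra.
  have C2 : 0 <= (1 - s) ^+ 2 * C by rewrite mulr_ge0// sqr_ge0.
  apply: (@le_trans _ _ ((u - s) * (v - s) * ((1 - s) ^+ 2 * C) + e)); last first.
    by rewrite lerD2r ler_wpM2r.
  have h3 : u * v - s * (u + v + 2 * (u * v)) <= (u - s) * (v - s) * (1 - s) ^+ 2.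
    have uv0 : 0 < u * v by rewrite mulr_gt0.
    rewrite -subr_ge0.
    have -> : (u - s) * (v - s) * (1 - s) ^+ 2 - (u * v - s * (u + v + 2 * (u * v))) =
      s * s * (u * v + (1 - s) ^+ 2) + s * ((u + v) * (2 * s - s * s)) by ring.
    rewrite addr_ge0// mulr_ge0// ?mulr_ge0 ?(ltW s0)//.
      by rewrite addr_ge0 ?sqr_ge0// ltW.
      by rewrite addr_ge0 // ltW.
    by rewrite -mulrBl mulr_ge0 ?(ltW s0)//; lra.
  have := ler_wpM2r C0 h3; move: se; rewrite /k.
  have -> : (u - s) * (v - s) * ((1 - s) ^+ 2 * C) = (u - s) * (v - s) * (1 - s) ^+ 2 * C by ring.
  lra.
rewrite leeD2r//; apply: le_trans (hausdorff2_mono hc).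
apply: (@le_trans _ _ (\sum_(p : 'I_K * 'I_L) hausdorff2 (rect0 (p.1%:R * s) (p.2%:R * s) (s * (1 - s)) (s * (1 - s))))%E).
  by apply: lee_sum => p _; rewrite hausdorff2_rect0_square// CE -EFinM.
apply: hausdorff2_big_separated; first exact: index_enum_uniq.
move=> [k1 l1] [k2 l2] _ _ ne.
have idx (M : nat) (m m' : 'I_M) : (m < m')%N -> m%:R * s + s * (1 - s) < m'%:R * s.
  move=> mm'; have : (m%:R + 1) * s <= m'%:R * s by rewrite natr1 ler_pM2r// ler_nat.
  have : 0 < s * s by rewrite mulr_gt0.
  by move=> h h'; lra.
have [kk|kk|kk] := ltngtP k1 k2.
- by have [] := @separated_cbox R 3 (row3 0 (k1%:R * s) (l1%:R * s)) (row3 0 (k1%:R * s + s * (1 - s)) (l1%:R * s + s * (1 - s))) (row3 0 (k2%:R * s) (l2%:R * s)) (row3 0 (k2%:R * s + s * (1 - s)) (l2%:R * s + s * (1 - s))) (inord 1); rewrite ?row3E ?idx.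
- by have [] := @separated_cbox R 3 (row3 0 (k2%:R * s) (l2%:R * s)) (row3 0 (k2%:R * s + s * (1 - s)) (l2%:R * s + s * (1 - s))) (row3 0 (k1%:R * s) (l1%:R * s)) (row3 0 (k1%:R * s + s * (1 - s)) (l1%:R * s + s * (1 - s))) (inord 1); rewrite ?row3E ?idx.
have [ll|ll|ll] := ltngtP l1 l2.
- by have [] := @separated_cbox R 3 (row3 0 (k1%:R * s) (l1%:R * s)) (row3 0 (k1%:R * s + s * (1 - s)) (l1%:R * s + s * (1 - s))) (row3 0 (k2%:R * s) (l2%:R * s)) (row3 0 (k2%:R * s + s * (1 - s)) (l2%:R * s + s * (1 - s))) (inord 2); rewrite ?row3E ?idx.
- by have [] := @separated_cbox R 3 (row3 0 (k2%:R * s) (l2%:R * s)) (row3 0 (k2%:R * s + s * (1 - s)) (l2%:R * s + s * (1 - s))) (row3 0 (k1%:R * s) (l1%:R * s)) (row3 0 (k1%:R * s + s * (1 - s)) (l1%:R * s + s * (1 - s))) (inord 2); rewrite ?row3E ?idx.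
by move/eqP: ne; case; congr (_, _); exact/val_inj.
Qed.

End Rectangles.

(** * Positivity of the area unit and areas of faces *)

Section UnitArea.
Context {R : realType}.
Local Notation space := 'rV[R]_3.
Local Notation leb := (@lebesgue_measure R).

Lemma lebesgue_itv_cc (a b : R) : a <= b -> leb `[a, b]%classic = (b - a)%:E.
Proof.
rewrite le_eqVlt => /predU1P[->|ab]; rewrite lebesgue_measure_itv /= lte_fin.
  by rewrite ltxx subrr.
by rewrite ab EFinB.
Qed.

Lemma lebesgue2_itv_cc (a b c d : R) : a <= b -> c <= d ->
  (leb \x leb)%E (`[a, b]%classic `*` `[c, d]%classic) = ((b - a) * (d - c))%:E.
Proof.
move=> ab cd; rewrite product_measure1E; try exact: measurable_itv.
by rewrite EFinM; congr (_ * _)%E; exact: lebesgue_itv_cc.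
Qed.

(** Comparison with Lebesgue measure: in its last two coordinates a set of diameter e lies in a
    square of side 2e, so a cover of the unit square has squared diameters of sum at least 1/4. This
    gives the lower bound pi / 16. *)
Lemma unit_area_gt0 : (0 < @unit_area R)%E.
Proof.
apply: (@lt_le_trans _ _ (pi / 16)%:E); first by rewrite lte_fin divr_gt0 ?pi_gt0.
apply: le_trans (hausdorff2_ub _ ltr01); apply: hausdorff2_delta_glb => F [cF Fd].
have /choice[e he] k : exists e : R, [/\ eucl_diam (F k) = e%:E, 0 <= e & e <= 1].
  exact: eucl_diam_fin.
pose p k : space := xget 0 (F k).
pose G k : set (R * R) := if pselect (F k !=set0) then
   (`[p k 0 (inord 1) - e k, p k 0 (inord 1) + e k]%classic `*`
    `[p k 0 (inord 2) - e k, p k 0 (inord 2) + e k]%classic) else set0.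
have mG k : measurable (G k).
  by rewrite /G; case: pselect => h; [apply: measurableX; exact: measurable_itv|exact: measurable0].
have lG k : ((leb \x leb) (G k) <= (4 * e k ^+ 2)%:E)%E.
  have [_ e0 _] := he k.
  rewrite /G; case: pselect => h; last by rewrite measure0 lee_fin mulr_ge0// sqr_ge0.
  rewrite lebesgue2_itv_cc; [|lra|lra].
  by rewrite lee_fin le_eqVlt; apply/orP; left; apply/eqP; ring.
have GU : `[0 : R, 1]%classic `*` `[0 : R, 1]%classic `<=` \bigcup_k G k.
  move=> [y z] /= [hy hz].
  have [k _ Fk] : (\bigcup_k F k) (row3 0 y z).
    apply: cF; apply/rect0P; rewrite !row3E !add0r.
    by move: hy hz; rewrite /= !in_itv /=.
  exists k => //; rewrite /G; case: pselect => [h|h]; last by exfalso; apply: h; exists (row3 0 y z).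
  have Fp : F k (p k) by apply: xgetPex; exists (row3 0 y z).
  have [ek e0 _] := he k.
  have h1 : eucl_dist (row3 0 y z) (p k) <= e k by rewrite -lee_fin -ek eucl_diam_ub.
  have := le_trans (coord_le_eucl_dist _ _ (inord 1)) h1.
  have := le_trans (coord_le_eucl_dist _ _ (inord 2)) h1.
  rewrite !row3E !ler_norml => /andP[a1 a2] /andP[b1 b2].
  by split; rewrite /= in_itv /=; apply/andP; split; lra.
have h : (1%:E <= \sum_(0 <= k <oo) (4 * e k ^+ 2)%:E)%E.
  have <- : (leb \x leb)%E (`[0 : R, 1]%classic `*` `[0 : R, 1]%classic) = 1%:E.
    by rewrite lebesgue2_itv_cc// subr0 mulr1.
  apply: (@le_trans _ _ (\sum_(0 <= k <oo) (leb \x leb)%E (G k))%E).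
    apply: (@measure_sigma_subadditive _ _ _ (leb \x leb)%E _ _ mG _ GU).
    by apply: measurableX; exact: measurable_itv.
  by apply: lee_nneseries => // k _ _; exact: measure_ge0.
rewrite (_ : (pi / 16)%:E = ((pi / 16)%:E * 1%:E)%E); last by rewrite mule1.
apply: (@le_trans _ _ ((pi / 16)%:E * \sum_(0 <= k <oo) (4 * e k ^+ 2)%:E)%E).
  by rewrite lee_wpmul2l// lee_fin divr_ge0// pi_ge0.
rewrite -nneseriesZl; last by move=> k _; rewrite lee_fin mulr_ge0// sqr_ge0.
apply: lee_nneseries => k _; first by move=> _; rewrite -EFinM lee_fin mulr_ge0 ?divr_ge0 ?pi_ge0// mulr_ge0// sqr_ge0.
have [ek e0 _] := he k.
rewrite /diam_sq ek expe2 -!EFinM lee_fin le_eqVlt; apply/orP; left; apply/eqP; lra.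
Qed.

(** The transposition of 0 and [d] enumerates the two other directions; [hausdorff2_face] uses the
    same one to bring the face into the plane of [rect0]. *)
Lemma prod3_neq (f : 'I_3 -> R) d :
  \prod_(j < 3 | j != d) f j = f (tperm ord0 d (inord 1)) * f (tperm ord0 d (inord 2)).
Proof.
have e01 : (inord 1 == ord0 :> 'I_3) = false by rewrite -val_eqE /= inordK.
have e02 : (inord 2 == ord0 :> 'I_3) = false by rewrite -val_eqE /= inordK.
have e12 : (inord 1 == inord 2 :> 'I_3) = false by rewrite -val_eqE /= !inordK.
have e10 : (ord0 == inord 1 :> 'I_3) = false by rewrite eq_sym.
have e20 : (ord0 == inord 2 :> 'I_3) = false by rewrite eq_sym.
have e21 : (inord 2 == inord 1 :> 'I_3) = false by rewrite eq_sym.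
have l1 : lift ord0 ord0 = inord 1 :> 'I_3 by apply/val_inj; rewrite /= inordK.
have l2 : lift ord0 (lift ord0 ord0) = inord 2 :> 'I_3 by apply/val_inj; rewrite /= inordK.
rewrite big_mkcond !big_ord_recl big_ord0 /= mulr1 l2 l1.
move: d; apply: ord3P.
- by rewrite tperm1 !perm1 eqxx e01 e02 mul1r.
- by rewrite tpermR tpermD ?e20 ?e12// e10 eqxx e21 mul1r.
- by rewrite tpermR tpermD ?e10 ?e21// e20 eqxx e12 mulr1 mulrC.
Qed.

Lemma hausdorff2_face (lo hi : space) d : lo 0 d = hi 0 d -> (forall j, lo 0 j <= hi 0 j) ->
  (hausdorff2 (cbox lo hi) <= (\prod_(j < 3 | j != d) (hi 0 j - lo 0 j))%:E * unit_area)%E /\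
  ((forall j, j != d -> lo 0 j < hi 0 j) ->
   ((\prod_(j < 3 | j != d) (hi 0 j - lo 0 j))%:E * unit_area <= hausdorff2 (cbox lo hi))%E).
Proof.
move=> lohi le; pose tau := tperm ord0 d.
set u := hi 0 (tau (inord 1)) - lo 0 (tau (inord 1)).
set v := hi 0 (tau (inord 2)) - lo 0 (tau (inord 2)).
have tauK k : tau (tau k) = k by rewrite /tau tpermK.
have -> : cbox lo hi = similarity lo 1 tau @` rect0 0 0 u v.
  rewrite similarity_cbox//; congr cbox; apply/rowP => k; rewrite [RHS]mxE mul1r.
    have -> : (row3 0 0 0 : space) 0 (tau k) = 0 by move: (tau k); apply: ord3P; rewrite row3E.
    by rewrite addr0.
  have -> : (row3 0 (0 + u) (0 + v) : space) 0 (tau k) = hi 0 (tau (tau k)) - lo 0 (tau (tau k)).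
    move: (tau k); apply: ord3P; rewrite row3E ?add0r//.
    by rewrite /tau tpermL lohi subrr.
  by rewrite tauK addrC subrK.
rewrite hausdorff2_similarity// expr1n mul1e prod3_neq -/tau -/u -/v.
split; first by apply: hausdorff2_rect0_le; rewrite subr_ge0.
move=> lt; apply: hausdorff2_rect0_ge; rewrite subr_gt0 lt// -(inj_eq (@perm_inj _ tau)) tauK /tau tpermR;
 by rewrite -val_eqE /= inordK.
Qed.

End UnitArea.

(** * Volume, measurability and density *)

Section RowTopology.
Context {R : realType} {n : nat}.
Implicit Types (x y : 'rV[R]_n) (A : set 'rV[R]_n) (e : R).

Lemma nbhs_coordP x A : nbhs x A <->
  exists2 e, 0 < e & forall y, (forall i, `|x 0 i - y 0 i| < e) -> A y.
Proof.
split=> [/nbhs_ballP[e /= e0 h]|[e e0 h]].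
  exists e => // y hy; apply: h; split => // i j; rewrite (ord1 i); exact: hy.
apply/nbhs_ballP; exists e => //= y [_ hy]; apply: h => i; exact: hy.
Qed.

(** Along the segment from [x] to [y], membership in [X] is both an open and a closed condition, so
    connectedness decides. It is meant for open grid cells, which avoid the boundary of the cubical
    set. *)
Lemma segment_in_or_out (C X : set 'rV[R]_n) : closed X ->
  (forall x y s, C x -> C y -> 0 <= s <= 1 -> C (x + s *: (y - x))) ->
  (forall x, C x -> X x -> nbhs x X) ->
  forall x y, C x -> C y -> X x -> X y.
Proof.
move=> clX convC intX x y Cx Cy Xx.
pose g (s : R) : 'rV[R]_n := x + s *: (y - x).
have cg : continuous g.
  move=> s; apply: cvgD; first exact: cvg_cst.
  exact: scalel_continuous.
have g0 : g 0 = x by rewrite /g scale0r addr0.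
have g1 : g 1 = y by rewrite /g scale1r addrC subrK.
have B0 : `[0, 1] `&` g @^-1` X !=set0 by exists 0; rewrite /= g0 in_itv/= lexx ler01.
have Bo : exists2 D : set R, open D & `[0, 1] `&` g @^-1` X = `[0, 1] `&` D.
  exists (g @^-1` (interior X)); first by apply: open_comp => //; exact: open_interior.
  apply/seteqP; split => s [/= s01 Xs]; split => //; last exact: interior_subset.
  by apply: intX => //; apply: convC => //; move: s01; rewrite in_itv.
have Bc : exists2 D : set R, closed D & `[0, 1] `&` g @^-1` X = `[0, 1] `&` D.
  by exists (g @^-1` X) => //; apply: closed_comp => // s _; exact: cg.
have e := @segment_connected R 0 1 _ B0 Bo Bc.
have : (`[0, 1]%classic : set R) 1 by rewrite /= in_itv /= ler01 lexx.
by rewrite -e => -[_ /=]; rewrite g1.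
Qed.

End RowTopology.

Section Volume.
Context {R : realType}.
Local Notation space := 'rV[R]_3.
Local Notation leb := (@lebesgue_measure R).
Local Notation leb3 := ((leb \x leb) \x leb)%E.
Local Notation RT := (measurableTypeR R).
Implicit Types (U W X : set space) (lo hi : space).

(** [volume] is the product measure of this preimage, so measurability is also expressed through
    it. *)
Definition coords (U : set space) : set (RT * RT * RT) := [set p | U (row3 p.1.1 p.1.2 p.2)].

Definition mvol U := measurable (coords U).

Definition obox (lo hi : space) : set space := [set x | forall i, lo 0 i < x 0 i < hi 0 i].

Lemma leb3_rect (A B C : set RT) : measurable A -> measurable B -> measurable C ->
  leb3 (A `*` B `*` C) = (leb A * leb B * leb C)%E.
Proof.
move=> mA mB mC; rewrite product_measure1E//; last exact: measurableX.
by congr (_ * _)%E; exact: product_measure1E.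
Qed.

Lemma coords_obox lo hi : coords (obox lo hi) =
  `]lo 0 ord0, hi 0 ord0[%classic `*` `]lo 0 (inord 1), hi 0 (inord 1)[%classic
    `*` `]lo 0 (inord 2), hi 0 (inord 2)[%classic.
Proof.
apply/seteqP; split => [[[a b] c] /= h|[[a b] c] /= [[h0 h1] h2]].
  have := h ord0; have := h (inord 1); have := h (inord 2); rewrite !row3E => h2 h1 h0.
  by rewrite /= !in_itv.
by move: h0 h1 h2; rewrite !in_itv /= => h0 h1 h2; apply: ord3P; rewrite row3E.
Qed.

Lemma mvol_obox lo hi : mvol (obox lo hi).
Proof.
rewrite /mvol coords_obox; apply: measurableX; last exact: measurable_itv.
by apply: measurableX; exact: measurable_itv.
Qed.

Lemma prod3 (F : 'I_3 -> R) : \prod_i F i = F ord0 * F (inord 1) * F (inord 2).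
Proof.
rewrite !big_ord_recl big_ord0 mulr1 mulrA; congr (_ * F _ * F _); apply/val_inj;
  by rewrite /= inordK.
Qed.

Lemma lebesgue_itv_oo (a b : R) : a <= b -> leb `]a, b[%classic = (b - a)%:E.
Proof.
rewrite le_eqVlt => /predU1P[->|ab]; rewrite lebesgue_measure_itv /= lte_fin.
  by rewrite ltxx subrr.
by rewrite ab EFinB.
Qed.

Lemma volume_obox lo hi : (forall i, lo 0 i <= hi 0 i) ->
  volume (obox lo hi) = (\prod_i (hi 0 i - lo 0 i))%:E.
Proof.
move=> le; transitivity (leb3 (coords (obox lo hi))); first by [].
rewrite coords_obox leb3_rect; [|exact: measurable_itv..].
rewrite prod3 !EFinM; congr (_ * _ * _)%E; exact: lebesgue_itv_oo.
Qed.

Lemma volume_mono U W : mvol U -> mvol W -> U `<=` W -> (volume U <= volume W)%E.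
Proof.
move=> mU mW UW; apply: (@le_measure _ _ _ leb3); rewrite ?inE//.
by move=> [[a b] c]; exact: UW.
Qed.

Lemma volume_ge0 U : (0 <= volume U)%E.
Proof. exact: (@measure_ge0 _ _ _ leb3). Qed.

Lemma mvolC U : mvol U -> mvol (~` U).
Proof. exact: measurableC. Qed.

Lemma mvolU U W : mvol U -> mvol W -> mvol (U `|` W).
Proof. exact: measurableU. Qed.

Lemma mvolI U W : mvol U -> mvol W -> mvol (U `&` W).
Proof. exact: measurableI. Qed.

Lemma mvolD U W : mvol U -> mvol W -> mvol (U `\` W).
Proof. exact: measurableD. Qed.

Lemma mvol_countable (I : Type) (F : I -> set space) : countable [set: I] ->
  (forall i, mvol (F i)) -> mvol (\bigcup_i F i).
Proof.
move=> cI mF; rewrite /mvol.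
rewrite (_ : coords _ = \bigcup_i coords (F i)); last first.
  by apply/seteqP; split => p [i _ h]; exists i.
exact: countable_bigcupT_measurable.
Qed.

(** An open set is the countable union of the cubes with rational centre and radius that it
    contains. *)
Lemma mvol_open U : open U -> mvol U.
Proof.
move=> oU.
pose F (q : rat * rat * rat * rat) : set space :=
  let c := row3 (ratr q.1.1.1) (ratr q.1.1.2) (ratr q.1.2) : space in
  let B := obox (\row_i (c 0 i - ratr q.2)) (\row_i (c 0 i + ratr q.2)) in
  if pselect (B `<=` U) then B else set0.
have -> : U = \bigcup_q F q.
  apply/seteqP; split => [x Ux|x [q _]]; last first.
    by rewrite /F; case: pselect => // BU; exact: BU.
  have /nbhs_coordP[e e0 he] : nbhs x U by exact: open_nbhs_nbhs.
  have e20 : 0 < e / 2 by rewrite divr_gt0.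
  have [r] := rat_in_itvoo e20; rewrite in_itv /= => /andP[r0 re].
  have app (a : R) : exists q, `|a - ratr q| < ratr r.
    have [|q] := @rat_in_itvoo R (a - ratr r) (a + ratr r); first lra.
    by rewrite in_itv /= => /andP[q1 q2]; exists q; rewrite ltr_norml; apply/andP; split; lra.
  have [q0 h0] := app (x 0 ord0); have [q1 h1] := app (x 0 (inord 1)).
  have [q2 h2] := app (x 0 (inord 2)).
  exists (q0, q1, q2, r) => //; rewrite /F /=.
  set c : space := row3 (ratr q0) (ratr q1) (ratr q2).
  have hc : forall i, `|x 0 i - c 0 i| < ratr r by apply: ord3P; rewrite row3E.
  case: pselect => [_|] /=.
    by move=> i; rewrite !mxE; have := hc i; rewrite /c mxE ltr_norml => /andP[a1 a2]; apply/andP; split; lra.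
  case=> y hy; apply: he => i; have := hy i; have := hc i; rewrite [(\row_ _ _) _ _]mxE [(\row_ _ _) _ _]mxE.
  rewrite !ltr_norml => /andP[a1 a2] /andP[b1 b2]; apply/andP; split; lra.
apply: mvol_countable; first exact: countableP.
by move=> q; rewrite /F /=; case: pselect => _ /=; [exact: mvol_obox|exact: measurable0].
Qed.

Lemma mvol_closed U : closed U -> mvol U.
Proof. by move=> cU; rewrite -[U]setCK; apply: mvolC; apply: mvol_open; exact: closed_openC. Qed.

Lemma open_eucl_ball (x : space) (r : R) : open (eucl_ball x r).
Proof.
have [r0|r0] := leP r 0.
  rewrite (_ : eucl_ball x r = set0); first exact: open0.
  by apply/seteqP; split => // y; rewrite /eucl_ball /= ltNge (le_trans r0)// eucl_dist_ge0.
pose S (y : space) := \sum_i (x 0 i - y 0 i) ^+ 2.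
have -> : eucl_ball x r = S @^-1` [set z | z < r ^+ 2].
  apply/seteqP; split => y; rewrite /eucl_ball /= => h; last exact: eucl_dist_lt_sq.
  have S0 : 0 <= S y by rewrite sumr_ge0// => i _; rewrite sqr_ge0.
  by rewrite -[S y]sqr_sqrtr// ltr_sqr ?nnegrE ?sqrtr_ge0// ltW.
apply: open_comp; last exact: open_lt.
move=> y _; pose d i : space -> R := fun z => x 0 i - z 0 i.
have c i : {for y, continuous (d i)}.
  by apply: continuousB; [exact: cst_continuous|exact: coord_continuous].
have cM i : {for y, continuous (d i \* d i)} by apply: continuousM; exact: c.
have -> : S = (d ord0 \* d ord0) \+ (d (inord 1) \* d (inord 1)) \+ (d (inord 2) \* d (inord 2)).
  by apply/funext => z; rewrite /S sum3 !expr2.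
by apply: continuousD; [apply: continuousD|]; exact: cM.
Qed.

End Volume.

Section NullSets.
Context {R : realType}.
Local Notation space := 'rV[R]_3.
Local Notation leb := (@lebesgue_measure R).
Local Notation leb3 := ((leb \x leb) \x leb)%E.
Implicit Types (U W Z : set space) (lo hi x y : space).

Definition planes (s : seq ('I_3 * R)) : set space :=
  [set x | exists2 h, h \in s & x 0 h.1 = h.2].

Lemma volumeU_le U W : mvol U -> mvol W -> (volume (U `|` W) <= volume U + volume W)%E.
Proof. by move=> mU mW; exact: (@measureU2 _ _ _ leb3). Qed.

Lemma volume0 : volume (@set0 space) = 0%E.
Proof. exact: (@measure0 _ _ _ leb3). Qed.

Lemma mvol_plane d (c : R) : mvol [set x : space | x 0 d = c].
Proof.
apply: mvol_closed; rewrite (_ : [set x | _] = (fun x : space => x 0 d) @^-1` [set c]); last first.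
  by [].
apply: closed_comp => // x _; exact: coord_continuous.
Qed.

Lemma volume_plane d (c : R) : volume [set x : space | x 0 d = c] = 0%E.
Proof.
pose A (i : 'I_3) : set (measurableTypeR R) := if i == d then [set c] else setT.
have mA i : measurable (A i) by rewrite /A; case: ifP => // _; exact: measurable_set1.
transitivity (leb3 (A ord0 `*` A (inord 1) `*` A (inord 2))).
  congr (leb3 _); apply/seteqP; split => [[[a b] e] /= h|[[a b] e] /=]; rewrite /A.
    have k i : (row3 a b e : space) 0 i = [:: a; b; e]`_i by rewrite mxE.
    have {}h (i : 'I_3) : A i ([:: a; b; e]`_i).
      by rewrite /A; case: eqP => // ->; rewrite /= -h mxE.
    have := h ord0; have := h (inord 1); have := h (inord 2); rewrite !inordK//.
  rewrite -!/(A _) => -[[h0 h1] h2].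
  have h : forall i, A i ((row3 a b e : space) 0 i) by apply: ord3P; rewrite row3E.
  by have := h d; rewrite /A eqxx.
rewrite leb3_rect//.
have Ad : leb (A d) = 0%E by rewrite /A eqxx; exact: lebesgue_measure_set1.
move: d A mA Ad; apply: ord3P => A mA ->; by rewrite ?mul0e ?mule0 ?mul0e.
Qed.

Lemma planes_nil : planes [::] = set0.
Proof. by apply/seteqP; split => // x [h]; rewrite in_nil. Qed.

Lemma planes_cons h s : planes (h :: s) = [set x : space | x 0 h.1 = h.2] `|` planes s.
Proof.
apply/seteqP; split => [x [k]|x [e|[k ks e]]].
- by rewrite inE => /predU1P[->|ks] e; [left|right; exists k].
- by exists h => //; rewrite mem_head.
- by exists k => //; rewrite inE ks orbT.
Qed.

Lemma mvol_planes s : mvol (planes s).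
Proof.
elim: s => [|h s IH]; first by rewrite planes_nil; exact: measurable0.
by rewrite planes_cons; apply: mvolU => //; exact: mvol_plane.
Qed.

Lemma volume_planes s : volume (planes s) = 0%E.
Proof.
elim: s => [|h s IH]; first by rewrite planes_nil volume0.
apply/eqP; rewrite eq_le volume_ge0 andbT planes_cons.
rewrite (le_trans (volumeU_le _ _))//; [exact: mvol_plane|exact: mvol_planes|].
by rewrite volume_plane IH adde0.
Qed.

Lemma volume_le_planes U W s : mvol U -> mvol W -> U `<=` W `|` planes s ->
  (volume U <= volume W)%E.
Proof.
move=> mU mW UW; have mP := mvol_planes s.
apply: (le_trans (volume_mono mU (mvolU mW mP) UW)).
by rewrite (le_trans (volumeU_le mW mP))// volume_planes adde0.
Qed.

End NullSets.

(** * Density at interior, exterior and face points *)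

Section Density.
Context {R : realType}.
Local Notation space := 'rV[R]_3.
Local Notation leb := (@lebesgue_measure R).
Local Notation leb3 := ((leb \x leb) \x leb)%E.
Implicit Types (U W Z : set space) (lo hi x y : space) (r : R).

Lemma mvol_ball x r : mvol (eucl_ball x r).
Proof. by apply: mvol_open; exact: open_eucl_ball. Qed.

Lemma in_ball_half x y r : 0 < r -> (forall i, `|x 0 i - y 0 i| < r / 2) -> eucl_ball x r y.
Proof.
move=> r0 h; rewrite /eucl_ball /=; apply: eucl_dist_lt_sq => //; rewrite sum3.
have sq i : (x 0 i - y 0 i) ^+ 2 < (r / 2) ^+ 2.
  by rewrite -real_normK ?num_real// ltr_sqr ?nnegrE// divr_ge0// ltW.
have := sq ord0; have := sq (inord 1); have := sq (inord 2).
have -> : (r / 2) ^+ 2 = r ^+ 2 / 4 by rewrite expr_div_n -natrX.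
have : 0 < r ^+ 2 by rewrite exprn_gt0.
lra.
Qed.

Lemma in_ball_coord x y r i : eucl_ball x r y -> `|x 0 i - y 0 i| < r.
Proof. by rewrite /eucl_ball /=; exact: le_lt_trans (coord_le_eucl_dist _ _ _). Qed.

Lemma volume_ball_le x r : 0 < r -> (volume (eucl_ball x r) <= (8 * r ^+ 3)%:E)%E.
Proof.
move=> r0; pose lo : space := \row_i (x 0 i - r); pose hi : space := \row_i (x 0 i + r).
apply: (@le_trans _ _ (volume (obox lo hi))).
  apply: volume_mono; [exact: mvol_ball|exact: mvol_obox|].
  move=> y xy i; rewrite !mxE; have := in_ball_coord i xy.
  by rewrite ltr_norml => /andP[a b]; apply/andP; split; lra.
rewrite volume_obox; last by move=> i; rewrite !mxE; lra.
rewrite prod3 !mxE lee_fin le_eqVlt; apply/orP; left; apply/eqP; ring.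
Qed.

Lemma prod_half d (r : R) (f : 'I_3 -> R) : f d = r / 2 -> (forall j, j != d -> f j = r) ->
  \prod_i f i = r ^+ 3 / 2.
Proof.
move=> fd fj; rewrite (bigD1 d)//= fd (eq_bigr (fun=> r)) => [|j]; last exact: fj.
by rewrite prod3_neq; ring.
Qed.

Lemma volume_ball_fin x r : 0 < r -> volume (eucl_ball x r) \is a fin_num.
Proof.
by move=> r0; rewrite ge0_fin_numE ?volume_ge0// (le_lt_trans (volume_ball_le x r0))// ltry.
Qed.

(** The cube of half-width r/2 about [x] lies in the ball, because 3 (r/2)^2 < r^2; its half on one
    side of the plane has volume r^3 / 2. The flag [b] selects the lower side. *)
Lemma half_box_volume W x r d b : 0 < r -> mvol W ->
  (forall y, (forall i, `|x 0 i - y 0 i| < r / 2) ->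
    (if b then y 0 d < x 0 d else x 0 d < y 0 d) -> W y) ->
  ((r ^+ 3 / 2)%:E <= volume (W `&` eucl_ball x r))%E.
Proof.
move=> r0 mW h.
pose lo : space := \row_i (if (i == d) && ~~ b then x 0 i else x 0 i - r / 2).
pose hi : space := \row_i (if (i == d) && b then x 0 i else x 0 i + r / 2).
have lh i : lo 0 i <= hi 0 i.
  by rewrite !mxE; case: (i == d); case: (b) => /=; lra.
have <- : volume (obox lo hi) = (r ^+ 3 / 2)%:E.
  rewrite volume_obox//; congr (_%:E); apply: (@prod_half d).
    by rewrite !mxE eqxx; case: (b) => /=; lra.
  by move=> j /negbTE jd; rewrite !mxE jd /=; lra.
apply: volume_mono; [exact: mvol_obox|apply: mvolI => //; exact: mvol_ball|].
move=> y hy.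
have hy' i : `|x 0 i - y 0 i| < r / 2.
  have := hy i; rewrite !mxE ltr_norml; case: (i == d); case: (b) => /= /andP[? ?]; apply/andP; split; lra.
split; last exact: in_ball_half.
apply: h => //; have := hy d; rewrite !mxE eqxx.
by case: (b) => /= /andP[].
Qed.

Lemma volume_ball_gt0 x r : 0 < r -> 0 < fine (volume (eucl_ball x r)).
Proof.
move=> r0; rewrite -lte_fin fineK ?volume_ball_fin//.
apply: (@lt_le_trans _ _ (r ^+ 3 / 2)%:E); first by rewrite lte_fin divr_gt0// exprn_gt0.
rewrite -[eucl_ball x r]setTI.
by apply: (@half_box_volume _ _ _ ord0 true) => //; exact: measurableT.
Qed.

Definition ratio U x r := fine (volume (U `&` eucl_ball x r)) / fine (volume (eucl_ball x r)).

Lemma density_interior U x : nbhs x U -> has_density U x 1.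
Proof.
move=> /nbhs_coordP[e e0 he]; rewrite /has_density; apply: cvg_near_cst; near=> r.
have r0 : 0 < r by near: r; exact: nbhs_right_gt.
have re : r < e by near: r; exact: nbhs_right_lt.
rewrite (_ : U `&` eucl_ball x r = eucl_ball x r).
  by rewrite divff// gt_eqF// volume_ball_gt0.
apply/seteqP; split => [y []//|y xy]; split => //; apply: he => i.
exact: lt_trans (in_ball_coord i xy) re.
Unshelve. all: by end_near. Qed.

Lemma density_exterior U x : nbhs x (~` U) -> has_density U x 0.
Proof.
move=> /nbhs_coordP[e e0 he]; rewrite /has_density; apply: cvg_near_cst; near=> r.
have r0 : 0 < r by near: r; exact: nbhs_right_gt.
have re : r < e by near: r; exact: nbhs_right_lt.
rewrite (_ : U `&` eucl_ball x r = set0); first by rewrite volume0 mul0r.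
apply/seteqP; split => // y [Uy xy]; apply: he Uy => i.
exact: lt_trans (in_ball_coord i xy) re.
Unshelve. all: by end_near. Qed.

(** The bounds are (c / 2) / (8 c) = 1 / 16 and its complement; they apply with c = r^3, where 8 r^3
    is the volume of the cube around the ball. *)
Lemma half_ratio (a b v : \bar R) (c : R) : 0 < c ->
  ((c / 2)%:E <= a)%E -> ((c / 2)%:E <= b)%E -> (v <= (8 * c)%:E)%E -> v = (a + b)%E ->
  1 / 16 <= fine a / fine v <= 15 / 16.
Proof.
move=> c0 ca cb vc vab.
have c20 : (0 <= (c / 2)%:E)%E by rewrite lee_fin divr_ge0// ltW.
have a0 := le_trans c20 ca; have b0 := le_trans c20 cb.
have fa : a \is a fin_num.
  by rewrite ge0_fin_numE// (le_lt_trans _ (ltry (8 * c)))// (le_trans _ vc)// vab leeDl.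
have fb : b \is a fin_num.
  by rewrite ge0_fin_numE// (le_lt_trans _ (ltry (8 * c)))// (le_trans _ vc)// vab leeDr.
move: ca cb vc; rewrite vab -(fineK fa) -(fineK fb) -EFinD !lee_fin /= => ca cb vc.
by apply/andP; split; [rewrite ler_pdivlMr|rewrite ler_pdivrMr]; lra.
Qed.

(** Near [x] the set is one side of a plane, up to the plane itself. The crude volume bounds keep
    the ratio within [1/16, 15/16], so its limit can be neither 0 nor 1. *)
Lemma essential_boundary_half U x d b e : mvol U -> 0 < e ->
  (forall y, (forall i, `|x 0 i - y 0 i| < e) ->
    (if b then y 0 d < x 0 d else x 0 d < y 0 d) -> U y) ->
  (forall y, (forall i, `|x 0 i - y 0 i| < e) ->
    (if ~~ b then y 0 d < x 0 d else x 0 d < y 0 d) -> ~ U y) ->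
  essential_boundary U x.
Proof.
move=> mU e0 hin hout.
suff key t : has_density U x t -> 1 / 16 <= t <= 15 / 16.
  by split => /key; lra.
rewrite /has_density => cvt.
have cl : closed [set s : R | 1 / 16 <= s <= 15 / 16].
  rewrite (_ : [set s | _] = `[1 / 16, 15 / 16]%classic); first exact: itv_closed.
  by apply/seteqP; split => s /=; rewrite in_itv.
suff nr : \forall r \near (0 : R)^'+, [set s : R | 1 / 16 <= s <= 15 / 16] (ratio U x r).
  exact: (@closed_cvg _ _ _ _ (ratio U x) _ cl nr _ cvt).
near=> r.
have r0 : 0 < r by near: r; exact: nbhs_right_gt.
have re : r < e by near: r; exact: nbhs_right_lt.
have lt_half i (y : space) : `|x 0 i - y 0 i| < r / 2 -> `|x 0 i - y 0 i| < e by lra.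
have h1 : ((r ^+ 3 / 2)%:E <= volume (U `&` eucl_ball x r))%E.
  by apply: (@half_box_volume _ _ _ d b) => // y hy; apply: hin => i; apply/lt_half/hy.
have h2 : ((r ^+ 3 / 2)%:E <= volume (~` U `&` eucl_ball x r))%E.
  apply: (@half_box_volume _ _ _ d (~~ b)) => //; first exact: mvolC.
  by move=> y hy; apply: hout => i; apply/lt_half/hy.
have h3 := volume_ball_le x r0.
have mB := mvol_ball x r.
have h4 : volume (eucl_ball x r) = (volume (U `&` eucl_ball x r) + volume (~` U `&` eucl_ball x r))%E.
  rewrite -[in LHS](setTI (eucl_ball x r)) -(setvU U) setIUl setUC.
  apply: (@measureU _ _ _ leb3).
  - exact: mvolI.
  - by apply: mvolI => //; exact: mvolC.
  - by apply/seteqP; split => // p [[a _] [b' _]].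
apply: (@half_ratio _ (volume (~` U `&` eucl_ball x r)) _ (r ^+ 3)) => //.
by rewrite exprn_gt0.
Unshelve. all: by end_near. Qed.

End Density.

(** * The grid of a cubical set *)

Section Grid.
Context {R : realType}.
Local Notation space := 'rV[R]_3.

(** One subdivision serves all three axes: it contains every level of a plane in (0, 1), whatever
    the normal. The same [N] and the same weights can then be used in every direction. *)
Definition is_grid (N : nat) (t : nat -> R) (s : seq ('I_3 * R)) :=
  [/\ t 0%N = 0, t N = 1, (forall i, (i < N)%N -> t i < t i.+1) &
      forall h, h \in s -> 0 < h.2 < 1 -> exists2 i, (i <= N)%N & t i = h.2].

Lemma grid_exists (s : seq ('I_3 * R)) : exists N t, is_grid N t s.
Proof.
pose T : seq R := sort <=%O (undup (0 :: 1 :: [seq h.2 | h <- s & 0 < h.2 < 1])).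
have memT x : (x \in T) = [|| x == 0, x == 1 | x \in [seq h.2 | h <- s & 0 < h.2 < 1]].
  by rewrite mem_sort mem_undup !inE.
have T01 x : x \in T -> 0 <= x <= 1.
  rewrite memT => /or3P[/eqP->|/eqP->|]; rewrite ?lexx ?ler01//.
  by case/mapP => h; rewrite mem_filter => /andP[/andP[h0 h1] _] ->; rewrite !ltW.
have sT : sorted <%O T.
  by rewrite lt_sorted_uniq_le sort_uniq undup_uniq sort_le_sorted.
have T0 : 0 \in T by rewrite memT eqxx.
have T1 : 1 \in T by rewrite memT eqxx orbT.
have szT : (0 < size T)%N by case: (T) T0.
pose t i := nth 1 T i; exists (size T).-1, t.
have tlt i j : (i < j)%N -> (j < size T)%N -> t i < t j.
  by move=> ij jT; apply: (sorted_ltn_nth lt_trans) => //; rewrite inE (ltn_trans ij).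
have tle i j : (i <= j)%N -> (j < size T)%N -> t i <= t j.
  by rewrite leq_eqVlt => /predU1P[->//|ij] jT; exact/ltW/tlt.
have tT i : (i < size T)%N -> 0 <= t i <= 1 by move=> iT; apply/T01/mem_nth.
split.
- apply/eqP; rewrite eq_le; have /andP[-> _] := tT _ szT; rewrite andbT.
  have := T0; move=> /(nthP 1)[i iT <-]; exact: tle.
- apply/eqP; rewrite eq_le; have szT' : ((size T).-1 < size T)%N by rewrite prednK.
  have /andP[_ ->] := tT _ szT'.
  have := T1; move=> /(nthP 1)[i iT <-]; apply: tle => //.
  by rewrite -ltnS prednK.
- by move=> i iT; apply: tlt => //; rewrite -ltn_predRL.
- move=> h hs h01; have : h.2 \in T.
    by rewrite memT; apply/or3P/Or33/mapP; exists h => //; rewrite mem_filter h01.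
  by move=> /(nthP 1)[i iT <-]; exists i => //; rewrite -ltnS prednK.
Qed.

Context (N : nat) (t : nat -> R) (s : seq ('I_3 * R)).
Hypothesis gridP : is_grid N t s.

Let t0 : t 0%N = 0. Proof. by case: gridP. Qed.
Let tN : t N = 1. Proof. by case: gridP. Qed.
Let tS i : (i < N)%N -> t i < t i.+1. Proof. by case: gridP => _ _ h _; exact: h. Qed.

Lemma grid_lt i j : (i < j)%N -> (j <= N)%N -> t i < t j.
Proof.
elim: j => // j IH; rewrite ltnS leq_eqVlt => /predU1P[->|ij] jN; first exact: tS.
exact: lt_trans (IH ij (ltnW jN)) (tS jN).
Qed.

Lemma grid_le i j : (i <= j)%N -> (j <= N)%N -> t i <= t j.
Proof. by rewrite leq_eqVlt => /predU1P[->//|ij] jN; exact/ltW/grid_lt. Qed.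

Lemma grid_ge0 i : (i <= N)%N -> 0 <= t i.
Proof. by move=> iN; rewrite -t0 grid_le. Qed.

Lemma grid_le1 i : (i <= N)%N -> t i <= 1.
Proof. by move=> iN; rewrite -tN grid_le. Qed.

Lemma grid_locate (y : R) : 0 <= y <= 1 -> (forall i, (i <= N)%N -> y != t i) ->
  exists2 i, (i < N)%N & t i < y < t i.+1.
Proof.
move=> /andP[y0 y1] ny.
have [i [iN h1 h2]] : exists i, [/\ (i < N)%N, t i < y & y < t i.+1].
  have yN : y < t N by rewrite lt_neqAle ny//= tN.
  have y0' : t 0%N < y by rewrite lt_neqAle eq_sym ny//= t0.
  suff h m : (m <= N)%N -> y < t m -> exists i, [/\ (i < N)%N, t i < y & y < t i.+1] by exact: h yN.
  elim: m => [|m IH] mN ym; first by have := lt_trans ym y0'; rewrite ltxx.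
  have [ltm|gem] := ltP (t m) y; first by exists m.
  by apply: IH (ltnW mN) _; rewrite lt_neqAle ny ?(ltnW mN).
by exists i => //; rewrite h1.
Qed.

Definition grid_step i := t i.+1 - t i.

Lemma grid_step_gt0 i : (i < N)%N -> 0 < grid_step i.
Proof. by move=> iN; rewrite subr_gt0 tS. Qed.

Lemma grid_step_partial n : (n <= N)%N -> \sum_(i < n) grid_step i = t n.
Proof.
elim: n => [|n IH] nN; first by rewrite big_ord0 t0.
by rewrite big_ord_recr /= IH ?(ltnW nN)// /grid_step addrC subrK.
Qed.

Lemma grid_step_sum : \sum_(i < N) grid_step i = 1.
Proof. by rewrite grid_step_partial// tN. Qed.

Implicit Types c : 'I_3 -> nat.

Definition cell c : set space := obox (\row_i t (c i)) (\row_i t (c i).+1).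

Definition center c : space := \row_i ((t (c i) + t (c i).+1) / 2).

Lemma cell_center c : (forall i, (c i < N)%N) -> cell c (center c).
Proof. by move=> cN i; rewrite !mxE; have := tS (cN i); move=> h; apply/andP; split; lra. Qed.

Context (X : set space).
Hypothesis X_cube : X `<=` unit_cube.
Hypothesis X_closed : closed X.
Hypothesis X_boundary : boundary X `<=` planes s.

Definition in_X c : bool := `[< X (center c) >].

(** A boundary point of [X] lies on a plane of [s], whose level would be a grid value strictly
    between two consecutive ones. *)
Lemma cell_interior c x : (forall i, (c i < N)%N) -> cell c x -> X x -> nbhs x X.
Proof.
move=> cN cx Xx; apply: contrapT => nX.
have [h hs xh] : planes s x.
  by apply: X_boundary; split => //; exact: subset_closure.
have := cx h.1; rewrite !mxE xh => /andP[h1 h2].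
have h01 : 0 < h.2 < 1.
  rewrite (le_lt_trans _ h1) ?(lt_le_trans h2)// ?grid_le1 ?grid_ge0// ltnW//.
case: gridP => _ _ _ /(_ h hs h01)[i iN ti].
move: h1 h2; rewrite -ti; have [ic|ci] := leqP i (c h.1).
  by move=> h1; have := lt_le_trans h1 (grid_le ic (ltnW (cN _))); rewrite ltxx.
by move=> _ h2; have := lt_le_trans h2 (grid_le ci iN); rewrite ltxx.
Qed.

Lemma cell_in_or_out c x y : (forall i, (c i < N)%N) -> cell c x -> cell c y -> X x -> X y.
Proof.
move=> cN; apply: segment_in_or_out => //; last by move=> z; exact: cell_interior.
move=> a b u ha hb /andP[u0 u1] i; have := ha i; have := hb i; rewrite !mxE.
set p := t _; set q := t _; set a' := a 0 i; set b' := b 0 i => /andP[b1 b2] /andP[a1 a2].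
have -> : a' + u * (b' - a') = (1 - u) * a' + u * b' by ring.
(* For u < 1 the strict inequalities are inherited from [a]; at u = 1 they come from [b]. *)
have [->|u1'] := eqVneq u 1; first by rewrite subrr mul0r add0r mul1r b1.
have u1'' : 0 < 1 - u by rewrite subr_gt0 lt_neqAle u1'.
have k1 : (1 - u) * p < (1 - u) * a' by rewrite ltr_pM2l.
have k2 : (1 - u) * a' < (1 - u) * q by rewrite ltr_pM2l.
have k3 : u * p <= u * b' by rewrite ler_wpM2l// ltW.
have k4 : u * b' <= u * q by rewrite ler_wpM2l// ltW.
by apply/andP; split; lra.
Qed.

Lemma cell_in c x : (forall i, (c i < N)%N) -> in_X c -> cell c x -> X x.
Proof. by move=> cN /asboolP Xc cx; exact: cell_in_or_out (cell_center cN) cx Xc. Qed.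

Lemma cell_out c x : (forall i, (c i < N)%N) -> ~~ in_X c -> cell c x -> ~ X x.
Proof.
move=> cN /asboolPn nXc cx Xx; apply: nXc.
exact: cell_in_or_out cx (cell_center cN) Xx.
Qed.

Definition grid_planes : seq ('I_3 * R) := [seq (d, t i) | d <- enum 'I_3, i <- iota 0 N.+1].

Lemma grid_planesP (x : space) d i : (i <= N)%N -> x 0 d = t i -> planes grid_planes x.
Proof.
move=> iN xd; exists (d, t i) => //; apply/allpairsP; exists (d, i); split => //.
  by rewrite mem_enum.
by rewrite mem_iota.
Qed.

Definition coord3 (i j k : nat) (d : 'I_3) : nat := nth 0%N [:: i; j; k] d.

Lemma coord3_lt (i j k : nat) : (i < N)%N -> (j < N)%N -> (k < N)%N ->
  forall d, (coord3 i j k d < N)%N.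
Proof. by move=> iN jN kN; apply: ord3P; rewrite /coord3 /= ?inordK. Qed.

Lemma unit_cube_cell x : unit_cube x -> ~ planes grid_planes x ->
  exists i j k, [/\ (i < N)%N, (j < N)%N, (k < N)%N & cell (coord3 i j k) x].
Proof.
move=> hx np.
have loc d : exists2 i, (i < N)%N & t i < x 0 d < t i.+1.
  apply: grid_locate; first by have := hx d; rewrite mxE.
  by move=> i iN; apply/eqP => e; apply: np; exact: (grid_planesP iN e).
have [i iN hi] := loc ord0; have [j jN hj] := loc (inord 1); have [k kN hk] := loc (inord 2).
exists i, j, k; split => //; rewrite /cell.
by apply: ord3P; rewrite !mxE /coord3 /= ?inordK.
Qed.

Definition in_X3 i j k : bool := in_X (coord3 i j k).

Lemma volume_bigsetU (I : choiceType) (r : seq I) (F : I -> set space) : uniq r ->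
  (forall i, mvol (F i)) -> (forall i j x, F i x -> F j x -> i = j) ->
  mvol (\big[setU/set0]_(i <- r) F i) /\
  volume (\big[setU/set0]_(i <- r) F i) = (\sum_(i <- r) volume (F i))%E.
Proof.
move=> + mF dF; elim: r => [_|i r IH] /=.
  by rewrite !big_nil volume0; split => //; exact: measurable0.
move=> /andP[ir /IH[mr vr]]; rewrite !big_cons -vr; split; first exact: mvolU.
have di : F i `&` \big[setU/set0]_(j <- r) F j = set0.
  apply/seteqP; split => // x [Fix]; rewrite -bigcup_seq => -[j /= jr Fjx].
  by move: ir; rewrite (dF _ _ _ Fix Fjx) jr.
apply: (@measureU _ _ _ ((@lebesgue_measure R \x @lebesgue_measure R) \x @lebesgue_measure R)%E); [exact: mF|exact: mr|].
apply/seteqP; split => // p /= [h1 h2].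
by have : (set0 : set space) (row3 p.1.1 p.1.2 p.2) by rewrite -di; split.
Qed.

Lemma sum_triple (F : 'I_N -> 'I_N -> 'I_N -> R) :
  \sum_(p : 'I_N * 'I_N * 'I_N) F p.1.1 p.1.2 p.2 = \sum_i \sum_j \sum_k F i j k.
Proof.
rewrite -(pair_bigA _ (fun q k => F q.1 q.2 k)) /=.
by rewrite -(pair_bigA _ (fun i j => \sum_k F i j k)).
Qed.

Lemma cell_inj i j k i' j' k' x :
  (i < N)%N -> (j < N)%N -> (k < N)%N -> (i' < N)%N -> (j' < N)%N -> (k' < N)%N ->
  cell (coord3 i j k) x -> cell (coord3 i' j' k') x -> [/\ i = i', j = j' & k = k'].
Proof.
move=> iN jN kN i'N j'N k'N h h'.
have uniq1 y a b : (a < N)%N -> (b < N)%N -> t a < y < t a.+1 -> t b < y < t b.+1 -> a = b.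
  move=> aN bN /andP[a1 a2] /andP[b1 b2]; apply/eqP; rewrite eqn_leq.
  rewrite leqNgt; apply/andP; split; last rewrite leqNgt; apply/negP => ab.
    by have := lt_trans (le_lt_trans (grid_le ab (ltnW aN)) a1) b2; rewrite ltxx.
  by have := lt_trans (le_lt_trans (grid_le ab (ltnW bN)) b1) a2; rewrite ltxx.
have := h ord0; have := h (inord 1); have := h (inord 2).
have := h' ord0; have := h' (inord 1); have := h' (inord 2).
rewrite !mxE /coord3 !inordK//= => a2 a1 a0 b2 b1 b0.
by split; [exact: uniq1 b0 a0|exact: uniq1 b1 a1|exact: uniq1 b2 a2].
Qed.

Definition cell_union (P : nat -> nat -> nat -> bool) : set space :=
  \big[setU/set0]_(p <- [seq p : 'I_N * 'I_N * 'I_N <- index_enum _ | P p.1.1 p.1.2 p.2])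
    cell (coord3 p.1.1 p.1.2 p.2).

Lemma cell_unionP P x : cell_union P x <->
  exists i j k, [/\ (i < N)%N, (j < N)%N, (k < N)%N, P i j k & cell (coord3 i j k) x].
Proof.
rewrite /cell_union -bigcup_seq; split.
  move=> [[[i j] k] /=]; rewrite mem_filter => /andP[/= Pijk _] h.
  by exists i, j, k; rewrite !ltn_ord.
move=> [i [j [k [iN jN kN Pijk h]]]]; exists (Ordinal iN, Ordinal jN, Ordinal kN) => //=.
by rewrite mem_filter mem_index_enum andbT.
Qed.

Lemma volume_cell_union P :
  mvol (cell_union P) /\ volume (cell_union P) = (vol3 N grid_step P)%:E.
Proof.
have [|||m ->] := @volume_bigsetU _ [seq p : 'I_N * 'I_N * 'I_N <- index_enum _ | P p.1.1 p.1.2 p.2]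
   (fun p => cell (coord3 p.1.1 p.1.2 p.2)).
- by rewrite filter_uniq// index_enum_uniq.
- by move=> p; exact: mvol_obox.
- move=> [[i j] k] [[i' j'] k'] x /= h h'.
  by have [] := cell_inj _ _ _ _ _ _ h h'; rewrite ?ltn_ord// => /val_inj-> /val_inj-> /val_inj->.
split => //; rewrite big_filter big_mkcond /=.
rewrite (eq_bigr (fun p : 'I_N * 'I_N * 'I_N => (grid_step p.1.1 * grid_step p.1.2 * grid_step p.2 * (P p.1.1 p.1.2 p.2)%:R)%:E)).
  rewrite sumEFin; congr (_%:E).
  rewrite (sum_triple (fun i j k => grid_step i * grid_step j * grid_step k * (P i j k)%:R)).
  rewrite /vol3 /area /weight.
  under [RHS]eq_bigr do rewrite big_distrr /=.
  rewrite [RHS]exchange_big /=; apply: eq_bigr => i _.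
  under [RHS]eq_bigr do rewrite !big_distrr /=.
  rewrite [RHS]exchange_big /=; apply: eq_bigr => j _; apply: eq_bigr => k _.
  rewrite /slice; ring.
move=> [[i j] k] _ /=; case: ifP => _; last by rewrite mulr0.
rewrite mulr1 volume_obox.
  by rewrite prod3 !mxE /coord3 !inordK.
by move=> d; rewrite !mxE; apply/ltW/tS; move: d; apply: coord3_lt.
Qed.

Lemma X_cell_union : cell_union in_X3 `<=` X /\ X `<=` cell_union in_X3 `|` planes grid_planes.
Proof.
split=> x; first by move=> /cell_unionP[i [j [k [iN jN kN]]]]; apply: cell_in; exact: coord3_lt.
move=> Xx; case: (pselect (planes grid_planes x)) => [|np]; [by right|left].
have [i [j [k [iN jN kN h]]]] := unit_cube_cell (X_cube Xx) np.
apply/cell_unionP; exists i, j, k; split => //.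
apply: contrapT => /negP nX; apply: (cell_out _ nX h) Xx; exact: coord3_lt.
Qed.

Lemma volume_X : volume X = (vol3 N grid_step in_X3)%:E.
Proof.
have [mU vU] := volume_cell_union in_X3; have [UX XU] := X_cell_union.
have mX : mvol X by exact: mvol_closed.
apply/eqP; rewrite eq_le -vU (volume_le_planes mX mU XU)/=.
exact: volume_mono.
Qed.

End Grid.

Lemma min_fin_gt0 (R : realDomainType) (I : finType) (f : I -> R) : (forall i, 0 < f i) ->
  exists2 e, 0 < e & forall i, e <= f i.
Proof.
move=> f0; exists (\big[Num.min/1]_i f i); last by move=> i; rewrite bigmin_le_cond.
by apply/bigmin_gtP; split.
Qed.

Lemma nbhs_obox (R : realType) (lo hi x : 'rV[R]_3) : obox lo hi x -> nbhs x (obox lo hi).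
Proof.
move=> h; apply/nbhs_coordP.
have [e e0 he] : exists2 e, 0 < e & forall i, e <= Num.min (x 0 i - lo 0 i) (hi 0 i - x 0 i).
  by apply: min_fin_gt0 => i; have /andP[h1 h2] := h i; rewrite lt_min !subr_gt0 h1.
exists e => // y hy i; have := he i; rewrite le_min => /andP[h1 h2].
by have := hy i; rewrite ltr_norml => /andP[a b]; apply/andP; split; lra.
Qed.

(** * Grid faces and the lower bound for the relative perimeter *)

Section Faces.
Context {R : realType}.
Local Notation space := 'rV[R]_3.
Context (N : nat) (t : nat -> R) (s : seq ('I_3 * R)).
Hypothesis gridP : is_grid N t s.
Context (X : set space).
Hypothesis X_closed : closed X.
Hypothesis X_boundary : boundary X `<=` planes s.

Implicit Types c : 'I_3 -> nat.

Definition up d c : 'I_3 -> nat := fun i => if i == d then (c i).+1 else c i.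

(** Lower corner of the upper face of cell [c] in direction [d], with a margin of [eta] times the
    cell width removed on every side so that distinct faces have positive distance. *)
Definition face_lo d c (eta : R) : space :=
  \row_i (if i == d then t (c i).+1 else t (c i) + eta * grid_step t (c i)).

Definition face_hi d c (eta : R) : space :=
  \row_i (if i == d then t (c i).+1 else t (c i).+1 - eta * grid_step t (c i)).

(** Only upper faces with a further cell above are considered, so each face inside the cube occurs
    once and faces on its boundary never do. *)
Definition active d c := ((c d).+1 < N)%N && (in_X t X c != in_X t X (up d c)).

Lemma up_lt d c : (forall i, (c i < N)%N) -> ((c d).+1 < N)%N -> forall i, (up d c i < N)%N.
Proof. by move=> cN dN i; rewrite /up; case: eqP => // ->. Qed.

Lemma face_in d c (eta : R) (x : space) : (forall i, (c i < N)%N) -> 0 < eta ->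
  cbox (face_lo d c eta) (face_hi d c eta) x ->
  x 0 d = t (c d).+1 /\ forall i, i != d -> t (c i) < x 0 i < t (c i).+1.
Proof.
move=> cN eta0 h; split.
  by have := h d; rewrite !mxE eqxx => h'; apply/eqP; rewrite eq_le andbC.
move=> i /negbTE id; have := h i; rewrite !mxE id => /andP[h1 h2].
have := mulr_gt0 eta0 (grid_step_gt0 gridP (cN i)) => h3.
by apply/andP; split; lra.
Qed.

Lemma face_essential d c (eta : R) : (forall i, (c i < N)%N) -> 0 < eta -> active d c ->
  cbox (face_lo d c eta) (face_hi d c eta) `<=` essential_boundary X `\` boundary unit_cube.
Proof.
move=> cN eta0 /andP[dN act] x /(face_in cN eta0)[xd xi].
have uN := up_lt cN dN.
have tlt := grid_lt gridP.
(* The open box made of the cell, its upper neighbour and the open face between them. *)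
have neigh : nbhs x (obox (\row_i t (c i)) (\row_i (if i == d then t (c i).+2 else t (c i).+1))).
  apply: nbhs_obox => i; rewrite !mxE; case: eqP => [->|/eqP/xi//].
  by rewrite xd !tlt//; lia.
have [e e0 he] := (nbhs_coordP _ _).1 neigh.
have low (y : space) : (forall i, `|x 0 i - y 0 i| < e) -> y 0 d < x 0 d -> cell t c y.
  move=> hy yd i; have := he y hy i; rewrite !mxE; case: eqP => [->|//].
  by move=> /andP[-> _]; rewrite -xd.
have high (y : space) : (forall i, `|x 0 i - y 0 i| < e) -> x 0 d < y 0 d -> cell t (up d c) y.
  move=> hy yd i; have := he y hy i; rewrite !mxE /up; case: eqP => [->|//].
  by move=> /andP[_ ->]; rewrite -xd yd.
split.
  apply: (@essential_boundary_half _ _ _ d (in_X t X c) e) => //; first exact: mvol_closed.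
  - move=> y hy; case: (boolP (in_X t X c)) => [cX yd|ncX yd].
      exact: (cell_in gridP X_closed X_boundary cN cX (low _ hy yd)).
    apply: (cell_in gridP X_closed X_boundary uN _ (high _ hy yd)).
    by move: act; rewrite (negbTE ncX); case: in_X.
  - move=> y hy; case: (boolP (in_X t X c)) => [cX yd|ncX yd].
      apply: (cell_out gridP X_closed X_boundary uN _ (high _ hy yd)).
      by move: act; rewrite cX; case: in_X.
    exact: (cell_out gridP X_closed X_boundary cN ncX (low _ hy yd)).
(* That box also lies in the unit cube, so [x] is interior to it. *)
case=> _; apply; apply/nbhs_coordP; exists e => // y hy i.
have := he y hy i; rewrite !mxE => /andP[h1 h2].
have := grid_ge0 gridP (ltnW (cN i)); move=> h3.
apply/andP; split; first lra.
apply/ltW/(lt_le_trans h2); case: eqP => [->|_]; apply: (grid_le1 gridP) => //; exact: cN.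
Qed.

(** With different directions, the first face lies on a grid level in coordinate [d], and the margin
    keeps the second away from all levels there. With the same direction, the cells differ in a
    coordinate in which levels or margins separate. *)
Lemma face_separated d c d' c' (eta : R) : (forall i, (c i < N)%N) -> (forall i, (c' i < N)%N) ->
  0 < eta -> (d != d') || [exists i, c i != c' i] ->
  dist_separated (cbox (face_lo d c eta) (face_hi d c eta)) (cbox (face_lo d' c' eta) (face_hi d' c' eta)).
Proof.
move=> cN c'N eta0 ne.
have tlt := grid_lt gridP; have tle := grid_le gridP.
have w0 i : 0 < eta * grid_step t (c i) by rewrite mulr_gt0// (grid_step_gt0 gridP).
have w0' i : 0 < eta * grid_step t (c' i) by rewrite mulr_gt0// (grid_step_gt0 gridP).
have [dd|dd] := eqVneq d d'.
  move: ne; rewrite dd eqxx /= => /existsP[i]; rewrite neq_ltn => /orP[lt|lt].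
  - have [] // := @separated_cbox _ _ (face_lo d' c eta) (face_hi d' c eta) (face_lo d' c' eta) (face_hi d' c' eta) i.
    rewrite !mxE; case: eqP => _; first by apply: tlt; [rewrite ltnS|exact: c'N].
    have := tle _ _ lt (ltnW (c'N i)); have := w0 i; have := w0' i; lra.
  - have [] // := @separated_cbox _ _ (face_lo d' c' eta) (face_hi d' c' eta) (face_lo d' c eta) (face_hi d' c eta) i.
    rewrite !mxE; case: eqP => _; first by apply: tlt; rewrite ?ltnS.
    have := tle _ _ lt (ltnW (cN i)); have := w0 i; have := w0' i; lra.
have [lt|ge] := ltnP (c d) (c' d).
- have [] // := @separated_cbox _ _ (face_lo d c eta) (face_hi d c eta) (face_lo d' c' eta) (face_hi d' c' eta) d.
  rewrite !mxE eqxx (negbTE dd).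
  have := tle _ _ lt (ltnW (c'N d)); have := w0' d; lra.
- have [] // := @separated_cbox _ _ (face_lo d' c' eta) (face_hi d' c' eta) (face_lo d c eta) (face_hi d c eta) d.
  rewrite !mxE eqxx (negbTE dd).
  have : t (c' d).+1 <= t (c d).+1 by apply: tle; rewrite ?ltnS ?cN.
  have := w0' d; lra.
Qed.

Local Notation index := ('I_3 * ('I_N * 'I_N * 'I_N))%type.

Let cc (q : index) : 'I_3 -> nat := coord3 q.2.1.1 q.2.1.2 q.2.2.

Let ccN (q : index) i : (cc q i < N)%N.
Proof. by move: i; apply: coord3_lt. Qed.

Definition face_area : R :=
  \sum_(q : index | active q.1 (cc q)) \prod_(j < 3 | j != q.1) grid_step t (cc q j).

Lemma perimeter_ge_eta (eta : R) : 0 < eta < 1 / 2 ->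
  (((1 - 2 * eta) ^+ 2 * face_area)%:E * unit_area <= relative_perimeter X)%E.
Proof.
move=> /andP[eta0 eta1].
pose F (q : index) := cbox (face_lo q.1 (cc q) eta) (face_hi q.1 (cc q) eta).
pose r : seq index := [seq q : index <- index_enum _ | active q.1 (cc q)].
apply: (@le_trans _ _ (hausdorff2 (\big[setU/set0]_(q <- r) F q))); last first.
  apply: hausdorff2_mono => x; rewrite -bigcup_seq => -[q /=].
  rewrite mem_filter => /andP[act _]; exact: face_essential.
apply: (@le_trans _ _ (\sum_(q <- r) hausdorff2 (F q))%E); last first.
  apply: hausdorff2_big_separated; first by rewrite filter_uniq// index_enum_uniq.
  move=> q q' _ _ qq'; apply: face_separated => //.
  apply: contraNT qq'; rewrite negb_or negbK negb_exists => /andP[/eqP dd /forallP h].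
  have h' i : cc q i = cc q' i by have := h i; rewrite negbK => /eqP.
  move: dd h' {h}; case: q => d [[i j] k]; case: q' => d' [[i' j'] k'] /= -> h.
  have := h ord0; have := h (inord 1); have := h (inord 2); rewrite /cc /coord3 /= !inordK//=.
  by move=> /val_inj-> /val_inj-> /val_inj->.
rewrite big_filter.
apply: (@le_trans _ _ (\sum_(q : index | active q.1 (cc q))
    (((1 - 2 * eta) ^+ 2 * \prod_(j < 3 | j != q.1) grid_step t (cc q j))%:E * unit_area))%E).
  rewrite -ge0_sume_distrl; last first.
    move=> q _; rewrite lee_fin mulr_ge0 ?sqr_ge0// prodr_ge0// => j _.
    exact/ltW/(grid_step_gt0 gridP).
  by rewrite sumEFin -big_distrr.
apply: lee_sum => q _.
have lt j : j != q.1 -> face_lo q.1 (cc q) eta 0 j < face_hi q.1 (cc q) eta 0 j.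
  move=> /negbTE jq; rewrite !mxE jq -subr_gt0.
  have := grid_step_gt0 gridP (ccN q j); rewrite /grid_step => h.
  have -> : t (cc q j).+1 - eta * (t (cc q j).+1 - t (cc q j)) -
     (t (cc q j) + eta * (t (cc q j).+1 - t (cc q j))) =
     (1 - 2 * eta) * (t (cc q j).+1 - t (cc q j)) by ring.
  by rewrite mulr_gt0//; lra.
have eqd : face_lo q.1 (cc q) eta 0 q.1 = face_hi q.1 (cc q) eta 0 q.1 by rewrite !mxE eqxx.
have [|_ /(_ lt)] := hausdorff2_face eqd.
  by move=> j; have [->|jq] := eqVneq j q.1; [rewrite eqd|exact/ltW/lt].
congr (_ <= _)%E; congr (_%:E * _)%E; rewrite !prod3_neq.
set a := tperm _ _ _; set b := tperm _ _ (inord 2).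
have ne (k : 'I_3) : k != ord0 -> tperm ord0 q.1 k != q.1.
  by move=> k0; apply: contra k0 => /eqP k1; rewrite -(inj_eq (@perm_inj _ (tperm ord0 q.1))) tpermL k1.
have /negbTE a1 : a != q.1 by apply: ne; rewrite -val_eqE /= inordK.
have /negbTE b1 : b != q.1 by apply: ne; rewrite -val_eqE /= inordK.
by rewrite !mxE a1 b1 /grid_step; ring.
Qed.

Lemma face_area_ge0 : 0 <= face_area.
Proof.
apply: sumr_ge0 => q _; apply: prodr_ge0 => j _; exact/ltW/(grid_step_gt0 gridP).
Qed.

Lemma perimeter_ge : (face_area%:E * unit_area <= relative_perimeter X)%E.
Proof.
have c_lty := @unit_area_lty R; have c0 : (0 <= @unit_area R)%E by exact: hausdorff2_ge0.
set C := fine (@unit_area R); have CE : @unit_area R = C%:E by rewrite fineK// ge0_fin_numE.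
have C0 : 0 <= C by exact: fine_ge0.
have A0 := face_area_ge0.
apply/lee_addgt0Pr => e e0.
(* As (1 - 2 eta)^2 >= 1 - 4 eta, the shrinking costs at most [eta * k]. *)
pose k := 4 * face_area * C + 1.
have k0 : 0 < k by rewrite /k ltr_wpDl// !mulr_ge0.
pose eta := Num.min (1 / 4) (e / k).
have eta0 : 0 < eta by rewrite lt_min !divr_gt0.
have eta1 : eta <= 1 / 4 by rewrite ge_min lexx.
have etak : eta * k <= e by rewrite -ler_pdivlMr// ge_min lexx orbT.
have := @perimeter_ge_eta eta; rewrite eta0 /= => h.
have eta2 : eta < 1 / 2 by lra.
apply: (le_trans _ (leeD2r e%:E (h eta2))).
rewrite CE -!EFinM -EFinD lee_fin.
have -> : (1 - 2 * eta) ^+ 2 * face_area * C = face_area * C - eta * (4 * face_area * C) + 4 * eta ^+ 2 * (face_area * C) by ring.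
have h1 : 0 <= 4 * eta ^+ 2 * (face_area * C).
  by apply: mulr_ge0; apply: mulr_ge0 => //; exact: sqr_ge0.
have h2 : eta * (4 * face_area * C) <= eta * k by rewrite ler_pM2l// /k lerDl.
lra.
Qed.

Lemma sum_jumps (b : nat -> bool) (x : R) :
  x * (jumps N b)%:R = \sum_(i < N) (if (i.+1 < N)%N && (b i != b i.+1) then x else 0).
Proof.
rewrite /jumps; case: N => [|M] /=; first by rewrite !big_ord0 mulr0.
rewrite big_ord_recr /= ltnn /= addr0 natr_sum big_distrr /=.
apply: eq_bigr => i _; rewrite !ltnS ltn_ord /=.
by case: (b i != b i.+1); rewrite ?mulr1 ?mulr0.
Qed.

(** Faces are grouped by direction, then by lines of cells: direction 0 gives the columns of the
    slices, direction 1 their rows, direction 2 the term [line_sum]. *)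
Lemma face_area_per3 : face_area = per3 N (grid_step t) (in_X3 t X).
Proof.
rewrite /face_area -(pair_big_dep xpredT (fun d p => active d (cc (d, p)))
  (fun d p => \prod_(j < 3 | j != d) grid_step t (cc (d, p) j))) /= sum3.
have upE i j k : [/\ up ord0 (coord3 i j k) = coord3 i.+1 j k,
    up (inord 1) (coord3 i j k) = coord3 i j.+1 k & up (inord 2) (coord3 i j k) = coord3 i j k.+1].
  split; apply/funext; apply: ord3P;
    by rewrite /up /coord3 -?val_eqE /= ?inordK// -?val_eqE /= ?inordK.
have e01 : (inord 1 == ord0 :> 'I_3) = false by rewrite -val_eqE /= inordK.
have e02 : (inord 2 == ord0 :> 'I_3) = false by rewrite -val_eqE /= inordK.
have e12 : (inord 1 == inord 2 :> 'I_3) = false by rewrite -val_eqE /= !inordK.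
set w := grid_step t; set B := in_X3 t X.
have prod_d (f : 'I_3 -> R) : [/\ \prod_(j < 3 | j != ord0) f j = f (inord 1) * f (inord 2),
   \prod_(j < 3 | j != inord 1) f j = f ord0 * f (inord 2) &
   \prod_(j < 3 | j != inord 2) f j = f ord0 * f (inord 1)].
  rewrite !prod3_neq tperm1 !perm1 !tpermR; split => //.
    by rewrite tpermD// ?e12// eq_sym e02.
  by rewrite mulrC tpermD// 1?eq_sym ?e01 ?e12.
rewrite /per3 /per2.
under [X in _ = X + _]eq_bigr do rewrite mulrDr.
rewrite big_split /= [X in _ = X + _]addrC.
have cN1 (i j k : nat) : (coord3 i j k ord0 = i) * (coord3 i j k (inord 1) = j) * (coord3 i j k (inord 2) = k).
  by rewrite /coord3 /= !inordK.
congr (_ + _ + _).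
- rewrite big_mkcond /= (eq_bigr (fun p : 'I_N * 'I_N * 'I_N =>
    if (p.1.1.+1 < N)%N && (B p.1.1 p.1.2 p.2 != B p.1.1.+1 p.1.2 p.2) then w p.1.2 * w p.2 else 0)); last first.
    move=> [[i j] k] _ /=; have [-> _ _] := prod_d (fun j0 => w (cc (ord0, (i, j, k)) j0)).
    by rewrite /active /cc /= !cN1; have [-> _ _] := upE i j k.
  rewrite (sum_triple (fun i j k : 'I_N => if (i.+1 < N)%N && (B i j k != B i.+1 j k) then w j * w k else 0)).
  rewrite /row_jumps /transp /slice.
  under [RHS]eq_bigr do rewrite big_distrr /=.
  under [RHS]eq_bigr => k _.
    under eq_bigr => j _ do rewrite mulrA (sum_jumps (fun i => B i j k)).
    over.
  rewrite exchange_big /= [RHS]exchange_big /=; apply: eq_bigr => j _.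
  rewrite exchange_big /=; apply: eq_bigr => k _; apply: eq_bigr => i _.
  by rewrite (mulrC (w k)).
- rewrite big_mkcond /= (eq_bigr (fun p : 'I_N * 'I_N * 'I_N =>
    if (p.1.2.+1 < N)%N && (B p.1.1 p.1.2 p.2 != B p.1.1 p.1.2.+1 p.2) then w p.1.1 * w p.2 else 0)); last first.
    move=> [[i j] k] _ /=; have [_ -> _] := prod_d (fun j0 => w (cc (inord 1, (i, j, k)) j0)).
    by rewrite /active /cc /= !cN1; have [_ -> _] := upE i j k.
  rewrite (sum_triple (fun i j k : 'I_N => if (j.+1 < N)%N && (B i j k != B i j.+1 k) then w i * w k else 0)).
  rewrite /row_jumps /slice.
  under [RHS]eq_bigr do rewrite big_distrr /=.
  under [RHS]eq_bigr => k _.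
    under eq_bigr => i _ do rewrite mulrA (sum_jumps (fun j => B i j k)).
    over.
  rewrite [RHS]exchange_big /=; apply: eq_bigr => i _.
  rewrite exchange_big /=; apply: eq_bigr => k _; apply: eq_bigr => j _.
  by rewrite (mulrC (w k)).
- rewrite big_mkcond /= (eq_bigr (fun p : 'I_N * 'I_N * 'I_N =>
    if (p.2.+1 < N)%N && (B p.1.1 p.1.2 p.2 != B p.1.1 p.1.2 p.2.+1) then w p.1.1 * w p.1.2 else 0)); last first.
    move=> [[i j] k] _ /=; have [_ _ ->] := prod_d (fun j0 => w (cc (inord 2, (i, j, k)) j0)).
    by rewrite /active /cc /= !cN1; have [_ _ ->] := upE i j k.
  rewrite (sum_triple (fun i j k : 'I_N => if (k.+1 < N)%N && (B i j k != B i j k.+1) then w i * w j else 0)).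
  rewrite /line_sum; apply: eq_bigr => i _; rewrite big_distrr /=; apply: eq_bigr => j _.
  by rewrite mulrA (sum_jumps (fun k => B i j k)).
Qed.

End Faces.

(** * Boxes and isometries of the cube *)

Section Boxes.
Context {R : realType}.
Local Notation space := 'rV[R]_3.
Implicit Types (a lo hi x y : space).

Lemma compact_cbox lo hi : compact (cbox lo hi).
Proof.
rewrite (_ : cbox lo hi = [set v : space | forall i, `[lo 0 i, hi 0 i]%classic (v 0 i)]).
  apply: (@rV_compact R 3 (fun i => `[lo 0 i, hi 0 i]%classic)) => i.
  exact: segment_compact.
by apply/seteqP; split => x h i; have := h i; rewrite /= in_itv.
Qed.

Lemma closed_cbox lo hi : closed (cbox lo hi).
Proof. by apply: compact_closed; [exact: norm_hausdorff|exact: compact_cbox]. Qed.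

Lemma boxE a : box a = cbox 0 a.
Proof. by apply/seteqP; split => x h i; have := h i; rewrite ?mxE. Qed.

Lemma sub_obox_cbox lo hi : obox lo hi `<=` cbox lo hi.
Proof. by move=> x h i; have /andP[h1 h2] := h i; rewrite !ltW. Qed.

Lemma cbox_sub_planes lo hi : exists s, cbox lo hi `<=` obox lo hi `|` planes s.
Proof.
exists ([seq (i, lo 0 i) | i <- enum 'I_3] ++ [seq (i, hi 0 i) | i <- enum 'I_3]) => x hx.
case: (pselect (exists i, x 0 i = lo 0 i)) => [[i xi]|nlo].
  right; exists (i, lo 0 i) => //; rewrite mem_cat; apply/orP; left.
  by apply: map_f; rewrite mem_enum.
case: (pselect (exists i, x 0 i = hi 0 i)) => [[i xi]|nhi].
  right; exists (i, hi 0 i) => //; rewrite mem_cat; apply/orP; right.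
  by apply: map_f; rewrite mem_enum.
left => i; have /andP[h1 h2] := hx i; rewrite !lt_neqAle h1 h2 !andbT.
apply/andP; split; apply/eqP => e; first by apply: nlo; exists i.
by apply: nhi; exists i.
Qed.

Lemma mvol_cbox lo hi : mvol (cbox lo hi).
Proof. by apply: mvol_closed; exact: closed_cbox. Qed.

Lemma volume_cbox lo hi : (forall i, lo 0 i <= hi 0 i) ->
  volume (cbox lo hi) = (\prod_i (hi 0 i - lo 0 i))%:E.
Proof.
move=> le; transitivity (volume (obox lo hi)); last exact: volume_obox.
apply/eqP; rewrite eq_le; apply/andP; split.
  have [s h] := cbox_sub_planes lo hi.
  exact: volume_le_planes (mvol_cbox _ _) (mvol_obox _ _) h.
by apply: volume_mono; [exact: mvol_obox|exact: mvol_cbox|exact: sub_obox_cbox].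
Qed.

Lemma boundary_cbox lo hi : exists s, boundary (cbox lo hi) `<=` planes s.
Proof.
have [s h] := cbox_sub_planes lo hi; exists s => x [].
rewrite -((closure_id _).1 (@closed_cbox lo hi)).
move=> /h[ox|//] nx; exfalso; apply: nx.
by have := nbhs_obox ox; apply: filterS; exact: sub_obox_cbox.
Qed.

Lemma cubical_box a : (forall i, a 0 i <= 1) -> cubical (box a).
Proof.
move=> a1; split.
- by move=> x h i; have /andP[h1 h2] := h i; rewrite mxE h1 (le_trans h2).
- by rewrite boxE; exact: compact_cbox.
- by rewrite boxE; have [s hs] := boundary_cbox 0 a; exists s.
Qed.

Lemma volume_box a : (forall i, 0 <= a 0 i) -> volume (box a) = (\prod_i a 0 i)%:E.
Proof.
move=> a0; rewrite boxE volume_cbox; last by move=> i; rewrite mxE.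
by congr (_%:E); apply: eq_bigr => i _; rewrite mxE subr0.
Qed.

Lemma interior_unit_cube x i : nbhs x unit_cube -> 0 < x 0 i < 1.
Proof.
move=> /nbhs_coordP[e e0 he]; pose y (u : R) : space := \row_j (x 0 j + u).
have hy u : `|u| < e -> unit_cube (y u).
  by move=> ue; apply: he => j; rewrite mxE opprD addrA subrr sub0r normrN.
have e2 : `|e / 2| < e by rewrite ger0_norm; lra.
have e2' : `|- (e / 2)| < e by rewrite normrN.
have := hy _ e2 i; have := hy _ e2' i; rewrite !mxE => /andP[h1 _] /andP[_ h2].
by apply/andP; split; lra.
Qed.

(** A point of the essential boundary lies in the box but not in its interior. If it is also
    interior to the unit cube, its coordinates lie strictly between 0 and 1, so it is on an upper
    face with [a 0 i < 1]. *)
Lemma perimeter_box_le a : (forall i, 0 <= a 0 i <= 1) ->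
  (relative_perimeter (box a) <=
   (\sum_(i < 3 | (a 0 i < 1)%R) \prod_(j < 3 | j != i) a 0 j)%:E * unit_area)%E.
Proof.
move=> a01; have a0 i : 0 <= a 0 i by have /andP[] := a01 i.
pose lo (i : 'I_3) : space := \row_j (if j == i then a 0 i else 0).
have facele i : (hausdorff2 (cbox (lo i) a) <= (\prod_(j < 3 | j != i) a 0 j)%:E * unit_area)%E.
  have [||h _] := @hausdorff2_face R (lo i) a i.
  - by rewrite mxE eqxx.
  - by move=> j; rewrite mxE; case: eqP => [->|].
  apply: (le_trans h); rewrite (eq_bigr (fun j => a 0 j))// => j /negbTE ji.
  by rewrite mxE ji subr0.
rewrite -sumEFin ge0_sume_distrl; last by move=> i _; rewrite lee_fin prodr_ge0.
apply: (@le_trans _ _ (\sum_(i < 3 | (a 0 i < 1)%R) hausdorff2 (cbox (lo i) a))%E); last first.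
  by apply: lee_sum => i _; exact: facele.
rewrite -big_filter; apply: le_trans (hausdorff2_big _ _); apply: hausdorff2_mono.
move=> x [[nd0 nd1] nbx].
have nin : ~ nbhs x (box a) by move=> /density_interior.
have nout : ~ nbhs x (~` box a) by move=> /density_exterior.
have bx : box a x.
  apply: contrapT => nx; apply: nout; apply: open_nbhs_nbhs; split => //.
  by apply: closed_openC; rewrite boxE; exact: closed_cbox.
have ux : nbhs x unit_cube.
  apply: contrapT => nux; apply: nbx; split => //; apply: subset_closure.
  by move=> i; rewrite mxE; have /andP[h1 h2] := bx i; have /andP[_ h3] := a01 i; rewrite h1 (le_trans h2).
have [i xi] : exists i, x 0 i = a 0 i.
  apply: contrapT => ne; apply: nin.
  have : nbhs x (obox 0 a).
    apply: nbhs_obox => i; rewrite mxE; have /andP[-> _] := interior_unit_cube i ux.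
    have /andP[_ h2] := bx i; rewrite lt_neqAle h2 andbT.
    by apply/eqP => e; apply: ne; exists i.
  by apply: filterS; rewrite boxE; exact: sub_obox_cbox.
rewrite -bigcup_seq; exists i => /=.
  by rewrite mem_filter mem_index_enum andbT -xi; have /andP[] := interior_unit_cube i ux.
move=> j; rewrite mxE; have /andP[h1 h2] := bx j; rewrite h2 andbT.
by case: eqP => [->|//]; rewrite xi.
Qed.

End Boxes.

Section Isometries.
Context {R : realType}.
Local Notation space := 'rV[R]_3.

(** The flag follows the convention of [flush]: where [b d] is false the coordinate is reflected, so
    that an initial interval becomes a final one. *)
Definition reflection_perm (b : 'I_3 -> bool) (tau : {perm 'I_3}) (x : space) : space :=
  \row_d (if b d then x 0 (tau d) else 1 - x 0 (tau d)).

Lemma reflection_perm_box b tau (a : space) :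
  reflection_perm b tau @` box a =
  cbox (\row_d (if b d then 0 else 1 - a 0 (tau d))) (\row_d (if b d then a 0 (tau d) else 1)).
Proof.
apply/seteqP; split => [_ [x hx <-] d|y hy].
  by rewrite !mxE; have /andP[h1 h2] := hx (tau d); case: (b d); apply/andP; split; lra.
pose x : space := \row_k (let d := (tau^-1)%g k in if b d then y 0 d else 1 - y 0 d).
exists x.
  move=> k; rewrite mxE /=; have := hy ((tau^-1)%g k); rewrite !mxE permKV.
  by case: (b _) => /andP[h1 h2]; apply/andP; split; lra.
by apply/rowP => d; rewrite !mxE /= permK; case: (b d) => //; ring.
Qed.

Lemma reflection_perm_isometry b tau : cube_isometry (reflection_perm b tau).
Proof.
split.
  rewrite /unit_cube reflection_perm_box boxE; congr cbox; apply/rowP => d; rewrite !mxE;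
  by case: (b d); rewrite ?subrr.
move=> x y _ _; rewrite /eucl_dist; congr Num.sqrt.
rewrite [RHS](reindex_inj (@perm_inj _ tau)) /=; apply: eq_bigr => d _; rewrite !mxE.
by case: (b d) => //; ring.
Qed.

Context (N : nat) (t : nat -> R) (s : seq ('I_3 * R)).
Hypothesis gridP : is_grid N t s.
Context (X : set space).
Hypothesis X_cube : X `<=` unit_cube.
Hypothesis X_closed : closed X.
Hypothesis X_boundary : boundary X `<=` planes s.

Lemma weight_flush (P : nat -> bool) (n : nat) (b : bool) : (n <= N)%N ->
  (forall i, (i < N)%N -> P i = b (+) (n <= i)%N) ->
  weight N (grid_step t) P = if b then t n else 1 - t n.
Proof.
move=> nN hP; have lt : weight N (grid_step t) (fun i => i < n)%N = t n.
  rewrite -(grid_step_partial gridP nN) (big_ord_widen N (grid_step t) nN) [RHS]big_mkcond /=.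
  by apply: eq_bigr => i _; case: ltnP => _; rewrite ?mulr1 ?mulr0.
case: b hP => hP.
  by rewrite -lt; apply: eq_weight => i iN; rewrite hP// ltnNge.
rewrite -lt -(weightN (grid_step_sum gridP)); apply: eq_weight => i iN.
by rewrite hP// -leqNgt.
Qed.

(** The image of the box is bounded by grid levels and contains the same open cells as [X], so the
    two differ only on grid planes. *)
Lemma equivalent_box (P : 'I_3 -> nat -> bool) (a : space) (tau : {perm 'I_3}) :
  (forall d, flush N (P d)) ->
  (forall i j k, (i < N)%N -> (j < N)%N -> (k < N)%N ->
     in_X3 t X i j k = [&& P ord0 i, P (inord 1) j & P (inord 2) k]) ->
  (forall d, a 0 (tau d) = weight N (grid_step t) (P d)) ->
  equivalent X (box a).
Proof.
move=> fP BP aP.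
have /choice[n hn] d : exists n, exists b : bool, (n <= N)%N /\ forall i, (i < N)%N -> P d i = b (+) (n <= i)%N.
  exact: fP.
have /choice[b hb] := hn.
have wP d := weight_flush (hb d).1 (hb d).2.
exists (reflection_perm b tau); first exact: reflection_perm_isometry.
rewrite reflection_perm_box; set W := cbox _ _.
have mX : mvol X by exact: mvol_closed.
have mW : mvol W by exact: mvol_cbox.
have WE (x : space) : W x <-> forall d, if b d then 0 <= x 0 d <= t (n d) else t (n d) <= x 0 d <= 1.
  by split => h d; have := h d; rewrite !mxE aP wP; case: (b d) => //; rewrite opprB addrC subrK.
have cellP (x : space) i j k : (i < N)%N -> (j < N)%N -> (k < N)%N -> cell t (coord3 i j k) x ->
    (W x <-> in_X3 t X i j k).
  move=> iN jN kN h; rewrite BP//.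
  have cN := coord3_lt iN jN kN.
  have key d : (if b d then 0 <= x 0 d <= t (n d) else t (n d) <= x 0 d <= 1) = P d (coord3 i j k d).
    rewrite (hb d).2//; have := h d; rewrite !mxE => /andP[h1 h2].
    have x0 : 0 <= x 0 d by rewrite (le_trans _ (ltW h1))// (grid_ge0 gridP)// ltnW.
    have x1 : x 0 d <= 1 by rewrite (le_trans (ltW h2))// (grid_le1 gridP).
    have nN := (hb d).1.
    have [nle|ltn] := leqP (n d) (coord3 i j k d).
      have le := grid_le gridP nle (ltnW (cN d)).
      by case: (b d) => /=; [apply/negbTE; rewrite negb_and -!ltNge (le_lt_trans le h1) orbT|rewrite x1 (le_trans le)// ltW].
    have le := grid_le gridP ltn nN.
    by case: (b d) => /=; [rewrite x0 (le_trans _ le)// ltW|apply/negbTE; rewrite negb_and -!ltNge (lt_le_trans h2 le)].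
  have k0 := key ord0; have k1 := key (inord 1); have k2 := key (inord 2).
  rewrite /coord3 /= !inordK//= in k0 k1 k2.
  split=> [/WE hW|/and3P[p0 p1 p2]].
    by rewrite -k0 -k1 -k2; apply/and3P; split; exact: hW.
  by apply/WE; apply: ord3P; rewrite ?k0 ?k1 ?k2.
have Wu : W `<=` unit_cube.
  move=> x /WE h d; rewrite mxE; have := h d; have nN := (hb d).1.
  have := grid_ge0 gridP nN; have := grid_le1 gridP nN.
  by case: (b d) => ? ? /andP[? ?]; apply/andP; split; lra.
apply/eqP; rewrite eq_le volume_ge0 andbT -(volume_planes (grid_planes N t)).
apply: volume_mono.
- by apply: mvolU; exact: mvolD.
- exact: mvol_planes.
move=> x [[Xx nWx]|[Wx nXx]]; apply: contrapT => np.
  have [i [j [k [iN jN kN h]]]] := unit_cube_cell gridP (X_cube Xx) np.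
  apply/nWx/(cellP _ _ _ _ iN jN kN h); apply: contrapT => /negP nX.
  by apply: (cell_out gridP X_closed X_boundary _ nX h) Xx; exact: coord3_lt.
have [i [j [k [iN jN kN h]]]] := unit_cube_cell gridP (Wu _ Wx) np.
apply: nXx; move/(cellP _ _ _ _ iN jN kN h): Wx => BX.
by apply: (cell_in gridP X_closed X_boundary _ BX h); exact: coord3_lt.
Qed.

End Isometries.

(** * Minimizers *)

Section Minimizers.
Context {R : realType}.
Local Notation space := 'rV[R]_3.
Implicit Types (X Y : set space) (V q : R).

Lemma box_ffun3 (a b c : R) (tau : {perm 'I_3}) (f : 'I_3 -> R) :
  f (tau^-1 ord0)%g = a -> f (tau^-1 (inord 1))%g = b -> f (tau^-1 (inord 2))%g = c ->
  forall d, (row3 a b c : space) 0 (tau d) = f d.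
Proof.
move=> h0 h1 h2 d; rewrite -{2}(permK tau d); move: (tau d).
by apply: ord3P; rewrite row3E.
Qed.

(** Both parts transfer [per3_extremal] from face area to relative perimeter; cancelling [unit_area]
    uses that it is positive and finite. *)
Lemma cubical_structure V q X : 0 < V -> V <= 1 / 2 -> 0 < q -> q ^+ 3 = V ->
  cubical_of_volume V X ->
  ((profile3 q V)%:E * unit_area <= relative_perimeter X)%E /\
  ((relative_perimeter X <= (profile3 q V)%:E * unit_area)%E ->
    [\/ profile3 q V = 3 * q ^+ 2 /\ equivalent X (box (row3 q q q)),
        profile3 q V = 2 * Num.sqrt V /\ equivalent X (box (row3 (Num.sqrt V) (Num.sqrt V) 1)) |
        profile3 q V = 1 /\ equivalent X (box (row3 V 1 1))]).
Proof.
move=> V0 V2 q0 qV [[Xc cX [s Xs]] vX].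
have clX : closed X by apply: compact_closed => //; exact: norm_hausdorff.
have [N [t gridP]] := grid_exists s.
have vol : vol3 N (grid_step t) (in_X3 t X) = V.
  by apply/EFin_inj; rewrite -vX (volume_X gridP Xc clX Xs).
have [ge eq] := per3_extremal (grid_step_gt0 gridP) (grid_step_sum gridP) V0 V2 q0 qV vol.
have c_lty := @unit_area_lty R; have c0 := @unit_area_gt0 R.
have cf : @unit_area R \is a fin_num by rewrite ge0_fin_numE// ltW.
have per := perimeter_ge gridP clX Xs; rewrite face_area_per3 in per.
split.
  by apply: le_trans per; rewrite lee_pmul2r// lee_fin.
move=> le; have {eq}[P [Q [S [[fP fQ fS] [BE ex]]]]] : exists P Q S, [/\ flush N P, flush N Q & flush N S] /\
    (forall i j k, (i < N)%N -> (j < N)%N -> (k < N)%N -> in_X3 t X i j k = [&& P i, Q j & S k]) /\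
    extremal q V (weight N (grid_step t) P) (weight N (grid_step t) Q) (weight N (grid_step t) S).
  apply: eq; have := le_trans per le; rewrite lee_pmul2r// lee_fin//.
pose D (d : 'I_3) : nat -> bool := nth P [:: P; Q; S] d.
have D0 : D ord0 = P by [].
have D1 : D (inord 1) = Q by rewrite /D inordK.
have D2 : D (inord 2) = S by rewrite /D inordK.
have fD d : flush N (D d) by move: d; apply: ord3P; rewrite ?D0 ?D1 ?D2.
have BD i j k : (i < N)%N -> (j < N)%N -> (k < N)%N ->
    in_X3 t X i j k = [&& D ord0 i, D (inord 1) j & D (inord 2) k].
  by rewrite D0 D1 D2; exact: BE.
have eqv (a b c : R) (tau : {perm 'I_3}) : weight N (grid_step t) (D (tau^-1 ord0)%g) = a ->
    weight N (grid_step t) (D (tau^-1 (inord 1))%g) = b ->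
    weight N (grid_step t) (D (tau^-1 (inord 2))%g) = c -> equivalent X (box (row3 a b c)).
  move=> h0 h1 h2; apply: (equivalent_box gridP Xc clX Xs (P := D) (tau := tau)) => //.
  by apply: (@box_ffun3 a b c tau (fun d => weight N (grid_step t) (D d))).
have e01 : (ord0 == inord 1 :> 'I_3) = false by rewrite -val_eqE /= inordK.
have e02 : (ord0 == inord 2 :> 'I_3) = false by rewrite -val_eqE /= inordK.
have e12 : (inord 1 == inord 2 :> 'I_3) = false by rewrite -val_eqE /= !inordK.
have e10 : (inord 1 == ord0 :> 'I_3) = false by rewrite eq_sym.
have e20 : (inord 2 == ord0 :> 'I_3) = false by rewrite eq_sym.
have e21 : (inord 2 == inord 1 :> 'I_3) = false by rewrite eq_sym.
(* The exceptional side may lie along any axis; the identity or one transposition brings it to its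
   place in [tube] or [slab]. *)
have eqv1 := @eqv _ _ _ 1%g erefl erefl erefl.
have eqv01 := @eqv _ _ _ (tperm ord0 (inord 1)) erefl erefl erefl.
have eqv02 := @eqv _ _ _ (tperm ord0 (inord 2)) erefl erefl erefl.
have eqv12 := @eqv _ _ _ (tperm (inord 1) (inord 2)) erefl erefl erefl.
rewrite invg1 !perm1 D0 D1 D2 in eqv1.
rewrite tpermV tpermL tpermR tpermD ?e02 ?e12// D0 D1 D2 in eqv01.
rewrite tpermV tpermL tpermR tpermD ?e01 ?e21// D0 D1 D2 in eqv02.
rewrite tpermV tpermL tpermR tpermD ?e10 ?e20// D0 D1 D2 in eqv12.
case: ex => [[T wP wQ wS]|[T ws]|[T ws]].
- apply: Or31; split; first exact: T.
  by rewrite wP wQ wS in eqv1; exact: eqv1.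
- apply: Or32; split; first exact: T.
  case: ws => [[wP wQ wS]|[wP wQ wS]|[wP wQ wS]].
  + by rewrite wP wQ wS in eqv1; exact: eqv1.
  + by rewrite wP wQ wS in eqv12; exact: eqv12.
  + by rewrite wP wQ wS in eqv02; exact: eqv02.
- apply: Or33; split; first exact: T.
  case: ws => [[wP wQ wS]|[wP wQ wS]|[wP wQ wS]].
  + by rewrite wP wQ wS in eqv1; exact: eqv1.
  + by rewrite wP wQ wS in eqv01; exact: eqv01.
  + by rewrite wP wQ wS in eqv02; exact: eqv02.
Qed.

Lemma row3_le (a b c : R) (Q : R -> Prop) : Q a -> Q b -> Q c ->
  forall i, Q ((row3 a b c : space) 0 i).
Proof. by move=> qa qb qc; apply: ord3P; rewrite row3E. Qed.

Lemma perimeter_sum (a b c : R) :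
  \sum_(i < 3 | ((row3 a b c : space) 0 i < 1)%R) \prod_(j < 3 | j != i) (row3 a b c : space) 0 j =
  (if a < 1 then b * c else 0) + (if b < 1 then a * c else 0) + (if c < 1 then a * b else 0).
Proof.
rewrite big_mkcond sum3 !row3E !prod3_neq tperm1 !perm1 !tpermR !row3E.
have e01 : (ord0 == inord 1 :> 'I_3) = false by rewrite -val_eqE /= inordK.
have e02 : (ord0 == inord 2 :> 'I_3) = false by rewrite -val_eqE /= inordK.
have e12 : (inord 1 == inord 2 :> 'I_3) = false by rewrite -val_eqE /= !inordK.
have e21 : (inord 2 == inord 1 :> 'I_3) = false by rewrite eq_sym.
by rewrite !tpermD ?e01 ?e02 ?e12 ?e21// !row3E (mulrC b a).
Qed.

Lemma box_candidate V (a b c : R) : 0 < a <= 1 -> 0 < b <= 1 -> 0 < c <= 1 -> a * b * c = V ->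
  cubical_of_volume V (box (row3 a b c : space)) /\
  (relative_perimeter (box (row3 a b c : space)) <=
   ((if a < 1 then b * c else 0) + (if b < 1 then a * c else 0) + (if c < 1 then a * b else 0))%:E * unit_area)%E.
Proof.
move=> /andP[a0 a1] /andP[b0 b1] /andP[c0 c1] abc; split; first split.
- by apply: cubical_box; exact: (@row3_le _ _ _ (fun u => u <= 1)).
- rewrite volume_box; last by apply: (@row3_le _ _ _ (fun u => 0 <= u)); exact: ltW.
  by rewrite prod3 !row3E abc.
rewrite -perimeter_sum; apply: perimeter_box_le.
by apply: (@row3_le _ _ _ (fun u => 0 <= u <= 1)); apply/andP; split=> //; exact: ltW.
Qed.

(** Upper bounds for the members of [L] suffice: they meet the general lower bound, and any
    minimizer, compared with one member, attains it too. Each optimal shape must then be in [L], but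
    only when its area is the minimum. *)
Lemma minimizers_of V q (L : set (set space)) : 0 < V -> V <= 1 / 2 -> 0 < q -> q ^+ 3 = V ->
  (forall Y, L Y -> cubical_of_volume V Y /\
     (relative_perimeter Y <= (profile3 q V)%:E * unit_area)%E) ->
  L !=set0 ->
  (profile3 q V = 3 * q ^+ 2 -> L (box (row3 q q q))) ->
  (profile3 q V = 2 * Num.sqrt V -> L (box (row3 (Num.sqrt V) (Num.sqrt V) 1))) ->
  (profile3 q V = 1 -> L (box (row3 V 1 1))) ->
  only_minimizers V L.
Proof.
move=> V0 V2 q0 qV LP [Y0 LY0] L1 L2 L3; split.
  move=> Y /LP[cY pY]; split; first exact: cY.
  move=> Z cZ; apply: le_trans pY _.
  have [h _] := cubical_structure V0 V2 q0 qV cZ; exact: h.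
move=> X [cX minX]; have [cY0 pY0] := LP _ LY0.
have [_ /(_ (le_trans (minX _ cY0) pY0))] := cubical_structure V0 V2 q0 qV cX.
case=> -[T e].
- exists (box (row3 q q q)); [exact: L1|exact: e].
- exists (box (row3 (Num.sqrt V) (Num.sqrt V) 1)); [exact: L2|exact: e].
- exists (box (row3 V 1 1)); [exact: L3|exact: e].
Qed.

End Minimizers.

Theorem proposition4p1 (R : realType) (V : R) (hV : 0 < V <= 1 / 2) :
  let V1 : R := (2 / 3) ^+ 6 in
  let V2 : R := 1 / 4 in
  [/\ V < V1 -> only_minimizers V [set cube V],
      V = V1 -> only_minimizers V [set cube V1; tube V1],
      V1 < V < V2 -> only_minimizers V [set tube V],
      V = V2 -> only_minimizers V [set tube V2; slab V2] &
      V2 < V -> only_minimizers V [set slab V]].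
Proof.
move=> V1 V2; have /andP[V0 Vh] := hV.
set q := V `^ 3^-1; set r := Num.sqrt V.
have q0 : 0 < q by exact: powR_gt0.
have qV : q ^+ 3 = V.
  by rewrite -powR_mulrn ?ltW// -powRrM mulVf ?powRr1 ?ltW.
have r0 : 0 < r by rewrite sqrtr_gt0.
have rV : r ^+ 2 = V by rewrite sqr_sqrtr// ltW.
have cubeE : cube V = box (row3 q q q) by [].
have tubeE : tube V = box (row3 r r 1) by rewrite /tube powR12_sqrt// ltW.
have slabE : slab V = box (row3 V 1 1) by [].
have q1 : q < 1.
  by rewrite ltNge; apply/negP => q1; have := exprn_ege1 3 q1; rewrite qV; lra.
have r1 : r < 1 by apply: sqr_ltW => //; rewrite rV expr1n; lra.
have V_lt1 : V < 1 by lra.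
have V1E : V1 = (4 / 9) ^+ 3.
  by rewrite /V1; field.
have cube_ok : cubical_of_volume V (cube V) /\ (relative_perimeter (cube V) <= (3 * q ^+ 2)%:E * unit_area)%E.
  rewrite cubeE; have qq : 0 < q <= 1 by rewrite q0 ltW.
  have [|h1 h2] := @box_candidate R V q q q qq qq qq; first by rewrite -qV; ring.
  by split => //; move: h2; rewrite q1; congr (_ <= _%:E * _)%E; ring.
have rr : 0 < r <= 1 by rewrite r0 ltW.
have one : 0 < (1 : R) <= 1 by rewrite ltr01 lexx.
have tube_ok : cubical_of_volume V (tube V) /\ (relative_perimeter (tube V) <= (2 * r)%:E * unit_area)%E.
  rewrite tubeE; have [|h1 h2] := @box_candidate R V r r 1 rr rr one; first by rewrite -rV; ring.
  by split => //; move: h2; rewrite r1 ltxx; congr (_ <= _%:E * _)%E; ring.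
have slab_ok : cubical_of_volume V (slab V) /\ (relative_perimeter (slab V) <= (1%:E * unit_area))%E.
  rewrite slabE; have VV : 0 < V <= 1 by rewrite V0 ltW.
  have [|h1 h2] := @box_candidate R V V 1 1 VV one one; first by ring.
  by split => //; move: h2; rewrite V_lt1 ltxx; congr (_ <= _%:E * _)%E; ring.
have [T1 T2 T3] := profile3_le q V; rewrite -/r in T2.
(* With q the cube root and r the square root of V, the three candidate areas
   compare as 3 q^2 : 2 r like q : 4 / 9 and as 2 r : 1 like V : 1 / 4. *)
have qlt : V < V1 -> q < 4 / 9.
  move=> h; rewrite ltNge; apply/negP => h'.
  have : (4 / 9 : R) ^+ 3 <= q ^+ 3 by rewrite lerXn2r// nnegrE; lra.
  by rewrite qV -V1E leNgt h.
have qgt : V1 < V -> 4 / 9 < q.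
  move=> h; rewrite ltNge; apply/negP => h'.
  have : q ^+ 3 <= (4 / 9 : R) ^+ 3 by rewrite lerXn2r// nnegrE; lra.
  by rewrite qV -V1E leNgt h.
have V1lt : V1 < 1 / 4 by rewrite V1E expr_div_n -!natrX; lra.
have lt32 : q < 4 / 9 -> 3 * q ^+ 2 < 2 * r.
  move=> h; apply: sqr_ltW; first by rewrite mulr_ge0// ltW.
  rewrite !exprMn rV -qV.
  have -> : 3 ^+ 2 * (q ^+ 2) ^+ 2 = 9 * q * q ^+ 3 by ring.
  by rewrite ltr_pM2r ?exprn_gt0// -natrX; lra.
have lt23 : 4 / 9 < q -> 2 * r < 3 * q ^+ 2.
  move=> h; apply: sqr_ltW; first by rewrite mulr_ge0// sqr_ge0.
  rewrite !exprMn rV -qV.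
  have -> : 3 ^+ 2 * (q ^+ 2) ^+ 2 = 9 * q * q ^+ 3 by ring.
  by rewrite ltr_pM2r ?exprn_gt0// -natrX; lra.
have lt21 : V < 1 / 4 -> 2 * r < 1.
  by move=> h; apply: sqr_ltW => //; rewrite exprMn rV expr1n -natrX; lra.
have lt12 : 1 / 4 < V -> 1 < 2 * r.
  move=> h; apply: sqr_ltW; first by rewrite mulr_ge0// ltW.
  by rewrite exprMn rV expr1n -natrX; lra.
(* The minimum is attained by one of its terms; in each range of [V] the strict comparisons
   eliminate the others. *)
have TE : [\/ profile3 q V = 3 * q ^+ 2, profile3 q V = 2 * r | profile3 q V = 1].
  rewrite /profile3 /Num.min; case: ifP => _; first exact: Or31.
  by case: ifP => _; [exact: Or32|exact: Or33].
split.
- move=> h; have a1 := lt32 (qlt h); have a2 := lt21 (lt_trans h V1lt).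
  have T : profile3 q V = 3 * q ^+ 2 by case: TE => e; lra.
  apply: (minimizers_of V0 Vh q0 qV); rewrite ?T.
  + by move=> Y ->.
  + by exists (cube V).
  + by move=> _; rewrite -cubeE.
  + by rewrite -/r => e; lra.
  + by move=> e; lra.
- move=> h; rewrite -h.
  (* At this volume cube and tube both have area 16/27, less than that of the slab. *)
  have q49 : q = 4 / 9.
    apply/eqP; rewrite -(@eqrXn2 _ 3)//; [|exact: ltW].
    by rewrite qV h V1E.
  have r827 : r = 8 / 27.
    apply/eqP; rewrite -(@eqrXn2 _ 2)//; [|exact: ltW].
    by rewrite rV h V1E; apply/eqP; field.
  have q2 : q ^+ 2 = 16 / 81 by rewrite q49 expr_div_n -!natrX.
  have T : profile3 q V = 3 * q ^+ 2 by case: TE => e; lra.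
  have T' : profile3 q V = 2 * r by lra.
  apply: (minimizers_of V0 Vh q0 qV).
  + by move=> Y [->|->]; [rewrite T|rewrite T'].
  + by exists (cube V); left.
  + by move=> _; left; rewrite -cubeE.
  + by move=> _; right; rewrite -tubeE.
  + by move=> e; lra.
- move=> /andP[h h']; have a1 := lt23 (qgt h); have a2 := lt21 h'.
  have T : profile3 q V = 2 * r by case: TE => e; lra.
  apply: (minimizers_of V0 Vh q0 qV); rewrite ?T.
  + by move=> Y ->.
  + by exists (tube V).
  + by move=> e; lra.
  + by move=> _; rewrite -tubeE.
  + by move=> e; lra.
- move=> h; rewrite -h; have a1 : 2 * r < 3 * q ^+ 2 by apply/lt23/qgt; rewrite h /V2.
  have r12 : r = 1 / 2.
    apply/eqP; rewrite -(@eqrXn2 _ 2)//; [|exact: ltW].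
    by rewrite rV h /V2 expr_div_n -!natrX; lra.
  have T : profile3 q V = 2 * r by case: TE => e; lra.
  have T' : profile3 q V = 1 by lra.
  apply: (minimizers_of V0 Vh q0 qV).
  + by move=> Y [->|->]; [rewrite T|rewrite T'].
  + by exists (tube V); left.
  + by move=> e; lra.
  + by move=> _; left; rewrite -tubeE.
  + by move=> _; right; rewrite -slabE.
- move=> h; have a1 := lt12 h.
  have a2 : 2 * r < 3 * q ^+ 2 by apply/lt23/qgt/(lt_trans V1lt).
  have T : profile3 q V = 1 by case: TE => e; lra.
  apply: (minimizers_of V0 Vh q0 qV); rewrite ?T.
  + by move=> Y ->.
  + by exists (slab V).
  + by move=> e; lra.
  + by rewrite -/r => e; lra.
  + by move=> _; rewrite -slabE.
Qed.
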